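(* Let $C\subset\mathbb{R}^2$ be a disjoint union of squares of areas $2^{-j}$, $j\in\{0,1,2,\dots\}$ (one for each $j$), together with a right isosceles triangle of area $2$ (disjoint from the squares). Let $D\subset\mathbb{R}^2$ be a disjoint union of rectangles $R_0,R_1,R_2,\dots$, where $R_j$ has area $2^{1-j}$ and diameter $2^{-j/2}\sqrt5$ (that is, $R_j$ has edge lengths $2^{-j/2}$ and $2\cdot2^{-j/2}$). All boundaries carry Dirichlet boundary conditions. Then $C$ and $D$ are isospectral and not isoheat. In particular: (i) for $t\to\infty$, $$Q_C(t)=\frac{1024}{9\pi^4}e^{-5\pi^2t/4}+O(e^{-2\pi^2t});$$ (ii) for $t\to\infty$, $$Q_D(t)=\frac{1152}{9\pi^4}e^{-5\pi^2t/4}+O(e^{-2\pi^2t}).$$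
   Context: For a planar open set $M$ of finite area (possibly with infinitely many components) with Dirichlet Laplacian $-\Delta_M$ on $L^2(M)$, let $\lambda_1(M)\le\lambda_2(M)\le\cdots$ be its eigenvalues counted with multiplicity; for a disjoint union of components the spectrum is the union (with multiplicity) of the spectra of the components. Two sets $M_1,M_2$ are isospectral if $\lambda_j(M_1)=\lambda_j(M_2)$ for all $j\in\mathbb{N}$. The heat content is $Q_M(t)=\int_M u(x;t)\,dx$, where $u$ is the solution of $\Delta u=\partial u/\partial t$ on $M$ for $t>0$ with $\lim_{t\downarrow0}u(\cdot;t)=1$ in $L^2(M)$ and $u(x;t)=0$ for $x\in\partial M$, $t>0$; equivalently $Q_M(t)=\sum_{j\ge1}e^{-t\lambda_j(M)}\left(\int_M\phi_{j,M}(x)\,dx\right)^2$ for an orthonormal basis $\{\phi_{j,M}\}$ of eigenfunctions corresponding to $\lambda_j(M)$. The heat content is additive over disjoint components. $M_1,M_2$ are isoheat if $Q_{M_1}(t)=Q_{M_2}(t)$ for all $t>0$. *)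

(* Defs.v *)
From HB Require Import structures.
From mathcomp Require Import all_boot all_order all_algebra.
From mathcomp Require Import all_classical all_reals all_analysis.

Set Implicit Arguments.
Unset Strict Implicit.
Unset Printing Implicit Defensive.

Import Order.TTheory GRing.Theory Num.Theory.
Import numFieldNormedType.Exports.

Local Open Scope classical_set_scope.
Local Open Scope ring_scope.

Definition area (R : realType) :
    {measure set (measurableTypeR R * measurableTypeR R) -> \bar R} :=
  (@lebesgue_measure R \x @lebesgue_measure R)%E.
Arguments area : clear implicits.

(* L^2(M) is represented by functions on the whole plane whose values outside
   M are irrelevant (f \_ M extends f by 0). *)
Definition L2norm (R : realType) (M : set (R * R)) (f : R * R -> R) : \bar R :=
  'N[area R]_(2%:E)[EFin \o (f \_ M)]%E.

Definition inL2 (R : realType) (M : set (R * R)) (f : R * R -> R) : Prop :=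
  f \_ M \in Lfun (area R) 2%:E.

Definition L2dot (R : realType) (M : set (R * R)) (f g : R * R -> R) : R :=
  \int[area R]_(x in M) (f x * g x).

Definition partial1 (R : realType) (f : R * R -> R) : R * R -> R :=
  'D_(1, 0) f.

Definition partial2 (R : realType) (f : R * R -> R) : R * R -> R :=
  'D_(0, 1) f.

(* C^oo: every iterated directional derivative of f is (Frechet) differentiable
   everywhere. *)
Definition smooth (R : realType) (f : R * R -> R) : Prop :=
  forall (vs : seq (R * R)) (x : R * R),
    differentiable (foldr (fun v (g : R * R -> R) => 'D_v g) f vs) x.

(* C_c^oo(M), for M open *)
Definition test_function (R : realType) (M : set (R * R)) (f : R * R -> R) :
    Prop :=
  [/\ smooth f, compact (closure [set x | f x != 0])
    & closure [set x | f x != 0] `<=` M].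

(* f is in H^1_0(M), the closure of C_c^oo(M) for the H^1 norm, and its weak
   gradient is (g1, g2). *)
Definition H10_with_gradient (R : realType) (M : set (R * R))
    (f g1 g2 : R * R -> R) : Prop :=
  [/\ inL2 M f, inL2 M g1, inL2 M g2
    & exists psi : nat -> R * R -> R,
      [/\ forall n, test_function M (psi n),
          L2norm M (psi n - f) @[n --> \oo] --> 0%E,
          L2norm M (partial1 (psi n) - g1) @[n --> \oo] --> 0%E
        & L2norm M (partial2 (psi n) - g2) @[n --> \oo] --> 0%E]].

(* The Dirichlet Laplacian as the Friedrichs extension: f is in the domain of
   -Delta_M and -Delta_M f = w. *)
Definition dirichlet_laplacian (R : realType) (M : set (R * R))
    (f w : R * R -> R) : Prop :=
  inL2 M w /\
  exists g1 g2 : R * R -> R,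
    H10_with_gradient M f g1 g2 /\
    forall psi, test_function M psi ->
      L2dot M g1 (partial1 psi) + L2dot M g2 (partial2 psi) = L2dot M w psi.

Definition orthonormal_basis (R : realType) (M : set (R * R))
    (phi : nat -> R * R -> R) : Prop :=
  [/\ forall j, inL2 M (phi j),
      forall i j, L2dot M (phi i) (phi j) = (i == j)%:R
    & forall f, inL2 M f -> (forall j, L2dot M f (phi j) = 0) ->
        {ae area R, forall x, M x -> f x = 0}].

(* lam 0 <= lam 1 <= ... lists the eigenvalues of -Delta_M with multiplicity. *)
Definition dirichlet_eigenvalues (R : realType) (M : set (R * R))
    (lam : nat -> R) : Prop :=
  nondecreasing_seq lam /\
  exists phi : nat -> R * R -> R,
    orthonormal_basis M phi /\
    forall j, dirichlet_laplacian M (phi j) (fun x => lam j * phi j x).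

(* The sequence of eigenvalues of an open set is unique when it exists. *)
Definition isospectral (R : realType) (M1 M2 : set (R * R)) : Prop :=
  exists lam1 lam2 : nat -> R,
    [/\ dirichlet_eigenvalues M1 lam1, dirichlet_eigenvalues M2 lam2
      & forall j, lam1 j = lam2 j].

(* u solves the heat equation on M with Dirichlet boundary conditions (encoded
   by u t being in the domain of Delta_M) and initial datum 1; the time
   derivative is taken in L^2(M). *)
Definition heat_solution (R : realType) (M : set (R * R))
    (u : R -> R * R -> R) : Prop :=
  (forall t, 0 < t -> exists w : R * R -> R,
     dirichlet_laplacian M (u t) w /\
     L2norm M (fun x => h^-1 * (u (t + h) x - u t x) + w x)
       @[h --> 0^'] --> 0%E) /\
  L2norm M (fun x => u t x - 1) @[t --> 0^'+] --> 0%E.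

(* For t > 0 the solution is unique up to null sets, so the value does not
   depend on the choice made by xget (u = 0 if there is no solution). *)
Definition heat_content (R : realType) (M : set (R * R)) (t : R) : R :=
  \int[area R]_(x in M)
    xget (fun=> fun=> 0) [set u | heat_solution M u] t x.

Definition isoheat (R : realType) (M1 M2 : set (R * R)) : Prop :=
  forall t : R, 0 < t -> heat_content M1 t = heat_content M2 t.

(* The point with coordinates (x, y) in the frame with origin p whose axes are
   e and e rotated by a right angle. *)
Definition in_frame (R : realType) (p e : R * R) (x y : R) : R * R :=
  (p.1 + x * e.1 - y * e.2, p.2 + x * e.2 + y * e.1).

Definition unit_vector (R : realType) (e : R * R) : Prop :=
  e.1 ^+ 2 + e.2 ^+ 2 = 1.

(* open rectangles, in any position and orientation *)
Definition is_rectangle (R : realType) (a b : R) (A : set (R * R)) : Prop :=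
  exists p e : R * R, unit_vector e /\
    A = [set q | exists x y : R,
           [/\ 0 < x < a, 0 < y < b & q = in_frame p e x y]].

Definition is_square (R : realType) (A : set (R * R)) : Prop :=
  exists s : R, 0 < s /\ is_rectangle s s A.

Definition is_right_isosceles_triangle (R : realType) (A : set (R * R)) :
    Prop :=
  exists (l : R) (p e : R * R), [/\ 0 < l, unit_vector e &
    A = [set q | exists x y : R,
           [/\ 0 < x, 0 < y, x + y < l & q = in_frame p e x y]]].

(* f t = O(g t) for t -> +oo. This is bigO of landau.v unfolded: there is no
   canonical filter_on for +oo, so =O_ does not apply directly. *)
Definition bigO_at_infinity (R : realType) (f g : R -> R) : Prop :=
  exists K : R, \forall t \near +oo, `|f t| <= K * `|g t|.

(* Main.v *)
Require Import Defs.
From HB Require Import structures.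
From mathcomp Require Import all_boot all_order all_algebra.
From mathcomp Require Import all_classical all_reals all_analysis.
From mathcomp Require Import measurable_realfun.
From mathcomp Require Import ring lra zify.

(* Separation of variables diagonalises every component.  On a rectangle with
   sides a, b the eigenfunctions are the products sin (m pi x / a) sin (n pi y / b);
   on a right isosceles triangle with legs l they are the combinations of such
   products on the square of side l that are antisymmetric in the reflection
   (x, y) -> (l - y, l - x), with m > n.  They lie in H^1_0 because they vanish
   linearly on the sides, and they are complete because bounded trigonometric
   sums approximate the indicators of quadrants.

   All eigenvalues are pi^2 / 4 times an integer.  For D the integers are
   2^j (4 p^2 + q^2) with j >= 0 and p, q >= 1.  If q is even, this is an
   eigenvalue of the square of area 2^-j, with m = p and n = q / 2.  If q is
   odd, it is an eigenvalue of the triangle: (m, n) is obtained from the larger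
   and the smaller of 2 p and q by applying j times (x, y) -> (x + y, x - y),
   which doubles x^2 + y^2.  Every m > n arises exactly once, since the parity
   of x + y tells when to stop undoing that map.

   The heat content is the sum of exp (- lambda_k t) a_k^2, where a_k is the
   integral of the k-th eigenfunction.  The lowest eigenvalue 5 pi^2 / 4 is
   simple, the next ones are at least 2 pi^2, and the sum of the a_k^2 is at
   most the area.  The lowest eigenfunctions of the triangle and of the
   1 x 2 rectangle have squared integrals 1024 / (9 pi^4) and 128 / pi^4. *)

Set Implicit Arguments.
Unset Strict Implicit.
Unset Printing Implicit Defensive.

Import Order.TTheory GRing.Theory Num.Theory.
Import numFieldNormedType.Exports.

Local Open Scope classical_set_scope.
Local Open Scope ring_scope.

(** [heat_content] selects an arbitrary heat solution, so both the existence of one and the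
    independence of its integral from the choice are required. The eigenfunction series provides
    existence; for any solution, the symmetry of the Laplacian makes each coefficient y obey y' = -
    lambda y, and this fixes the integral. Neither set is handled one component at a time:
    eigenfunctions are extended by 0 to the whole union, and the issue is uniformity over infinitely
    many shrinking components. Normalising factors blow up there, but no faster than a power of the
    eigenvalue, and a cubic count of the modes makes every series converge. Membership in H^1_0 is
    delicate because cutoffs near the sides have gradients of order n; linear vanishing compensates
    exactly this factor. Sine products do not form an algebra, and the approximation argument rests
    on the fact that multiplication by cos x and cos y preserves their span. The two sets are told
    apart by 128 / pi^4 = 1152 / (9 pi^4), against 1024 / (9 pi^4): the gap above the lowest
    eigenvalue makes the leading coefficient a function of the heat content. *)

Notation plane R := (measurableTypeR R * measurableTypeR R)%type.

(** * Area-preserving maps of the plane *)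

Section measure_preserving.
Variable R : realType.
Implicit Types (A : set (plane R)) (f g : plane R -> plane R).

(** This takes the place of a change of variables formula. Preservation of area by preimages is
    stable under composition and suffices for [area_preserving_integral], so only the swap and the
    shears are treated directly; translations and rotations are composed from them. *)
Definition area_preserving f :=
  measurable_fun setT f /\
  forall A, measurable A -> area R (f @^-1` A) = area R A.

Lemma area_preserving_comp f g :
  area_preserving f -> area_preserving g -> area_preserving (f \o g).
Proof.
move=> [mf If] [mg Ig]; split; first exact: measurableT_comp.
move=> A mA; rewrite comp_preimage Ig ?If//.
by rewrite -[X in measurable X]setTI; exact: mf.
Qed.

Lemma lebesgue_measureD (r : R) (A : set (measurableTypeR R)) : measurable A ->
  lebesgue_measure ((fun x => x + r) @^-1` A) = lebesgue_measure A.
Proof.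
move=> mA.
have mr : measurable_fun setT (fun x : measurableTypeR R => x + r : measurableTypeR R).
  exact: measurable_funD.
apply/esym/(@lebesgue_measure_unique R (pushforward lebesgue_measure _)) => //.
move=> _ [[a b]] _ <-.
rewrite /= /pushforward /=.
have -> : (fun x : R => x + r) @^-1` `]a, b]%classic = `](a - r), (b - r)]%classic.
  by apply/seteqP; split => x /=; rewrite !in_itv/= ltrBlDr lerBrDr.
rewrite !lebesgue_measure_itv/= !lte_fin ltrD2r; case: ifP => // _.
by rewrite !EFinN -!EFinB; congr EFin; ring.
Qed.

Lemma areaX (A B : set (measurableTypeR R)) : measurable A -> measurable B ->
  area R (A `*` B) = (lebesgue_measure A * lebesgue_measure B)%E.
Proof. by move=> mA mB; exact: product_measure1E. Qed.

Lemma area_preserving_swap : area_preserving (fun q => (q.2, q.1)).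
Proof.
have ms : measurable_fun setT (fun q : plane R => (q.2, q.1) : plane R).
  by apply/measurable_fun_pair.
split; [by []|move=> A mA].
apply/esym/(@product_measure_unique _ _ _ _ _ _ _ (pushforward (area R) _)) => //.
move=> B C mB mC; rewrite /= /pushforward/=.
rewrite (_ : _ @^-1` _ = C `*` B); last first.
  by apply/seteqP; split => -[x y] /= [].
by rewrite areaX// muleC.
Qed.

(** Each vertical section of the preimage of [A] is a translate of the section of [A]. *)
Lemma area_preserving_shear (g : R -> R) : measurable_fun setT g ->
  area_preserving (fun q => (q.1, q.2 + g q.1)).
Proof.
move=> mg; have mG : measurable_fun setT (fun q : plane R => (q.1, q.2 + g q.1) : plane R).
  apply/measurable_fun_pair => //; apply: measurable_funD => //.
  exact: (measurableT_comp mg).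
split; [by []|move=> A mA].
rewrite /area /product_measure1; apply: eq_integral => x _ /=.
rewrite -(@lebesgue_measureD (g x) (xsection A x)); last exact: measurable_xsection.
congr (lebesgue_measure _); apply/seteqP; split => y /=;
  by rewrite /xsection/= !inE.
Qed.

Lemma area_preserving_shear1 (c : R) :
  area_preserving (fun q => (q.1, q.2 + c * q.1)).
Proof.
by apply: (@area_preserving_shear (fun x => c * x)); exact: measurable_funM.
Qed.

Lemma area_preserving_shear2 (c : R) :
  area_preserving (fun q => (q.1 + c * q.2, q.2)).
Proof.
have := area_preserving_comp area_preserving_swap
  (area_preserving_comp (area_preserving_shear1 c) area_preserving_swap).
exact.
Qed.

Lemma area_preserving_translation (v : plane R) :
  area_preserving (fun q => (q.1 + v.1, q.2 + v.2)).
Proof.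
have tr2 (r : R) := @area_preserving_shear (cst r) (measurable_cst _).
have := area_preserving_comp area_preserving_swap
  (area_preserving_comp (tr2 v.1) (area_preserving_comp area_preserving_swap (tr2 v.2))).
exact.
Qed.

(* A rotation by an angle other than a multiple of pi is a product of three
   shears, and minus the identity is a square of a quarter turn. *)
Lemma area_preserving_rotation (e : plane R) : unit_vector e ->
  area_preserving (fun q => (e.1 * q.1 + e.2 * q.2, - e.2 * q.1 + e.1 * q.2)).
Proof.
have rot (c s : R) : c ^+ 2 + s ^+ 2 = 1 -> s != 0 ->
    area_preserving (fun q => (c * q.1 + s * q.2, - s * q.1 + c * q.2)).
  (* With c and s the cosine and the sine of an angle, [al] is the tangent of half that angle. *)
  move=> cs s0; pose al := (1 - c) / s.
  have sal : s * al = 1 - c by rewrite /al mulrCA divff// mulr1.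
  have sal2 : al * (1 + c) = s.
    by apply: (mulfI s0); rewrite mulrA sal; move: cs; rewrite -!expr2; nra.
  have := area_preserving_comp (area_preserving_shear2 al)
    (area_preserving_comp (area_preserving_shear1 (- s)) (area_preserving_shear2 al)).
  congr area_preserving; apply/funext => -[x y] /=; congr pair; last nra.
  rewrite -[in RHS]sal2.
  have -> : c = 1 - s * al by lra.
  ring.
case: e => c s; rewrite /unit_vector/= => cs.
have [s0|] := eqVneq s 0; last exact: rot.
have rot90 : area_preserving (fun q => (0 * q.1 + 1 * q.2, - 1 * q.1 + 0 * q.2)).
  by apply: rot; rewrite ?oner_neq0//; ring.
have /eqP : (c - 1) * (c + 1) = 0 by rewrite s0 in cs; nra.
rewrite mulf_eq0 subr_eq0 addr_eq0 => /orP[/eqP c1|/eqP c1].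
  have := area_preserving_translation (0, 0).
  by congr area_preserving; apply/funext => -[x y] /=; rewrite s0 c1; congr pair; ring.
have := area_preserving_comp rot90 rot90.
by congr area_preserving; apply/funext => -[x y] /=; rewrite s0 c1; congr pair; ring.
Qed.

(** Measurability refers to the product sigma-algebra, openness to the product topology. The link is
    that an open set is a countable union of open boxes with rational endpoints. *)
Lemma open_plane_measurable (U : set (R * R)) : open U ->
  measurable (U : set (plane R)).
Proof.
move=> oU.
pose box (i : (rat * rat) * (rat * rat)) : set (plane R) :=
  `]ratr i.1.1, ratr i.1.2[%classic `*` `]ratr i.2.1, ratr i.2.2[%classic.
have -> : U = \bigcup_i (if `[< box i `<=` U >] then box i else set0).
  apply/seteqP; split => [[x y] Uxy|q [i _]]; last first.
    by case: asboolP => // + bq; apply.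
  have /nbhs_ballP[e /= e0 eU] : nbhs (x, y) U by apply: open_nbhs_nbhs.
  have near (z : R) : exists a b : rat, [/\ z - e < ratr a, ratr a < z, z < ratr b & ratr b < z + e].
    have /rat_in_itvoo[a] : z - e < z by rewrite ltrBlDr ltrDl.
    rewrite in_itv/= => /andP[a1 a2].
    have /rat_in_itvoo[b] : z < z + e by rewrite ltrDl.
    rewrite in_itv/= => /andP[b1 b2].
    by exists a, b; split.
  have [a [b [a1 a2 b1 b2]]] := near x.
  have [c [d [c1 c2 d1 d2]]] := near y.
  exists ((a, b), (c, d)) => //; case: asboolP; last first.
    case=> -[x' y']; rewrite /box/= => -[]/=; rewrite !in_itv/= => /andP[? ?] /andP[? ?].
    apply: eU; split; rewrite /ball/= ltr_norml; apply/andP; split; lra.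
  by move=> _; rewrite /box; split; rewrite /= in_itv/= ?a2 ?b1 ?c2 ?d1.
apply: countable_bigcupT_measurable => [|i]; first exact: countableP.
by case: ifP => // _; apply: measurableX; exact: measurable_itv.
Qed.

Lemma continuous_plane_measurable (h : R * R -> R) : continuous h ->
  measurable_fun setT (h : plane R -> R).
Proof.
move=> ch; apply: (measurability _ (RGenOpens.measurableE R)).
move=> _ [_ [a [b ->] <-]]; rewrite setTI.
apply: open_plane_measurable; apply: open_comp; last exact: interval_open.
by move=> x _; exact: ch.
Qed.

Lemma area_preserving_integral f (S : set (plane R)) (h : plane R -> R) :
  area_preserving f -> measurable S -> measurable_fun setT h ->
  (area R).-integrable (f @^-1` S) (EFin \o (h \o f)) ->
  \int[area R]_(q in f @^-1` S) h (f q) = \int[area R]_(q in S) h q.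
Proof.
move=> [mf If] mS mh ih; rewrite /Rintegral; congr fine.
have mh' : measurable_fun setT (EFin \o h) by exact/measurable_EFinP.
transitivity (\int[pushforward (area R) f]_(q in S) (EFin \o h) q)%E.
  exact/esym/(integral_pushforward mf mh' ih mS).
by apply: eq_measure_integral => A mA _; exact: If.
Qed.

Lemma bounded_integrable (D : set (plane R)) (h : plane R -> R) (K : R) :
  measurable D -> (area R D < +oo)%E -> measurable_fun D h ->
  (forall q, D q -> `|h q| <= K) -> (area R).-integrable D (EFin \o h).
Proof.
move=> mD aD mh hK; apply: measurable_bounded_integrable => //.
exists K; split; first exact: num_real.
by move=> x Kx q /= Dq; rewrite (le_trans (hK _ Dq))// ltW.
Qed.

Definition frame_coord (p e q : R * R) : R * R :=
  (e.1 * (q.1 - p.1) + e.2 * (q.2 - p.2),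
   - e.2 * (q.1 - p.1) + e.1 * (q.2 - p.2)).

Lemma in_frameK (p e : R * R) x y : unit_vector e ->
  frame_coord p e (in_frame p e x y) = (x, y).
Proof.
case: p e => [p1 p2] [c s]; rewrite /unit_vector /frame_coord /in_frame/= => cs.
by congr pair; rewrite -[RHS]mulr1 -cs; ring.
Qed.

Lemma frame_coordK (p e q : R * R) : unit_vector e ->
  in_frame p e (frame_coord p e q).1 (frame_coord p e q).2 = q.
Proof.
case: p e q => [p1 p2] [c s] [x y]; rewrite /unit_vector /frame_coord /in_frame/= => cs.
congr pair.
  by transitivity (p1 + (c ^+ 2 + s ^+ 2) * (x - p1)); [|rewrite cs]; ring.
by transitivity (p2 + (c ^+ 2 + s ^+ 2) * (y - p2)); [|rewrite cs]; ring.
Qed.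

Lemma area_preserving_frame_coord (p e : plane R) : unit_vector e ->
  area_preserving (frame_coord p e).
Proof.
move=> ue.
have := area_preserving_comp (area_preserving_rotation ue)
  (area_preserving_translation (- p.1, - p.2)).
exact.
Qed.

Definition diag_reflection (l : R) (q : R * R) : R * R := (l - q.2, l - q.1).

Lemma area_preserving_diag_reflection (l : R) :
  area_preserving (diag_reflection l).
Proof.
have um : @unit_vector R (-1, 0) by rewrite /unit_vector/=; ring.
have := area_preserving_comp (area_preserving_translation (l, l))
  (area_preserving_comp (area_preserving_rotation um) area_preserving_swap).
by congr area_preserving; apply/funext => -[x y]; rewrite /diag_reflection/=;
  congr pair; ring.
Qed.

Lemma area_box_lty (K : R) (S : set (plane R)) : measurable S ->
  (forall q, S q -> `|q.1| <= K /\ `|q.2| <= K) -> (area R S < +oo)%E.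
Proof.
move=> mS SK.
have : (area R S <= area R (`[(- K)%R, K]%classic `*` `[(- K)%R, K]%classic))%E.
  apply: le_measure; rewrite ?inE//; last first.
    by move=> q /SK[]; rewrite !ler_norml => ? ?; split; rewrite /= in_itv.
  by apply: measurableX; exact: measurable_itv.
move=> /le_lt_trans; apply.
rewrite areaX; [|exact: measurable_itv|exact: measurable_itv].
rewrite !lebesgue_measure_itv/=.
by case: ifP => _; rewrite ?mule0// -EFinD -EFinM ltry.
Qed.

Lemma area_iterated_integral (K B : R) (S : set (plane R)) (h : plane R -> R) :
  measurable S -> (forall q, S q -> `|q.1| <= K /\ `|q.2| <= K) ->
  measurable_fun setT h -> (forall q, S q -> `|h q| <= B) ->
  \int[area R]_(q in S) h q =
  \int[lebesgue_measure]_x \int[lebesgue_measure]_(y in xsection S x) h (x, y).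
Proof.
move=> mS SK mh hB.
have ih : (area R).-integrable S (EFin \o h).
  apply: (bounded_integrable mS (area_box_lty mS SK) _ hB).
  exact: measurable_funTS.
have ih' : (area R).-integrable setT (EFin \o (h \_ S)).
  by have := (integrable_mkcond (EFin \o h) mS).1 ih; rewrite restrict_EFin.
rewrite Rintegral_mkcond /Rintegral; congr fine.
rewrite -[LHS](integral12_prod_meas1 ih'); apply: eq_integral => x _.
have msx : measurable (xsection S x) by exact: measurable_xsection.
(* [Rintegral] takes the finite part of every inner integral, so these have to be finite: the
   sections of [S] are bounded, and so is h on them. *)
rewrite /fubini_F/= fineK; last first.
  apply: integrable_fin_num => //.
  apply: measurable_bounded_integrable => //.
  - apply: (@le_lt_trans _ _ (lebesgue_measure `[(- K)%R, K]%classic)).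
      apply: le_measure; rewrite ?inE//.
      by move=> y; rewrite /xsection/= inE => /SK[_]; rewrite in_itv/= ler_norml.
    by rewrite lebesgue_measure_itv; case: ifP => _; rewrite // -EFinD ltry.
  - apply: measurable_funTS; apply: (measurableT_comp mh).
    exact: measurable_pair1.
  - exists B; split; first exact: num_real.
    move=> z Bz y /=; rewrite /xsection/= inE => /hB hb.
    exact/(le_trans hb)/ltW.
rewrite [RHS]integral_mkcond; apply: eq_integral => y _.
by rewrite !patchE mem_xsection; case: ifP.
Qed.

Lemma area_product_integral (K B : R) (A1 A2 : set (measurableTypeR R))
    (f g : R -> R) :
  measurable A1 -> measurable A2 ->
  (forall x, A1 x -> `|x| <= K) -> (forall x, A2 x -> `|x| <= K) ->
  measurable_fun setT f -> measurable_fun setT g ->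
  (forall x, A1 x -> `|f x| <= B) -> (forall x, A2 x -> `|g x| <= B) ->
  \int[area R]_(q in A1 `*` A2) (f q.1 * g q.2) =
  (\int[lebesgue_measure]_(x in A1) f x) * \int[lebesgue_measure]_(y in A2) g y.
Proof.
move=> mA1 mA2 A1K A2K mf mg fB gB.
have lty (A : set (measurableTypeR R)) : measurable A -> (forall x, A x -> `|x| <= K) ->
    (lebesgue_measure A < +oo)%E.
  move=> mA AK; apply: (@le_lt_trans _ _ (lebesgue_measure `[(- K)%R, K]%classic)).
    apply: le_measure; rewrite ?inE//.
    by move=> y /AK; rewrite /= in_itv/= ler_norml.
  by rewrite lebesgue_measure_itv; case: ifP => _; rewrite // -EFinD ltry.
have int (A : set (measurableTypeR R)) (h : R -> R) : measurable A -> (forall x, A x -> `|x| <= K) ->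
    measurable_fun setT h -> (forall x, A x -> `|h x| <= B) ->
    lebesgue_measure.-integrable A (EFin \o h).
  move=> mA AK mh hB; apply: measurable_bounded_integrable => //.
  - exact: lty.
  - exact: measurable_funTS.
  - exists B; split; first exact: num_real.
    by move=> z Bz y /= /hB hb; exact/(le_trans hb)/ltW.
rewrite (@area_iterated_integral K (B * B)); first last.
- by move=> q [/fB q1 /gB q2]; rewrite normrM ler_pM.
- by apply: measurable_funM; [exact: (measurableT_comp mf)|exact: (measurableT_comp mg)].
- by move=> q [/A1K ? /A2K ?].
- exact: measurableX.
rewrite -RintegralZr//; last exact: int.
rewrite [RHS]Rintegral_mkcond; apply: eq_Rintegral => x _.
rewrite patchE; case: ifPn => xA.
  by rewrite in_xsectionX//= RintegralZl//; exact: int.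
by rewrite notin_xsectionX// Rintegral_set0.
Qed.
End measure_preserving.

(** * Smooth functions and cutoffs of polygons *)

Section smooth_functions.
Variable R : realType.
Implicit Types (f g : R * R -> R) (q v : R * R).

Lemma differentiable_comp_real (h : R -> R) (h' : R) f q :
  differentiable f q -> is_derive (f q) (1 : R) h h' ->
  differentiable (fun r => h (f r)) q.
Proof.
move=> df hh; have dh : derivable h (f q) 1 by [].
by apply: differentiable_comp => //; exact/derivable1_diffP.
Qed.

Lemma derive_comp_real (h : R -> R) (h' : R) f q v :
  differentiable f q -> is_derive (f q) (1 : R) h h' ->
  'D_v (fun r => h (f r)) q = h' * 'D_v f q.
Proof.
move=> df hh; have dh : derivable h (f q) 1 by [].
have dd : differentiable h (f q) by exact/derivable1_diffP.
rewrite (deriveE _ df) deriveE; last exact: differentiable_comp_real df hh.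
rewrite (@diff_comp _ _ _ _ f h _ df dd).
have -> : ('d h (f q) \o 'd f q) v = 'd h (f q) ('d f q v) by [].
by rewrite (diff1E dd)/= derive1E derive_val mulrC.
Qed.

(** The classical smooth function exp (- 1 / s), extended by 0, with a negative power of s in front.
    The powers make the family closed under differentiation up to linear combinations, so one
    computation of a first derivative yields all orders. *)
Definition flat (k : nat) (s : R) : R :=
  if 0 < s then s ^- k * expR (- s^-1) else 0.

Lemma flat_ge0 k s : 0 <= flat k s.
Proof.
rewrite /flat; case: ifP => // s0.
by rewrite mulr_ge0 ?expR_ge0// invr_ge0 exprn_ge0// ltW.
Qed.

(** One term of the exponential series at 1 / s; hence every [flat k] vanishes to all orders at
    0. *)
Lemma flat_le k n s : 0 <= s -> flat k s <= (k + n).+1`!%:R * s ^+ n.+1.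
Proof.
rewrite /flat; case: ifPn => [s0 _|_ s0]; last by rewrite mulr_ge0// exprn_ge0.
have := @expR_ge1Dxn R s^-1 (k + n) (ltW _).
rewrite invr_gt0 => /(_ s0) h.
rewrite expRN ler_pdivrMr ?expR_gt0// -ler_pdivrMl; last first.
  by rewrite mulr_gt0 ?exprn_gt0// ltr0n fact_gt0.
apply: le_trans h; apply: (@le_trans _ _ (s^-1 ^+ (k + n).+1 / (k + n).+1`!%:R)); last by rewrite lerDr.
rewrite exprVn invfM [leRHS]mulrC -mulrA ler_pM2l ?invr_gt0 ?ltr0n ?fact_gt0//.
by rewrite -invfM -exprD addSn addnC.
Qed.

Lemma flatS k s : flat k s = flat k.+1 s * s.
Proof.
rewrite /flat; case: ifPn => [s0|_]; last by rewrite mul0r.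
by rewrite exprSr invfM mulrAC divfK// gt_eqF.
Qed.

Lemma is_derive_flat k s :
  is_derive s (1 : R) (flat k) (flat k.+2 s - k%:R * flat k.+1 s).
Proof.
have [s0|s0|->] := ltgtP s 0.
- rewrite {2 3}/flat ltNge (ltW s0)/= mulr0 subr0.
  apply: (@near_eq_is_derive _ _ _ (cst 0)) => //.
  near=> x; rewrite /flat/= ltNge ltW//.
  near: x; exact: lt_nbhsl.
- have sn0 : s != 0 by rewrite gt_eqF.
  pose h : R -> R := (id ^+ k) * (expR \o -%R).
  apply: (@near_eq_is_derive _ _ _ (h \o GRing.inv)).
    near=> x; rewrite /flat/= ifT//; last by near: x; exact: lt_nbhsr.
    by rewrite /h/= !fctE exprVn.
  have hV : is_derive s (1 : R) (@GRing.inv R) (- s ^- 2).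
    by apply: is_derive_eq; [apply: is_deriveV => //|rewrite /GRing.scale/= mulr1].
  have hh : is_derive s^-1 (1 : R) h (k%:R * s^-1 ^+ k.-1 * expR (- s^-1) - s^-1 ^+ k * expR (- s^-1)).
    apply: is_derive_eq.
    rewrite /GRing.scale/= !fctE/=; ring.
  apply: is_derive_eq.
  rewrite /flat s0 /GRing.scale/=.
  case: k {h hh} => [|k]/=; rewrite -!exprVn !exprS; ring.
- rewrite {2 3}/flat ltxx mulr0 subr0.
  (* By [flatS], the difference quotient of [flat k] at 0 is [flat k.+1], which is continuous
     there. *)
  apply/is_derive1_caratheodory; exists (flat k.+1); split.
  + by move=> z; rewrite {2}/flat ltxx !subr0 flatS.
  + rewrite /continuous_at.
    have f0 : flat k.+1 0 = 0 by rewrite /flat ltxx.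
    rewrite /prop_for f0.
    apply/cvgrPdist_le => e e0.
    near=> z; rewrite sub0r normrN ger0_norm ?flat_ge0//.
    have [z0|z0] := leP 0 z; last by rewrite /flat ltNge (ltW z0)/= ltW.
    rewrite (le_trans (flat_le k.+1 0 z0))// expr1 -ler_pdivlMl ?ltr0n ?fact_gt0//.
    apply: le_trans (ler_norm _) _.
    near: z; apply/nbhs_ballP.
    exists ((k.+1 + 0).+1`!%:R^-1 * e); first by rewrite /= mulr_gt0// invr_gt0 ltr0n fact_gt0.
    by move=> z; rewrite /ball/= sub0r normrN => /ltW.
  + by rewrite /flat ltxx.
Unshelve. all: by end_near.
Qed.

(** A syntactic class that contains the eigenfunctions and their cutoffs and is closed under
    directional derivatives. The predicate [smooth], which speaks of all iterated derivatives, then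
    follows by induction on the list of directions. *)
Inductive elementary : (R * R -> R) -> Prop :=
| elementary_cst c : elementary (cst c)
| elementary_fst : elementary fst
| elementary_snd : elementary snd
| elementaryD f g : elementary f -> elementary g -> elementary (fun q => f q + g q)
| elementaryM f g : elementary f -> elementary g -> elementary (fun q => f q * g q)
| elementary_sin f : elementary f -> elementary (fun q => sin (f q))
| elementary_cos f : elementary f -> elementary (fun q => cos (f q))
| elementary_flat k f : elementary f -> elementary (fun q => flat k (f q)).

Lemma elementary_differentiable f q : elementary f -> differentiable f q.
Proof.
elim=> {f}.
- by move=> c; exact: differentiable_cst.
- by apply: linear_differentiable => -[x y]; exact: cvg_fst.
- by apply: linear_differentiable => -[x y]; exact: cvg_snd.
- by move=> f g _ df _ dg; exact: differentiableD.
- by move=> f g _ df _ dg; exact: differentiableM.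
- by move=> f _ df; exact: differentiable_comp_real df (is_derive_sin _).
- by move=> f _ df; exact: differentiable_comp_real df (is_derive_cos _).
- by move=> k f _ df; exact: differentiable_comp_real df (is_derive_flat _ _).
Qed.

Lemma derive_fst q v : 'D_v (fst : R * R -> R) q = v.1.
Proof.
have cf : continuous (fst : R * R -> R) by move=> -[x y]; exact: cvg_fst.
by rewrite deriveE ?diff_lin//; exact: linear_differentiable.
Qed.

Lemma derive_snd q v : 'D_v (snd : R * R -> R) q = v.2.
Proof.
have cf : continuous (snd : R * R -> R) by move=> -[x y]; exact: cvg_snd.
by rewrite deriveE ?diff_lin//; exact: linear_differentiable.
Qed.

Lemma elementary_derive f v : elementary f -> elementary ('D_v f).
Proof.
elim=> {f}.
- by move=> c; rewrite (_ : 'D_v _ = cst 0); [exact: elementary_cst|apply/funext => q; rewrite derive_cst].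
- rewrite (_ : 'D_v _ = cst v.1); first exact: elementary_cst.
  by apply/funext => q; rewrite derive_fst.
- rewrite (_ : 'D_v _ = cst v.2); first exact: elementary_cst.
  by apply/funext => q; rewrite derive_snd.
- move=> f g ef edf eg edg.
  rewrite (_ : 'D_v _ = fun q => 'D_v f q + 'D_v g q); first exact: elementaryD.
  by apply/funext => q; rewrite deriveD//; apply/diff_derivable/elementary_differentiable.
- move=> f g ef edf eg edg.
  rewrite (_ : 'D_v _ = fun q => f q * 'D_v g q + g q * 'D_v f q).
    by apply: elementaryD; exact: elementaryM.
  by apply/funext => q; rewrite deriveM//; apply/diff_derivable/elementary_differentiable.
- move=> f ef edf.
  rewrite (_ : 'D_v _ = fun q => cos (f q) * 'D_v f q).
    by apply: elementaryM => //; exact: elementary_cos.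
  apply/funext => q; apply: derive_comp_real (is_derive_sin _).
  exact: elementary_differentiable.
- move=> f ef edf.
  rewrite (_ : 'D_v _ = fun q => (-1 * sin (f q)) * 'D_v f q).
    apply: elementaryM => //; apply: elementaryM; first exact: elementary_cst.
    exact: elementary_sin.
  apply/funext => q; rewrite mulN1r; apply: derive_comp_real (is_derive_cos _).
  exact: elementary_differentiable.
- move=> k f ef edf.
  rewrite (_ : 'D_v _ = fun q => (flat k.+2 (f q) + - k%:R * flat k.+1 (f q)) * 'D_v f q).
    apply: elementaryM => //; apply: elementaryD; first exact: elementary_flat.
    by apply: elementaryM; [exact: elementary_cst|exact: elementary_flat].
  apply/funext => q; rewrite mulNr; apply: derive_comp_real (is_derive_flat _ _).
  exact: elementary_differentiable.
Qed.

Lemma elementary_smooth f : elementary f -> smooth f.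
Proof.
move=> ef vs x; apply: elementary_differentiable.
by elim: vs => //= v vs; exact: elementary_derive.
Qed.

Lemma elementary_continuous f : elementary f -> continuous f.
Proof. by move=> ef q; exact/differentiable_continuous/elementary_differentiable. Qed.

Lemma elementary_measurable f : elementary f -> measurable_fun setT (f : plane R -> R).
Proof. by move=> ef; apply: continuous_plane_measurable; exact: elementary_continuous. Qed.

Lemma elementary_deriveM f g q v : elementary f -> elementary g ->
  'D_v (fun q => f q * g q) q = f q * 'D_v g q + g q * 'D_v f q.
Proof.
by move=> ef eg; rewrite deriveM//; apply/diff_derivable/elementary_differentiable.
Qed.

Lemma elementary_deriveD f g q v : elementary f -> elementary g ->
  'D_v (fun q => f q + g q) q = 'D_v f q + 'D_v g q.
Proof.
by move=> ef eg; rewrite deriveD//; apply/diff_derivable/elementary_differentiable.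
Qed.

Definition affine (l : R * R * R) (q : R * R) : R := l.1.1 * q.1 + l.1.2 * q.2 + l.2.

Lemma elementary_affine l : elementary (affine l).
Proof.
by do 2?[apply: elementaryD]; try exact: elementary_cst; apply: elementaryM;
  try exact: elementary_cst; [exact: elementary_fst|exact: elementary_snd].
Qed.

Lemma elementaryZ c f : elementary f -> elementary (fun q => c * f q).
Proof. by apply: elementaryM; exact: elementary_cst. Qed.

Lemma elementary_deriveZ c f q v : elementary f ->
  'D_v (fun q => c * f q) q = c * 'D_v f q.
Proof.
move=> ef; rewrite (elementary_deriveM _ _ (elementary_cst c) ef).
by rewrite [X in _ + _ * X]derive_cst mulr0 addr0.
Qed.

Lemma derive_affine l q v : 'D_v (affine l) q = l.1.1 * v.1 + l.1.2 * v.2.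
Proof.
have e1 : elementary (fun q => l.1.1 * q.1) by exact/elementaryZ/elementary_fst.
have e2 : elementary (fun q => l.1.2 * q.2) by exact/elementaryZ/elementary_snd.
rewrite /affine (@elementary_deriveD (fun q => l.1.1 * q.1 + l.1.2 * q.2) (cst l.2)).
- rewrite [X in _ + X]derive_cst addr0 (elementary_deriveD _ _ e1 e2).
  rewrite (elementary_deriveZ _ _ _ elementary_fst) (elementary_deriveZ _ _ _ elementary_snd).
  by rewrite derive_fst derive_snd.
- exact: elementaryD.
- exact: elementary_cst.
Qed.

Lemma flat0_le1 s : flat 0 s <= 1.
Proof.
rewrite /flat; case: ifP => // s0.
by rewrite expr0 invr1 mul1r -expR0 ler_expR oppr_le0 invr_ge0 ltW.
Qed.

Lemma flat_leV k s : 1 <= s -> flat k.+1 s <= s^-1.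
Proof.
move=> s1; have s0 : 0 < s by rewrite (lt_le_trans _ s1).
rewrite -[leRHS]mulr1 /flat s0 ler_pM ?expR_ge0 ?invr_ge0 ?exprn_ge0//.
- exact: ltW.
- by rewrite lef_pV2 ?posrE ?exprn_gt0// exprS ler_peMr ?exprn_ege1// ltW.
- by rewrite -expR0 ler_expR oppr_le0 invr_ge0 ltW.
Qed.

Lemma flat_bounded k s : flat k s <= k.+1`!%:R.
Proof.
have [s0|s0] := leP s 0; first by rewrite /flat ltNge s0.
have k1 : 1 <= k.+1`!%:R :> R by rewrite ler1n fact_gt0.
have [s1|s1] := leP s 1.
  by rewrite (le_trans (flat_le k 0 (ltW s0)))// addn0 expr1 ler_piMr.
case: k k1 => [|k] k1; first by rewrite (le_trans (flat0_le1 s)).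
by rewrite (le_trans (flat_leV k (ltW s1)))// (le_trans _ k1)// invf_le1// ltW.
Qed.

(** A factor vanishes unless [affine l q] exceeds 1 / n and tends to 1 where [affine l q] is
    positive. The product is thus a smooth function supported inside the polygon, at a positive
    distance from each side, with limit 1 in the interior. *)
Definition cutoff (n : nat) (ls : seq (R * R * R)) : R * R -> R :=
  foldr (fun l g q => flat 0 (n%:R * affine l q - 1) * g q) (cst 1) ls.

Definition polygon (ls : seq (R * R * R)) : set (R * R) :=
  [set q | forall l, l \in ls -> 0 < affine l q].

Lemma elementary_step n l : elementary (fun q => flat 0 (n%:R * affine l q - 1)).
Proof.
apply: elementary_flat; apply: elementaryD; last exact: elementary_cst.
exact/elementaryZ/elementary_affine.
Qed.

Lemma elementary_cutoff n ls : elementary (cutoff n ls).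
Proof.
elim: ls => [|l ls IH] /=; first exact: elementary_cst.
by apply: elementaryM => //; exact: elementary_step.
Qed.

Lemma derive_step n l q v : 'D_v (fun q => flat 0 (n%:R * affine l q - 1)) q =
  flat 2 (n%:R * affine l q - 1) * (n%:R * 'D_v (affine l) q).
Proof.
have e1 : elementary (fun q => n%:R * affine l q) by exact/elementaryZ/elementary_affine.
have e2 : elementary (fun q => n%:R * affine l q - 1).
  by apply: elementaryD => //; exact: elementary_cst.
rewrite (derive_comp_real _ (elementary_differentiable _ e2) (is_derive_flat 0 _)) mul0r subr0.
rewrite (@elementary_deriveD _ (cst (- 1)) q v e1 (elementary_cst _)) derive_cst addr0.
by rewrite (elementary_deriveZ _ _ _ (elementary_affine l)).
Qed.

Lemma cutoff_ge0 n ls q : 0 <= cutoff n ls q.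
Proof. by elim: ls => //= l ls IH; rewrite mulr_ge0 ?flat_ge0. Qed.

Lemma cutoff_le1 n ls q : cutoff n ls q <= 1.
Proof.
by elim: ls => //= l ls IH; rewrite mulr_ile1 ?flat_ge0 ?cutoff_ge0 ?flat0_le1.
Qed.

Lemma cutoff_neq0 n ls q : cutoff n ls q != 0 ->
  forall l, l \in ls -> 1 <= n%:R * affine l q.
Proof.
elim: ls => // l ls IH /=; rewrite mulf_eq0 negb_or => /andP[h1 /IH h2] l'.
rewrite inE => /predU1P[->|]; last exact: h2.
rewrite leNgt; apply/negP => h; move: h1; rewrite /flat ifF ?eqxx//.
by apply/negbTE; rewrite -leNgt subr_le0 ltW.
Qed.

Lemma derive_cutoff_out n ls q v : ~ polygon ls q ->
  cutoff n ls q = 0 /\ 'D_v (cutoff n ls) q = 0.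
Proof.
elim: ls => [|l ls IH] /=; first by case.
move=> Pq; rewrite (elementary_deriveM _ _ (elementary_step n l) (elementary_cutoff n ls)).
have [l0|l0] := leP (affine l q) 0.
  have hl : 0 < n%:R * affine l q - 1 = false.
    by apply/negbTE; rewrite -leNgt subr_le0 (le_trans _ ler01)// mulr_ge0_le0.
  by rewrite derive_step /flat hl !mul0r mulr0 addr0.
have [] := IH.
  by move=> Pq'; apply: Pq => l'; rewrite inE => /predU1P[->|]; [exact: l0|exact: Pq'].
by move=> -> ->; rewrite !mulr0 mul0r addr0.
Qed.

Lemma flat_cvg_pinfty k : flat k.+1 u @[u --> +oo] --> (0 : R).
Proof.
apply/cvgrPdist_le => e e0; near=> u.
have u1 : 1 <= u by near: u; exact: nbhs_pinfty_ge.
rewrite sub0r normrN ger0_norm ?flat_ge0// (le_trans (flat_leV k u1))//.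
have u0 : 0 < u by rewrite (lt_le_trans _ u1).
by rewrite -[leRHS]invrK lef_pV2 ?posrE ?invr_gt0.
Unshelve. all: by end_near.
Qed.

Lemma flat0_cvg_pinfty : flat 0 u @[u --> +oo] --> (1 : R).
Proof.
apply/cvgrPdist_le => e e0; near=> u.
have u0 : 0 < u by near: u; exact: nbhs_pinfty_gt.
rewrite ger0_norm ?subr_ge0 ?flat0_le1// /flat u0 expr0 invr1 mul1r.
have := expR_ge1Dx (- u^-1); suff : u^-1 <= e by lra.
by rewrite -[leRHS]invrK lef_pV2 ?posrE ?invr_gt0.
Unshelve. all: by end_near.
Qed.

Lemma step_arg_cvg (a : R) : 0 < a -> (n%:R * a - 1) @[n --> \oo] --> (+oo : set_system R).
Proof.
move=> a0; apply/cvgryPge => A; near=> n.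
rewrite lerBrDr -ler_pdivrMr//.
by near: n; apply: nbhs_infty_ger.
Unshelve. all: by end_near.
Qed.

Lemma cutoff_cvg ls q : polygon ls q -> cutoff n ls q @[n --> \oo] --> (1 : R).
Proof.
elim: ls => [|l ls IH] Pq /=; first exact: cvg_cst.
rewrite -[X in _ --> X]mulr1; apply: cvgM.
  apply: cvg_comp flat0_cvg_pinfty; apply: step_arg_cvg.
  by apply: Pq; rewrite inE eqxx.
by apply: IH => l' l'ls; apply: Pq; rewrite inE l'ls orbT.
Qed.

(** * Cutoff gradients multiplied by functions that vanish on the sides *)

Section cutoff_derivative.
Variables (F : R * R -> R) (K : R) (v q : R * R).

(** The gradient of a cutoff factor carries a factor n, and the linear bound on F contributes
    [affine l q]. With u = n [affine l q] - 1 their product is u + 1, and (u + 1) [flat 2 u] =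
    [flat 1 u] + [flat 2 u], which is bounded and tends to 0 as n grows. *)
Let step_bound n l : 0 < affine l q -> `|F q| <= K * affine l q ->
  `|F q * 'D_v (fun q => flat 0 (n%:R * affine l q - 1)) q| <=
  K * `|'D_v (affine l) q| *
    (flat 1 (n%:R * affine l q - 1) + flat 2 (n%:R * affine l q - 1)).
Proof.
move=> l0 FK; rewrite derive_step (flatS 1); set u := n%:R * _ - 1.
have -> : flat 2 u * u + flat 2 u = flat 2 u * (n%:R * affine l q).
  by rewrite /u; ring.
rewrite !normrM (ger0_norm (flat_ge0 2 u)) normr_nat.
have : `|F q| * (flat 2 u * n%:R * `|'D_v (affine l) q|) <=
    K * affine l q * (flat 2 u * n%:R * `|'D_v (affine l) q|).
  by rewrite ler_wpM2r// !mulr_ge0// flat_ge0.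
by congr (_ <= _); ring.
Qed.

Lemma cutoff_derive_bounded n ls : polygon ls q ->
  (forall l, l \in ls -> `|F q| <= K * affine l q) ->
  `|F q * 'D_v (cutoff n ls) q| <= \sum_(l <- ls) K * `|'D_v (affine l) q| * 8.
Proof.
elim: ls => [|l ls IH] Pq FK.
  by rewrite big_nil/= derive_cst mulr0 normr0.
have lP : 0 < affine l q by apply: Pq; rewrite inE eqxx.
have FKl : `|F q| <= K * affine l q by apply: FK; rewrite inE eqxx.
have K0 : 0 <= K by rewrite -(pmulr_lge0 _ lP) (le_trans _ FKl).
rewrite big_cons /= (elementary_deriveM _ _ (elementary_step n l) (elementary_cutoff n ls)).
rewrite mulrDr addrC (le_trans (ler_normD _ _))// lerD//.
  rewrite mulrCA normrM ger0_norm ?cutoff_ge0//.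
  apply: (@le_trans _ _ (1 * (K * `|'D_v (affine l) q| * 8))); last by rewrite mul1r.
  apply: ler_pM; rewrite ?cutoff_ge0 ?cutoff_le1//.
  apply: le_trans (step_bound n lP FKl) _.
  rewrite ler_wpM2l ?mulr_ge0//.
  (* The constant 8 is 2! + 3!, the sum of the bounds on [flat 1] and [flat 2]. *)
  by have := flat_bounded 1 (n%:R * affine l q - 1); have := flat_bounded 2 (n%:R * affine l q - 1);
    rewrite !factS fact0 !natrM; lra.
rewrite mulrCA normrM ger0_norm ?flat_ge0//.
apply: (@le_trans _ _ (1 * `|F q * 'D_v (cutoff n ls) q|)).
  by rewrite ler_wpM2r// flat0_le1.
rewrite mul1r; apply: IH => [l' l'ls|l' l'ls]; [apply: Pq|apply: FK];
  by rewrite inE l'ls orbT.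
Qed.

Lemma cutoff_derive_cvg ls : polygon ls q ->
  (forall l, l \in ls -> `|F q| <= K * affine l q) ->
  F q * 'D_v (cutoff n ls) q @[n --> \oo] --> (0 : R).
Proof.
elim: ls => [|l ls IH] Pq FK.
  by rewrite /= derive_cst mulr0; exact: cvg_cst.
have lP : 0 < affine l q by apply: Pq; rewrite inE eqxx.
have FKl : `|F q| <= K * affine l q by apply: FK; rewrite inE eqxx.
have Pls : polygon ls q by move=> l' l'ls; apply: Pq; rewrite inE l'ls orbT.
rewrite (_ : (fun n => _) = fun n =>
    flat 0 (n%:R * affine l q - 1) * (F q * 'D_v (cutoff n ls) q) +
    cutoff n ls q * (F q * 'D_v (fun q => flat 0 (n%:R * affine l q - 1)) q)); last first.
  apply/funext => n /=.
  by rewrite (elementary_deriveM _ _ (elementary_step n l) (elementary_cutoff n ls)); ring.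
have -> : 0 = 1 * 0 + 1 * 0 :> R by rewrite !mulr0 addr0.
apply: cvgD; apply: cvgM.
- by apply: cvg_comp flat0_cvg_pinfty; exact: step_arg_cvg.
- by apply: IH => // l' l'ls; apply: FK; rewrite inE l'ls orbT.
- exact: cutoff_cvg.
- apply/norm_cvg0P; apply: (@squeeze_cvgr _ _ _ _ (cst 0) (fun n =>
    K * `|'D_v (affine l) q| *
    (flat 1 (n%:R * affine l q - 1) + flat 2 (n%:R * affine l q - 1)))).
  + by near=> n; rewrite normr_ge0/=; exact: step_bound.
  + exact: cvg_cst.
  + rewrite [X in _ --> X](_ : 0 = K * `|'D_v (affine l) q| * (0 + 0)); last by rewrite addr0 mulr0.
    by apply: cvgMr; apply: cvgD; apply: cvg_comp (flat_cvg_pinfty _); exact: step_arg_cvg.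
Unshelve. all: by end_near.
Qed.

End cutoff_derivative.

End smooth_functions.

(** * L^2, H^1_0 and integration by parts *)

Section L2_space.
Variables (R : realType) (M : set (plane R)).
Hypothesis mM : measurable M.
Implicit Types (f g : plane R -> R).

Lemma inL2P f : inL2 M f <->
  measurable_fun M f /\ (area R).-integrable M (fun q => (f q ^+ 2)%:E).
Proof.
have mr : measurable_fun M f <-> measurable_fun setT (f \_ M).
  exact: measurable_restrictT.
have ir : (area R).-integrable M (fun q => (f q ^+ 2)%:E) <->
    (area R).-integrable setT (EFin \o (fun q => (f \_ M) q ^+ 2)).
  have -> : EFin \o (fun q => (f \_ M) q ^+ 2) = (fun q => (f q ^+ 2)%:E) \_ M.
    apply/funext => q; rewrite /= !patchE; case: ifP => // _.
    by rewrite expr0n.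
  exact: integrable_mkcond.
split=> [Lf|[mf i2]].
  split; last exact/ir/Lfun2_integrable_sqr.
  by apply/mr; have := sub_Lfun_mfun Lf; rewrite inE.
rewrite /inL2 inE; apply/andP; split; rewrite inE/=; first exact/mr.
rewrite /finite_norm unlock poweR_lty//.
have /integrableP[_] := (ir.1 i2).
apply: le_lt_trans; apply: ge0_le_integral => //.
- by move=> q _; exact: poweR_ge0.
- apply/measurable_EFinP/(@measurableT_comp _ _ _ _ _ _ (fun x : R => x `^ 2)%R) => //.
  by apply/measurableT_comp => //; exact/mr.
- apply: measurableT_comp => //; apply/measurable_EFinP/measurable_funX; exact/mr.
- by move=> q _; rewrite /= lee_fin normrX powR_mulrn.
Qed.

Lemma inL2_measurable f : inL2 M f -> measurable_fun M f.
Proof. by move/inL2P => []. Qed.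

Lemma inL2_dot_integrable f g : inL2 M f -> inL2 M g ->
  (area R).-integrable M (EFin \o (fun q => f q * g q)).
Proof.
move=> /inL2P[mf i2f] /inL2P[mg i2g].
apply: (le_integrable mM _ _ (integrableD mM i2f i2g)).
  by apply/measurable_EFinP/measurable_funM.
move=> q Mq; rewrite -EFinD /= lee_fin normrM.
rewrite [leRHS]ger0_norm ?addr_ge0 ?sqr_ge0//.
rewrite -(normr_id (f q)) -[`|f q|]/(`|f q|).
have := sqr_ge0 (`|f q| - `|g q|); rewrite -(real_normK (num_real (f q))) -(real_normK (num_real (g q))).
have := normr_ge0 (f q); have := normr_ge0 (g q); rewrite normr_id; nra.
Qed.

Lemma inL2D f g : inL2 M f -> inL2 M g -> inL2 M (fun q => f q + g q).
Proof.
move=> Lf Lg; have := inL2_dot_integrable Lf Lg.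
move: Lf Lg => /inL2P[mf i2f] /inL2P[mg i2g] ifg; apply/inL2P; split.
  exact: measurable_funD.
have := integrableD mM (integrableD mM i2f i2g) (integrableZl mM 2 ifg).
congr (_.-integrable); apply/funext => q /=.
by rewrite -!EFinM -!EFinD; congr EFin; ring.
Qed.

Lemma inL2Z c f : inL2 M f -> inL2 M (fun q => c * f q).
Proof.
move=> /inL2P[mf i2f]; apply/inL2P; split.
  exact: measurable_funM.
have := integrableZl mM (c ^+ 2) i2f.
by congr (_.-integrable); apply/funext => q /=; rewrite -EFinM exprMn.
Qed.

Lemma inL2_eq f g : (forall q, M q -> f q = g q) -> inL2 M f -> inL2 M g.
Proof.
rewrite /inL2 => fg; suff -> : f \_ M = g \_ M by [].
by apply/funext => q; rewrite !patchE; case: ifPn => // /set_mem/fg.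
Qed.

Lemma inL2_cst0 : inL2 M (cst 0).
Proof.
apply/inL2P; split => //.
rewrite (_ : (fun q => _) = cst 0%E); first exact: integrable0.
by apply/funext => q; rewrite /= expr0n.
Qed.

Lemma inL2B f g : inL2 M f -> inL2 M g -> inL2 M (fun q => f q - g q).
Proof.
move=> Lf Lg; apply: inL2_eq (inL2D Lf (inL2Z (-1) Lg)) => q _.
by rewrite mulN1r.
Qed.

Lemma inL2_sum (I : Type) (s : seq I) (F : I -> plane R -> R) :
  (forall i, inL2 M (F i)) -> inL2 M (fun q => \sum_(i <- s) F i q).
Proof.
move=> LF; elim: s => [|i s IH].
  by apply: inL2_eq inL2_cst0 => q _; rewrite big_nil.
by apply: inL2_eq (inL2D (LF i) IH) => q _; rewrite big_cons.
Qed.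

Lemma inL2_bounded f (B : R) : (area R M < +oo)%E -> measurable_fun M f ->
  (forall q, M q -> `|f q| <= B) -> inL2 M f.
Proof.
move=> aM mf fB; apply/inL2P; split => //.
apply: (@bounded_integrable _ M (fun q => f q ^+ 2) (B ^+ 2)) => //.
  exact: measurable_funX.
by move=> q /fB h; rewrite normrX lerXn2r ?nnegrE//; exact: le_trans h.
Qed.

Lemma L2dotC f g : L2dot M f g = L2dot M g f.
Proof. by apply: eq_Rintegral => q _; rewrite mulrC. Qed.

Lemma L2dot_eq f f' g g' : (forall q, M q -> f q = f' q) ->
  (forall q, M q -> g q = g' q) -> L2dot M f g = L2dot M f' g'.
Proof. by move=> ff gg; apply: eq_Rintegral => q /set_mem Mq; rewrite ff// gg. Qed.

Lemma L2dotDl f g h : inL2 M f -> inL2 M g -> inL2 M h ->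
  L2dot M (fun q => f q + g q) h = L2dot M f h + L2dot M g h.
Proof.
move=> Lf Lg Lh.
rewrite -RintegralD//; try exact: inL2_dot_integrable.
by apply: eq_Rintegral => q _; rewrite mulrDl.
Qed.

Lemma L2dotZl c f g : inL2 M f -> inL2 M g ->
  L2dot M (fun q => c * f q) g = c * L2dot M f g.
Proof.
move=> Lf Lg; rewrite -RintegralZl//; last exact: inL2_dot_integrable.
by apply: eq_Rintegral => q _; rewrite mulrA.
Qed.

Lemma L2dotBl f g h : inL2 M f -> inL2 M g -> inL2 M h ->
  L2dot M (fun q => f q - g q) h = L2dot M f h - L2dot M g h.
Proof.
move=> Lf Lg Lh; rewrite -mulN1r -L2dotZl// -L2dotDl//; last exact: inL2Z.
by apply: L2dot_eq => // q _; rewrite mulN1r.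
Qed.

Lemma L2dot_suml (I : Type) (s : seq I) (F : I -> plane R -> R) g :
  (forall i, inL2 M (F i)) -> inL2 M g ->
  L2dot M (fun q => \sum_(i <- s) F i q) g = \sum_(i <- s) L2dot M (F i) g.
Proof.
move=> LF Lg; elim: s => [|i s IH].
  rewrite big_nil; transitivity (\int[area R]_(q in M) (cst 0 : _ -> R) q).
    by apply: eq_Rintegral => q _; rewrite big_nil mul0r.
  by rewrite Rintegral_cst// mul0r.
rewrite big_cons -IH -L2dotDl//; last exact: inL2_sum.
by apply: L2dot_eq => // q _; rewrite big_cons.
Qed.

Lemma L2dot_ge0 f : 0 <= L2dot M f f.
Proof. by apply: Rintegral_ge0 => q _; rewrite -expr2 sqr_ge0. Qed.

(** Non-negativity of the squared norm of f - g. For squared norms this replaces the triangle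
    inequality. *)
Lemma L2dot_sqrD f g : inL2 M f -> inL2 M g ->
  L2dot M (fun q => f q + g q) (fun q => f q + g q) <=
  2 * L2dot M f f + 2 * L2dot M g g.
Proof.
move=> Lf Lg.
have := L2dot_ge0 (fun q => f q - g q).
rewrite (L2dotBl Lf Lg (inL2B Lf Lg)) (L2dotDl Lf Lg (inL2D Lf Lg)).
rewrite ![L2dot M _ (fun q => _ - _)]L2dotC ![L2dot M _ (fun q => _ + _)]L2dotC.
rewrite (L2dotBl Lf Lg Lf) (L2dotBl Lf Lg Lg) (L2dotDl Lf Lg Lf) (L2dotDl Lf Lg Lg).
by rewrite (L2dotC g f); lra.
Qed.

Lemma L2dot_CauchySchwarz f g : inL2 M f -> inL2 M g ->
  L2dot M f g ^+ 2 <= L2dot M f f * L2dot M g g.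
Proof.
move=> Lf Lg.
have H c : 0 <= L2dot M f f + 2 * c * L2dot M f g + c ^+ 2 * L2dot M g g.
  have Lcg := inL2Z c Lg; have := L2dot_ge0 (fun q => f q + c * g q).
  rewrite (L2dotDl Lf Lcg (inL2D Lf Lcg)) ![L2dot M _ (fun q => _ + _)]L2dotC.
  rewrite (L2dotDl Lf Lcg Lf) (L2dotDl Lf Lcg Lcg) (L2dotZl _ Lg Lf) (L2dotZl _ Lg Lcg).
  rewrite (L2dotC f (fun q => c * g q)) (L2dotC g (fun q => c * g q)).
  by rewrite (L2dotZl _ Lg Lf) (L2dotZl _ Lg Lg) (L2dotC g f); nra.
have g0 := L2dot_ge0 g; have [g00|gn0] := eqVneq (L2dot M g g) 0.
  have [->|b0] := eqVneq (L2dot M f g) 0; first by rewrite expr0n g00 mulr0.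
  (* When g has norm 0, the quadratic in c degenerates to an affine function of nonzero slope; this
     c gives it the value -1. *)
  have := H (- (L2dot M f f + 1) / (2 * L2dot M f g)).
  rewrite g00 mulr0 addr0 (_ : 2 * _ * _ = - (L2dot M f f + 1)); last by field.
  lra.
have gp : 0 < L2dot M g g by rewrite lt0r gn0.
have := H (- L2dot M f g / L2dot M g g).
set a := L2dot M f f; set b := L2dot M f g; set c := L2dot M g g.
have -> : a + 2 * (- b / c) * b + (- b / c) ^+ 2 * c = a - b ^+ 2 / c by field.
by rewrite subr_ge0 ler_pdivrMr.
Qed.

Lemma L2normE f : inL2 M f -> L2norm M f = (Num.sqrt (L2dot M f f))%:E.
Proof.
move=> Lf; rewrite /L2norm unlock.
have -> : (\int[area R]_x (`|(EFin \o f \_ M) x| `^ 2) = (L2dot M f f)%:E)%E.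
  rewrite /L2dot /Rintegral fineK; last first.
    by apply: integrable_fin_num => //; exact: inL2_dot_integrable.
  rewrite [RHS]integral_mkcond; apply: eq_integral => q _ /=.
  rewrite !patchE; case: ifP => _; last by rewrite normr0 powR0.
  by rewrite powR_mulrn// real_normK ?num_real// expr2.
by rewrite poweR_EFin powR12_sqrt// L2dot_ge0.
Qed.

(** Membership in L^2 is asked only eventually along [F], because difference quotients of a heat
    solution at t are meaningful only for small h. *)
Lemma L2norm_cvg0P (T : Type) (F : set_system T) (f : T -> plane R -> R) :
  Filter F -> (\forall t \near F, inL2 M (f t)) ->
  L2norm M (f t) @[t --> F] --> 0%E <-> L2dot M (f t) (f t) @[t --> F] --> (0 : R).
Proof.
move=> FF Lf.
have e : {near F, (fun t => Num.sqrt (L2dot M (f t) (f t))) =1 fine \o (fun t => L2norm M (f t))}.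
  by apply: filterS Lf => t /L2normE /= ->.
split=> h.
  have hs : Num.sqrt (L2dot M (f t) (f t)) @[t --> F] --> (0 : R).
    apply: cvg_trans (fine_cvg h); apply: near_eq_cvg.
    by apply: filterS e => t /= ->.
  rewrite [X in X @ _ --> _](_ : _ = fun t =>
      Num.sqrt (L2dot M (f t) (f t)) * Num.sqrt (L2dot M (f t) (f t))).
    by rewrite -[X in _ --> X](mulr0 (0 : R)); exact: cvgM.
  by apply/funext => t /=; rewrite -expr2 sqr_sqrtr// L2dot_ge0.
apply: cvg_EFin; first by apply: filterS Lf => t /L2normE ->.
suff hs : Num.sqrt (L2dot M (f t) (f t)) @[t --> F] --> (0 : R).
  by apply: cvg_trans hs; exact: near_eq_cvg.
rewrite -(sqrtr0 R); exact: cvg_comp h (@sqrt_continuous _ _).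
Qed.

Lemma L2_dominated_cvg (f : nat -> plane R -> R) (B : R) :
  (area R M < +oo)%E -> (forall n, measurable_fun M (f n)) ->
  (forall n q, M q -> `|f n q| <= B) ->
  (forall q, M q -> f n q @[n --> \oo] --> (0 : R)) ->
  L2dot M (f n) (f n) @[n --> \oo] --> (0 : R).
Proof.
move=> aM mf fB f0.
have mf2 n : measurable_fun M (EFin \o (fun q => f n q * f n q)).
  by apply/measurable_EFinP/measurable_funM.
have [] := @dominated_convergence _ _ R (area R) M mM
  (fun n => EFin \o (fun q => f n q * f n q)) (cst 0%E) (cst (B * B)%:E).
- exact: mf2.
- exact: measurable_cst.
- apply: nearW => q Mq; apply: cvg_EFin; first exact: nearW.
  by rewrite -[X in _ --> X](mulr0 (0 : R)); apply: cvgM; exact: f0.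
- by apply: (@bounded_integrable _ M (cst (B * B)) `|B * B|).
- apply: nearW => q n Mq; rewrite /= lee_fin normrM ler_pM//; exact: fB.
move=> _ _; rewrite integral0 => /fine_cvg; exact.
Qed.

Lemma L2dot_cvg (f : nat -> plane R -> R) g h : (forall n, inL2 M (f n)) ->
  inL2 M g -> inL2 M h ->
  L2dot M (fun q => f n q - g q) (fun q => f n q - g q) @[n --> \oo] --> (0 : R) ->
  L2dot M (f n) h @[n --> \oo] --> L2dot M g h.
Proof.
move=> Lf Lg Lh fg; apply/subr_cvg0.
apply/norm_cvg0P; apply: (@squeeze_cvgr _ _ _ _ (cst 0) (fun n =>
  Num.sqrt (L2dot M (fun q => f n q - g q) (fun q => f n q - g q) * L2dot M h h))).
- apply: nearW => n; rewrite normr_ge0/= -sqrtr_sqr -L2dotBl// ler_sqrt; last first.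
    by rewrite mulr_ge0 ?L2dot_ge0.
  by apply: L2dot_CauchySchwarz => //; exact: inL2B.
- exact: cvg_cst.
- rewrite [X in _ --> X](_ : 0 = Num.sqrt (0 * L2dot M h h)); last by rewrite mul0r sqrtr0.
  have h1 := cvgM fg (cvg_cst (L2dot M h h)).
  exact: (cvg_comp _ _ (h1 _ _) (@sqrt_continuous R _)).
Qed.

(** * Finite expansions in an orthonormal sequence *)

Section orthonormal.
Variable phi : nat -> plane R -> R.
Hypotheses (Lphi : forall k, inL2 M (phi k))
  (Hon : forall i j, L2dot M (phi i) (phi j) = (i == j)%:R).

Lemma partial_sum_inL2 (c : nat -> R) N : inL2 M (fun q => \sum_(k < N) c k * phi k q).
Proof. by apply: inL2_sum => // k; exact: inL2Z. Qed.

Lemma partial_sum_dotl (c : nat -> R) N h : inL2 M h ->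
  L2dot M (fun q => \sum_(k < N) c k * phi k q) h = \sum_(k < N) c k * L2dot M (phi k) h.
Proof.
move=> Lh; rewrite (L2dot_suml _ (fun k : 'I_N => inL2Z (c k) (Lphi k)) Lh).
by apply: eq_bigr => k _; rewrite L2dotZl.
Qed.

Lemma partial_sum_distance f (c : nat -> R) N : inL2 M f ->
  L2dot M (fun q => \sum_(k < N) c k * phi k q - f q) (fun q => \sum_(k < N) c k * phi k q - f q) =
  L2dot M f f - 2 * (\sum_(k < N) c k * L2dot M f (phi k)) + \sum_(k < N) c k ^+ 2.
Proof.
move=> Lf; set S := fun q => \sum_(k < N) c k * phi k q.
have Lp : inL2 M S := partial_sum_inL2 c N; have Ld := inL2B Lp Lf.
rewrite (L2dotBl Lp Lf Ld) ![L2dot M _ (fun q => _ - _)]L2dotC.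
rewrite (L2dotBl Lp Lf Lp) (L2dotBl Lp Lf Lf) (L2dotC f S).
have -> : L2dot M S f = \sum_(k < N) c k * L2dot M f (phi k).
  by rewrite partial_sum_dotl//; apply: eq_bigr => k _; rewrite L2dotC.
have -> : L2dot M S S = \sum_(k < N) c k ^+ 2.
  rewrite partial_sum_dotl//; apply: eq_bigr => k _; rewrite L2dotC partial_sum_dotl//.
  rewrite (bigD1 k)//= Hon eqxx mulr1 big1 ?addr0 ?expr2// => i ik.
  by rewrite Hon (_ : (i == k :> nat) = false) ?mulr0//; exact/negbTE.
ring.
Qed.

(** Completing the square: the right-hand side exceeds the left one by the squares of c_k - (f,
    phi_k) for k < N plus the squares of (f, phi_k) for N <= k < n. *)
Lemma best_approximation f (c : nat -> R) N n : inL2 M f -> (N <= n)%N ->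
  L2dot M (fun q => \sum_(k < n) L2dot M f (phi k) * phi k q - f q)
          (fun q => \sum_(k < n) L2dot M f (phi k) * phi k q - f q) <=
  L2dot M (fun q => \sum_(k < N) c k * phi k q - f q) (fun q => \sum_(k < N) c k * phi k q - f q).
Proof.
move=> Lf Nn; rewrite !(partial_sum_distance (fun k => L2dot M f (phi k)))// partial_sum_distance//.
rewrite -!(big_mkord xpredT (fun k => L2dot M f (phi k) * L2dot M f (phi k))).
rewrite !(big_cat_nat (leq0n N) Nn)/= !big_mkord.
have : 0 <= \sum_(N <= k < n) L2dot M f (phi k) * L2dot M f (phi k).
  by apply: sumr_ge0 => k _; exact: sqr_ge0.
have : 0 <= \sum_(k < N) (c k - L2dot M f (phi k)) ^+ 2 by apply: sumr_ge0 => k _; exact: sqr_ge0.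
have -> : \sum_(k < N) (c k - L2dot M f (phi k)) ^+ 2 = \sum_(k < N) c k ^+ 2
    - 2 * (\sum_(k < N) c k * L2dot M f (phi k)) + \sum_(k < N) L2dot M f (phi k) * L2dot M f (phi k).
  rewrite mulr_sumr -sumrN -!big_split/=; apply: eq_bigr => k _; ring.
lra.
Qed.
End orthonormal.

End L2_space.

(** * Membership in H^1_0 of functions that vanish on the sides of a polygon *)

Section polygon_H10.
Variable R : realType.
Implicit Types (ls : seq (R * R * R)) (F : R * R -> R).

Lemma polygon_cons l ls :
  polygon (l :: ls) = [set q | 0 < affine l q] `&` polygon ls.
Proof.
apply/seteqP; split => q /=.
  move=> Pq; split; first by apply: Pq; rewrite inE eqxx.
  by move=> l' h; apply: Pq; rewrite inE h orbT.
by move=> [h1 h2] l'; rewrite inE => /predU1P[->|/h2].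
Qed.

Lemma continuous_affine (l : R * R * R) : continuous (affine l).
Proof. exact/elementary_continuous/elementary_affine. Qed.

Lemma open_polygon ls : open (polygon ls).
Proof.
elim: ls => [|l ls IH].
  by rewrite (_ : polygon _ = setT); [exact: openT|apply/seteqP; split].
rewrite polygon_cons; apply: openI => //.
apply: (@open_comp _ _ (affine l) [set x | 0 < x]); last exact: open_gt.
by move=> q _; exact: continuous_affine.
Qed.

Lemma measurable_polygon ls : measurable (polygon ls : set (plane R)).
Proof. by apply: open_plane_measurable; exact: open_polygon. Qed.

Lemma closed_cutoff_core n ls :
  closed [set q : R * R | forall l, l \in ls -> 1 <= n%:R * affine l q].
Proof.
elim: ls => [|l ls IH].
  by rewrite (_ : [set _ | _] = setT); [exact: closedT|apply/seteqP; split].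
rewrite (_ : [set _ | _] = [set q | 1 <= n%:R * affine l q] `&`
    [set q | forall l, l \in ls -> 1 <= n%:R * affine l q]); last first.
  apply/seteqP; split => q /=.
    move=> Pq; split; first by apply: Pq; rewrite inE eqxx.
    by move=> l' h; apply: Pq; rewrite inE h orbT.
  by move=> [h1 h2] l'; rewrite inE => /predU1P[->|/h2].
apply: closedI => //.
apply: (@closed_comp _ _ (fun q => n%:R * affine l q) [set x | 1 <= x]); last exact: closed_ge.
move=> q _; apply: elementary_continuous; exact/elementaryZ/elementary_affine.
Qed.

Lemma cutoff_test_function (r : R) (M : set (R * R)) n ls F : elementary F ->
  (forall q, polygon ls q -> `|q.1| <= r /\ `|q.2| <= r) -> polygon ls `<=` M ->
  test_function M (fun q => F q * cutoff n ls q).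
Proof.
move=> eF Pr PM.
pose S : set (R * R) := [set q | forall l, l \in ls -> 1 <= n%:R * affine l q].
have SP : S `<=` polygon ls.
  move=> q Sq l /Sq h; have [n0|n0] := eqVneq n 0%N.
    by move: h; rewrite n0 mul0r ler10.
  rewrite -(@pmulr_rgt0 _ n%:R) ?(lt_le_trans _ h)// ltr0n lt0n//.
have cS : closed S by exact: closed_cutoff_core.
have supS : closure [set q | F q * cutoff n ls q != 0] `<=` S.
  have -> : S = closure S by exact/closure_id.
  apply: closureS => q /=.
  by rewrite mulf_eq0 negb_or => /andP[_ /cutoff_neq0].
split.
- by apply: elementary_smooth; apply: elementaryM => //; exact: elementary_cutoff.
- apply: (@subclosed_compact _ _ (`[(- r), r]%classic `*` `[(- r), r]%classic)).
  + exact: closed_closure.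
  + by apply: compact_setX; exact: segment_compact.
  + move=> q /supS /SP /Pr[]; rewrite !ler_norml => h1 h2.
    by split; rewrite /= in_itv.
- exact: subset_trans (subset_trans supS SP) PM.
Qed.

(** The approximants are F times the cutoffs, and dominated convergence applies to them and to their
    gradients because F vanishes linearly at each side. [M] may be larger than the polygon, so that
    the result applies to one component of a union. *)
Lemma polygon_H10 (M : set (R * R)) ls F (r K B : R) :
  measurable (M : set (plane R)) -> (area R M < +oo)%E -> polygon ls `<=` M ->
  (forall q, polygon ls q -> `|q.1| <= r /\ `|q.2| <= r) -> elementary F ->
  (forall q l, polygon ls q -> l \in ls -> `|F q| <= K * affine l q) ->
  (forall q, polygon ls q ->
    [/\ `|F q| <= B, `|partial1 F q| <= B & `|partial2 F q| <= B]) ->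
  H10_with_gradient M (F \_ (polygon ls)) (partial1 F \_ (polygon ls))
    (partial2 F \_ (polygon ls)).
Proof.
move=> mM aM PM Pr eF FK FB; set P := polygon ls.
have mP : measurable (P : set (plane R)) by exact: measurable_polygon.
have mrest G : elementary G -> measurable_fun M (G \_ P : plane R -> R).
  move=> eG; apply: measurable_funTS; apply/(measurable_restrictT _ mP).
  by apply: measurable_funTS; exact: elementary_measurable.
have Lrest G : elementary G -> (forall q, P q -> `|G q| <= B) ->
    inL2 M (G \_ P).
  move=> eG GB; apply: (inL2_bounded mM (B := Num.max B 0) aM (mrest G eG)) => q Mq.
  rewrite patchE; case: ifPn => [/set_mem/GB|_]; rewrite le_max ?normr0 ?lexx ?orbT//.
  by move=> ->.
pose psi n q := F q * cutoff n ls q.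
have epsi n : elementary (psi n) by apply: elementaryM => //; exact: elementary_cutoff.
have Lconv (f : nat -> R * R -> R) (B' : R) : (forall n, measurable_fun M (f n : plane R -> R)) ->
    (forall n q, ~ P q -> f n q = 0) -> (forall n q, P q -> `|f n q| <= B') ->
    (forall q, P q -> f n q @[n --> \oo] --> (0 : R)) ->
    L2norm M (f n) @[n --> \oo] --> 0%E.
  move=> mf f0 fB fcvg.
  have fB' n q : M q -> `|f n q| <= Num.max B' 0.
    move=> Mq; have [Pq|nPq] := pselect (P q); first by rewrite le_max fB.
    by rewrite f0// normr0 le_max lexx orbT.
  apply/L2norm_cvg0P => //.
    by apply: nearW => n; apply: (inL2_bounded mM aM (mf n) (fB' n)).
  apply: (L2_dominated_cvg mM aM mf fB') => q Mq.
  have [Pq|nPq] := pselect (P q); first exact: fcvg.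
  by under eq_fun do rewrite f0//; exact: cvg_cst.
have Dconv v (B0 : R) : (forall q, P q -> `|'D_v F q| <= B0) ->
    (exists B1, forall q l, `|'D_v (@affine R l) q| <= B1 l) ->
    L2norm M ('D_v (psi n) - ('D_v F \_ P)) @[n --> \oo] --> 0%E.
  move=> DB [B1 DB1].
  have K' q : P q -> 0 <= `|K| by [].
  apply: (Lconv _ (\sum_(l <- ls) `|K| * B1 l * 8 + B0)) => [n|n q nPq|n q Pq|q Pq].
  - apply: (@measurable_funB _ (plane R) R M ('D_v (psi n)) ('D_v F \_ P)); last first.
      by apply: mrest; exact: elementary_derive.
    by apply: measurable_funTS; apply: elementary_measurable; exact: elementary_derive.
  - have [c0 dc0] := derive_cutoff_out n v nPq.
    rewrite fctE [X in _ - X]patchE memNset// subr0.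
    by rewrite (elementary_deriveM _ _ eF (elementary_cutoff n ls)) c0 dc0 mulr0 mul0r addr0.
  - rewrite fctE [X in _ - X]patchE mem_set//.
    rewrite (elementary_deriveM _ _ eF (elementary_cutoff n ls)).
    (* The error in the gradient splits into F times the gradient of the cutoff, controlled by the
       linear vanishing of F, and a multiple of 1 - cutoff, controlled by the bound on the
       derivative of F. *)
    have -> : F q * 'D_v (cutoff n ls) q + cutoff n ls q * 'D_v F q - 'D_v F q =
        F q * 'D_v (cutoff n ls) q - (1 - cutoff n ls q) * 'D_v F q by ring.
    rewrite (le_trans (ler_normB _ _))// lerD//.
      apply: (le_trans (cutoff_derive_bounded (K := `|K|) v n Pq _)) => [l lls|].
        apply: le_trans (FK _ _ Pq lls) _; rewrite ler_wpM2r//; last exact: ler_norm.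
        exact/ltW/Pq.
      by apply: ler_sum => l _; rewrite ler_wpM2r// ler_wpM2l.
    rewrite normrM -[leRHS]mul1r ler_pM//; last exact: DB.
    by have := cutoff_ge0 n ls q; have := cutoff_le1 n ls q; rewrite ler_norml; lra.
  - rewrite (_ : (fun n => _) = fun n => F q * 'D_v (cutoff n ls) q +
        (cutoff n ls q - 1) * 'D_v F q); last first.
      apply/funext => n; rewrite fctE [X in _ - X]patchE mem_set//.
      by rewrite (elementary_deriveM _ _ eF (elementary_cutoff n ls)); ring.
    rewrite [X in _ --> X](_ : 0 = 0 + (1 - 1) * 'D_v F q); last by ring.
    apply: cvgD; first by apply: (cutoff_derive_cvg v Pq) => l; exact: FK.
    apply: cvgMl; apply: cvgB; last exact: cvg_cst.
    exact: cutoff_cvg.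
split.
- by apply: Lrest => // q /FB[].
- by apply: Lrest; [exact: elementary_derive|move=> q /FB[]].
- by apply: Lrest; [exact: elementary_derive|move=> q /FB[]].
exists psi; split.
- by move=> n; exact: cutoff_test_function Pr PM.
- apply: (Lconv _ B) => [n|n q nPq|n q Pq|q Pq].
  + apply: (@measurable_funB _ (plane R) R M (psi n) (F \_ P)); last exact: mrest.
    by apply: measurable_funTS; exact: elementary_measurable.
  + have [c0 _] := derive_cutoff_out n (0, 0) nPq.
    by rewrite fctE [X in _ - X]patchE memNset// subr0 /psi c0 mulr0.
  + rewrite fctE [X in _ - X]patchE mem_set// /psi.
    have [FBq _ _] := FB _ Pq.
    have -> : F q * cutoff n ls q - F q = F q * (cutoff n ls q - 1) by ring.
    rewrite normrM -[leRHS]mulr1 ler_pM//.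
    by have := cutoff_ge0 n ls q; have := cutoff_le1 n ls q; rewrite ler_norml; lra.
  + rewrite (_ : (fun n => _) = fun n => F q * (cutoff n ls q - 1)); last first.
      by apply/funext => n; rewrite fctE [X in _ - X]patchE mem_set// /psi; ring.
    rewrite [X in _ --> X](_ : 0 = F q * (1 - 1)); last by ring.
    apply: cvgMr; apply: cvgB; last exact: cvg_cst.
    exact: cutoff_cvg.
- apply: (Dconv (1, 0) B) => [q /FB[]//|].
  by exists (fun l => `|l.1.1|) => q l; rewrite derive_affine/= mulr1 mulr0 addr0.
- apply: (Dconv (0, 1) B) => [q /FB[]//|].
  by exists (fun l => `|l.1.2|) => q l; rewrite derive_affine/= mulr1 mulr0 add0r.
Qed.
End polygon_H10.

(** * Integration by parts against test functions *)

Section integration_by_parts.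
Variable R : realType.
Implicit Types (G h : R * R -> R) (r : R).

Definition square_box r : set (R * R) := `[(- r), r]%classic `*` `[(- r), r]%classic.

Lemma square_boxE r q : square_box r q <-> `|q.1| <= r /\ `|q.2| <= r.
Proof. by rewrite /square_box !ler_norml; split=> -[/=]; rewrite !in_itv. Qed.

Lemma measurable_square_box r : measurable (square_box r : set (plane R)).
Proof. by apply: measurableX; exact: measurable_itv. Qed.

Lemma square_box_bounded r h : continuous h ->
  exists B : R, forall q, square_box r q -> `|h q| <= B.
Proof.
move=> ch; have [r0|r0] := leP 0 r; last first.
  exists 0 => q /square_boxE[h1 _]; move: r0; rewrite ltNge => /negP; case.
  exact: le_trans h1.
have [|||c _ cmax] := @compact_EVT_max _ R (fun q => `|h q|) (square_box r).
- by exists (0, 0); apply/square_boxE; rewrite normr0.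
- by apply: compact_setX; exact: segment_compact.
- by apply: continuous_subspaceT => q; apply: cvg_norm; exact: ch.
- by exists (`|h c|) => q qS; apply: cmax; rewrite inE.
Qed.

Lemma continuous_box_integrable r h : continuous h ->
  (forall q, ~ square_box r q -> h q = 0) ->
  (area R).-integrable setT (EFin \o (h : plane R -> R)).
Proof.
move=> ch h0; have [B hB] := square_box_bounded r ch.
have mS := @measurable_square_box r.
have -> : EFin \o h = (EFin \o (h : plane R -> R)) \_ (square_box r).
  apply/funext => q; rewrite patchE; case: ifPn => //= /negP qS.
  by rewrite h0// => /mem_set.
apply: (integrable_mkcond _ mS).1.
apply: (bounded_integrable mS _ _ hB).
  by apply: (@area_box_lty _ r _ mS) => q /square_boxE.
by apply: measurable_funTS; exact: continuous_plane_measurable.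
Qed.

Lemma is_derive_slice G x y : derivable G (x, y) (0, 1) ->
  is_derive y (1 : R) (fun y => G (x, y)) ('D_(0, 1) G (x, y)).
Proof.
have E : (fun h : R => h^-1 *: (((fun y => G (x, y)) \o shift y) (h *: 1) - G (x, y)))
    = (fun h : R => h^-1 *: ((G \o shift (x, y)) (h *: (0, 1)) - G (x, y))).
  apply/funext => t; rewrite [in RHS]/= [in LHS]/=.
  have -> : t *: ((0, 1) : R * R) + (x, y) = (x, t *: 1 + y).
    transitivity ((t * 0 + x, t * 1 + y) : R * R); [by []|by rewrite mulr0 add0r].
  by [].
by move=> dG; split; rewrite /derivable /derive E.
Qed.

Lemma open_square_boxC r : open (~` square_box r).
Proof.
apply: closed_openC; apply: compact_closed; first exact: norm_hausdorff.
by apply: compact_setX; exact: segment_compact.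
Qed.

Lemma derive_out_box r G (v q : R * R) : (forall q, ~ square_box r q -> G q = 0) ->
  ~ square_box r q -> 'D_v G q = 0.
Proof.
move=> G0 qS; rewrite (@near_eq_derive _ _ _ G (cst 0) q); first exact: derive_cst.
have : nbhs q (~` square_box r).
  by apply: open_nbhs_nbhs; split => //; exact: open_square_boxC.
by apply: filterS => z /G0.
Qed.

Lemma integral_partial2_eq0 r G : 0 < r -> (forall q, derivable G q (0, 1)) ->
  continuous (partial2 G) -> (forall q, ~ square_box r q -> G q = 0) ->
  \int[area R]_q partial2 G q = 0.
Proof.
(* The box is enlarged so that the endpoints of every segment lie strictly outside the smaller box,
   where G is 0 by hypothesis. *)
move=> r0 dG cG G0; pose r' := r + 1.
have rr' : r < r' by rewrite ltrDl.
have mS := @measurable_square_box r'.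
have D0 q : ~ square_box r' q -> partial2 G q = 0.
  move=> qS; apply: (derive_out_box _ G0); apply: contra_not qS => /square_boxE[h1 h2].
  by apply/square_boxE; split; exact/(le_trans _ (ltW rr')).
have -> : \int[area R]_q partial2 G q = \int[area R]_(q in square_box r') partial2 G q.
  rewrite [RHS]Rintegral_mkcond; apply: eq_Rintegral => q _; rewrite patchE.
  by case: ifPn => // /negP qS; rewrite D0// => /mem_set.
have [B hB] := square_box_bounded r' cG.
rewrite (@area_iterated_integral R r' B _ (partial2 G) mS); first last.
- exact: hB.
- exact: continuous_plane_measurable.
- by move=> q /square_boxE.
transitivity (\int[@lebesgue_measure R]_x (cst 0 : _ -> R) x); last first.
  by rewrite Rintegral_cst// mul0r.
apply: eq_Rintegral => x _; have [xr|xr] := boolP (x \in `[(- r'), r']%classic); last first.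
  by rewrite notin_xsectionX// Rintegral_set0.
rewrite in_xsectionX// /Rintegral.
have sd y : is_derive y (1 : R) (fun y => G (x, y)) (partial2 G (x, y)).
  by apply: is_derive_slice; exact: dG.
have sc : continuous (fun y => G (x, y)).
  by move=> y; apply/differentiable_continuous/derivable1_diffP; case: (sd y).
have G00 y : r < `|y| -> G (x, y) = 0.
  by move=> ry; apply: G0 => /square_boxE/= -[_]; rewrite leNgt ry.
rewrite (@continuous_FTC2 R (fun y => partial2 G (x, y)) (fun y => G (x, y))).
- have r'N : `|r'| = r' by rewrite ger0_norm// ltW// (lt_trans r0).
  have -> : G (x, r') = 0 by rewrite G00// r'N.
  have -> : G (x, - r') = 0 by rewrite G00// normrN r'N.
  by rewrite /= subr0.
- by rewrite /r'; lra.
- apply: continuous_subspaceT => y; apply: (@continuous_comp _ _ _ (fun y => (x, y)) (partial2 G)).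
    exact: (@cvg_pair _ _ _ (nbhs y) (nbhs x) (nbhs y) _ _ _ (cst x) id (cvg_cst x) cvg_id).
  exact: cG.
- split; first by move=> y _; case: (sd y).
    by apply: cvg_at_right_filter; exact: sc.
  by apply: cvg_at_left_filter; exact: sc.
- by move=> y _; rewrite derive1E; case: (sd y).
Qed.

Lemma integral_partial1_eq0 r G : 0 < r -> (forall q, derivable G q (1, 0)) ->
  continuous (partial1 G) -> (forall q, ~ square_box r q -> G q = 0) ->
  \int[area R]_q partial1 G q = 0.
Proof.
move=> r0 dG cG G0.
pose s (q : plane R) : plane R := (q.2, q.1).
have sK q : s (s q) = q by case: q.
have E q : (fun h : R => h^-1 *: (((G \o s) \o shift q) (h *: (0, 1)) - (G \o s) q))
    = (fun h : R => h^-1 *: ((G \o shift (s q)) (h *: (1, 0)) - G (s q))).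
  by [].
have DE : partial1 G \o s = partial2 (G \o s).
  by apply/funext => q; rewrite /partial1 /partial2 /= /derive E.
have cs : continuous (s : R * R -> R * R).
  move=> -[x y].
  exact: (@cvg_pair _ _ _ (nbhs (x, y)) (nbhs y) (nbhs x) _ _ _ snd fst cvg_snd cvg_fst).
have cDs : continuous (partial2 (G \o s)).
  by rewrite -DE => q; apply: continuous_comp; [exact: cs|exact: cG].
have Gs0 q : ~ square_box r q -> (G \o s) q = 0.
  by move=> qS; apply: G0 => /square_boxE[h1 h2]; apply: qS; apply/square_boxE.
rewrite -(@integral_partial2_eq0 r (G \o s) r0 _ cDs Gs0); last first.
  by move=> q; rewrite /derivable E; exact: dG.
have mG : measurable_fun setT (partial1 G : plane R -> R) by exact: continuous_plane_measurable.
have iG : (area R).-integrable (s @^-1` setT) (EFin \o ((partial1 G : plane R -> R) \o s)).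
  rewrite DE; apply: (@continuous_box_integrable r _ cDs) => q; exact: derive_out_box.
rewrite -DE.
exact/esym/(area_preserving_integral (area_preserving_swap R) measurableT mG iG).
Qed.

Section restricted_test_function.
Variables (M P P' : set (R * R)) (psi : R * R -> R).
Hypotheses (oP : open P) (oP' : open P') (PP' : P `&` P' = set0)
  (MP : M = P `|` P') (tpsi : test_function M psi).

Let S := closure [set q | psi q != 0].

(** A boundary point of [P] belongs neither to [P] nor to [P'], as both are open and they are
    disjoint; so it is outside [M] and off the support of psi. Hence near every point the truncation
    to [P] either changes nothing or gives 0, and differentiability survives it. *)
Let local_restriction (g : R * R -> R) q : (forall q, ~ S q -> g q = 0) ->
  (P q /\ {near q, g =1 g \_ P}) \/ (~ P q /\ {near q, cst 0 =1 g \_ P}).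
Proof.
move=> gS; have [Pq|nPq] := pselect (P q); [left|right]; split => //.
  have : nbhs q P by exact: open_nbhs_nbhs.
  by apply: filterS => z Pz; rewrite patchE mem_set.
have [Sq|nSq] := pselect (S q).
  have P'q : P' q by case: tpsi => _ _ /(_ q Sq); rewrite MP => -[].
  have : nbhs q P' by exact: open_nbhs_nbhs.
  apply: filterS => z P'z; rewrite patchE memNset//= => Pz.
  by have : (P `&` P') z by []; rewrite PP'.
have : nbhs q (~` S).
  by apply: open_nbhs_nbhs; split => //; apply: closed_openC; exact: closed_closure.
by apply: filterS => z /gS gz; rewrite patchE gz if_same.
Qed.

Let psi_out q : ~ S q -> psi q = 0.
Proof. by apply: contra_notP => /eqP h; exact: subset_closure. Qed.

Let dpsi_out v q : ~ S q -> 'D_v psi q = 0.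
Proof.
move=> nSq; rewrite (@near_eq_derive _ _ _ psi (cst 0) q); first exact: derive_cst.
have : nbhs q (~` S).
  by apply: open_nbhs_nbhs; split => //; apply: closed_openC; exact: closed_closure.
by apply: filterS => z /psi_out.
Qed.

Lemma test_function_derivable v q : derivable psi q v.
Proof. by case: tpsi => /(_ [::] q) h _ _; exact: diff_derivable. Qed.

Lemma test_function_continuous : continuous psi.
Proof. by case: tpsi => h _ _ q; exact/differentiable_continuous/(h [::]). Qed.

Lemma test_function_derive_continuous v : continuous ('D_v psi).
Proof. by case: tpsi => h _ _ q; exact/differentiable_continuous/(h [:: v]). Qed.

Lemma restricted_derivable v q : derivable (psi \_ P) q v.
Proof.
have [[_ h]|[_ h]] := local_restriction q psi_out; apply: near_eq_derivable h _.
  exact: test_function_derivable.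
exact: derivable_cst.
Qed.

Lemma restricted_derive v : 'D_v (psi \_ P) = ('D_v psi) \_ P.
Proof.
apply/funext => q; rewrite patchE.
have [[Pq h]|[nPq h]] := local_restriction q psi_out.
  by rewrite mem_set// -(near_eq_derive v h).
by rewrite memNset// -(near_eq_derive v h) derive_cst.
Qed.

Let restricted_continuous (g : R * R -> R) : (forall q, ~ S q -> g q = 0) -> continuous g ->
  continuous (g \_ P).
Proof.
move=> gS cg q; have [[Pq h]|[nPq h]] := local_restriction q gS.
  rewrite /continuous_at patchE mem_set//; apply: cvg_trans (cg q); exact: near_eq_cvg.
rewrite /continuous_at patchE memNset//; exact: (cvg_trans (near_eq_cvg h) (cvg_cst (0 : R))).
Qed.

Lemma restricted_test_continuous : continuous (psi \_ P).
Proof. exact/restricted_continuous/test_function_continuous. Qed.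

Lemma restricted_derive_continuous v : continuous ('D_v (psi \_ P)).
Proof.
rewrite restricted_derive; apply: restricted_continuous; first exact: dpsi_out.
exact: test_function_derive_continuous.
Qed.

(** In each direction the integral of the derivative of ['D_v F * chi] is 0. There are no boundary
    terms because [chi], the part of psi living in [P], vanishes near the boundary of [P]; the
    Dirichlet condition on F enters through [polygon_H10]. *)
Lemma weak_equation (F : R * R -> R) r lam : 0 < r -> elementary F ->
  P `<=` square_box r ->
  (forall q, partial1 (partial1 F) q + partial2 (partial2 F) q = - lam * F q) ->
  L2dot M (partial1 F \_ P) (partial1 psi) + L2dot M (partial2 F \_ P) (partial2 psi) =
  L2dot M (fun q => lam * (F \_ P) q) psi.
Proof.
move=> r0 eF Pr FE; set chi := psi \_ P.
have PM : P `<=` M by rewrite MP; exact: subsetUl.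
have swap (H g : R * R -> R) : L2dot M (H \_ P) g = \int[area R]_q (H q * (g \_ P) q).
  rewrite /L2dot Rintegral_mkcond; apply: eq_Rintegral => q _; rewrite !patchE.
  case: ifPn => [_|qM]; first by case: ifPn => // _; rewrite mul0r mulr0.
  rewrite memNset ?mulr0// => Pq; move: qM; rewrite mem_set//; exact: PM.
have chi0 q : ~ square_box r q -> chi q = 0.
  by move=> h; rewrite /chi patchE memNset// => /Pr.
have cchi := restricted_test_continuous.
have int (H g : R * R -> R) : continuous H -> continuous g -> (forall q, ~ square_box r q -> g q = 0) ->
    (area R).-integrable setT (EFin \o (fun q => H q * g q)).
  move=> cH cg g0; apply: (@continuous_box_integrable r (fun q => H q * g q)) => [q|q /g0 ->].
    by apply: cvgM; [exact: cH|exact: cg].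
  by rewrite mulr0.
have ec G := elementary_continuous (R := R) (f := G).
have parts v : (forall G, (forall q, derivable G q v) -> continuous ('D_v G) ->
      (forall q, ~ square_box r q -> G q = 0) -> \int[area R]_q 'D_v G q = 0) ->
    \int[area R]_q ('D_v F q * ('D_v psi \_ P) q) = - \int[area R]_q ('D_v ('D_v F) q * chi q).
  move=> ibp.
  have cDF : continuous ('D_v F) by apply: ec; exact: elementary_derive.
  have cDDF : continuous ('D_v ('D_v F)) by apply: ec; do 2 apply: elementary_derive.
  have cDchi : continuous ('D_v psi \_ P).
    by rewrite -restricted_derive; exact: restricted_derive_continuous.
  apply/eqP; rewrite -addr_eq0 -RintegralD//; last 2 first.
  - apply: int => //.
    by rewrite -restricted_derive => q; exact: derive_out_box.
  - exact: int.
  have dG q : derivable (fun q => 'D_v F q * chi q) q v.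
    apply: derivableM; last exact: restricted_derivable.
    exact/diff_derivable/elementary_differentiable/elementary_derive.
  have DG q : 'D_v (fun q => 'D_v F q * chi q) q =
      'D_v F q * ('D_v psi \_ P) q + 'D_v ('D_v F) q * chi q.
    rewrite deriveM//; last exact: restricted_derivable; last first.
      exact/diff_derivable/elementary_differentiable/elementary_derive.
    by rewrite -restricted_derive /GRing.scale/= [X in _ + X]mulrC.
  rewrite -[X in _ == X](ibp _ dG) ?(funext DG)//.
    move=> q; apply: cvgD; apply: cvgM.
    - exact: cDF.
    - exact: cDchi.
    - exact: cDDF.
    - exact: cchi.
  by move=> q /chi0 ->; rewrite mulr0.
rewrite !swap (parts (1, 0) (@integral_partial1_eq0 r ^~ r0)) (parts (0, 1) (@integral_partial2_eq0 r ^~ r0)).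
rewrite -opprD -RintegralD//; try by apply: int => //; apply: ec; do 2 apply: elementary_derive.
have -> : (fun q => lam * (F \_ P) q) = (fun q => lam * F q) \_ P.
  by apply/funext => q; rewrite !patchE; case: ifP => //; rewrite mulr0.
rewrite swap -[LHS]mulN1r -RintegralZl//; last first.
  rewrite (_ : _ \o _ = EFin \o (fun q => (- lam * F q) * chi q)).
    by apply: int => //; apply: ec; exact: elementaryZ.
  by apply/funext => q /=; rewrite -FE mulrDl.
apply: eq_Rintegral => q _; rewrite -mulrDl FE -/chi; ring.
Qed.

End restricted_test_function.
End integration_by_parts.

(** * The Dirichlet Laplacian: symmetry, and closedness of H^1_0 *)

Section dirichlet_operator.
Variable R : realType.
Implicit Types (f g : R * R -> R) (M : set (R * R)).

Lemma test_function_box M psi : test_function M psi ->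
  exists2 r : R, 0 < r & forall q, ~ square_box r q -> psi q = 0.
Proof.
case=> _ /compact_bounded [N [Nr NS]] _.
have [r [r0 Nr']] : exists r : R, 0 < r /\ N < r.
  by exists (Num.max N 0 + 1); split; rewrite (@le_lt_trans _ _ (Num.max N 0)) ?ltrDl// le_max lexx ?orbT.
exists r => // q; apply: contra_notP => /eqP psiq.
have /(NS _ Nr')/= : closure [set q | psi q != 0] q by exact: subset_closure.
by rewrite prod_normE ge_max => /andP[h1 h2]; apply/square_boxE.
Qed.

Lemma continuous_box_inL2 M r h : measurable (M : set (plane R)) -> continuous h ->
  (forall q, ~ square_box r q -> h q = 0) -> inL2 M h.
Proof.
move=> mM ch h0; apply/(inL2P mM); split.
  by apply: measurable_funTS; exact: continuous_plane_measurable.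
apply: (@integrableS _ _ _ _ setT) => //.
have := @continuous_box_integrable R r (fun q => h q ^+ 2).
apply; first by move=> q; apply: (cvg_comp h (fun x => x ^+ 2)); [exact: ch|exact: exprn_continuous].
by move=> q /h0 ->; rewrite expr0n.
Qed.

Lemma test_function_inL2 M psi : measurable (M : set (plane R)) ->
  test_function M psi ->
  [/\ inL2 M psi, inL2 M (partial1 psi) & inL2 M (partial2 psi)].
Proof.
move=> mM tpsi; have [r r0 psi0] := test_function_box tpsi.
split; apply: (continuous_box_inL2 (r := r) mM).
- exact: test_function_continuous tpsi.
- exact: psi0.
- exact: test_function_derive_continuous tpsi _.
- by move=> q; exact: derive_out_box.
- exact: test_function_derive_continuous tpsi _.
- by move=> q; exact: derive_out_box.
Qed.

(** Both sides are continuous for the H^1 norm, so the identity passes from test functions to their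
    closure. *)
Lemma H10_weak_extend M f g1 g2 h1 h2 w : measurable (M : set (plane R)) ->
  H10_with_gradient M f g1 g2 -> inL2 M h1 -> inL2 M h2 -> inL2 M w ->
  (forall psi, test_function M psi ->
    L2dot M h1 (partial1 psi) + L2dot M h2 (partial2 psi) = L2dot M w psi) ->
  L2dot M h1 g1 + L2dot M h2 g2 = L2dot M w f.
Proof.
move=> mM [Lf Lg1 Lg2 [psi [tpsi c0 c1 c2]]] Lh1 Lh2 Lw weak.
have cv (a : nat -> R * R -> R) (b h : R * R -> R) : (forall n, inL2 M (a n)) -> inL2 M b -> inL2 M h ->
    L2norm M (a n - b) @[n --> \oo] --> 0%E -> L2dot M h (a n) @[n --> \oo] --> L2dot M h b.
  move=> La Lb Lh ab; under eq_fun do rewrite L2dotC; rewrite L2dotC.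
  apply: (L2dot_cvg mM La Lb Lh).
  apply/(L2norm_cvg0P mM (f := fun n => a n - b)) => //.
  by apply: nearW => n; exact: (inL2B mM (La n) Lb).
have L n := test_function_inL2 mM (tpsi n).
have C1 : L2dot M h1 (partial1 (psi n)) @[n --> \oo] --> L2dot M h1 g1.
  by apply: cv => // n; have [] := L n.
have C2 : L2dot M h2 (partial2 (psi n)) @[n --> \oo] --> L2dot M h2 g2.
  by apply: cv => // n; have [] := L n.
have C0 : L2dot M w (psi n) @[n --> \oo] --> L2dot M w f.
  by apply: cv => // n; have [] := L n.
apply: cvg_unique (C0); first exact: norm_hausdorff.
by rewrite -(funext (fun n => weak _ (tpsi n))); exact: cvgD.
Qed.

(** Both sides equal the Dirichlet form of f and g, each function serving as a test element for the
    equation of the other. *)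
Lemma dirichlet_laplacian_sym M f w g z : measurable (M : set (plane R)) ->
  dirichlet_laplacian M f w -> dirichlet_laplacian M g z ->
  L2dot M w g = L2dot M f z.
Proof.
move=> mM [Lw [f1 [f2 [Hf wf]]]] [Lz [g1 [g2 [Hg wg]]]].
have [Lf Lf1 Lf2 _] := Hf; have [Lg Lg1 Lg2 _] := Hg.
rewrite -(H10_weak_extend mM Hg Lf1 Lf2 Lw wf) [RHS]L2dotC.
by rewrite -(H10_weak_extend mM Hf Lg1 Lg2 Lz wg) ![L2dot M g1 _]L2dotC ![L2dot M g2 _]L2dotC.
Qed.

Lemma smooth_foldrD f g vs : smooth f -> smooth g ->
  foldr (fun v (h : R * R -> R) => 'D_v h) (fun q => f q + g q) vs =
  fun q => foldr (fun v (h : R * R -> R) => 'D_v h) f vs q + foldr (fun v (h : R * R -> R) => 'D_v h) g vs q.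
Proof.
move=> sf sg; elim: vs => //= v vs ->; apply/funext => q.
by rewrite deriveD//; apply: diff_derivable; [exact: sf|exact: sg].
Qed.

Lemma smooth_foldrZ c f vs : smooth f ->
  foldr (fun v (h : R * R -> R) => 'D_v h) (fun q => c * f q) vs =
  fun q => c * foldr (fun v (h : R * R -> R) => 'D_v h) f vs q.
Proof.
move=> sf; elim: vs => //= v vs ->; apply/funext => q.
by rewrite (@deriveZ _ _ _ _ c)//; apply: diff_derivable; exact: sf.
Qed.

Lemma test_functionD M f g : test_function M f -> test_function M g ->
  test_function M (fun q => f q + g q).
Proof.
move=> [sf cf Mf] [sg cg Mg].
have sub : closure [set q | f q + g q != 0] `<=`
    closure [set q | f q != 0] `|` closure [set q | g q != 0].
  rewrite -closureU; apply: closureS => q /=; have [->|f0 _] := eqVneq (f q) 0.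
    by rewrite add0r; right.
  by left.
split.
- move=> vs q; rewrite smooth_foldrD//; apply: differentiableD; [exact: sf|exact: sg].
- by apply: subclosed_compact sub; [exact: closed_closure|exact: compactU].
- by apply: subset_trans sub _ => q [/Mf|/Mg].
Qed.

Lemma test_functionZ M c f : test_function M f -> test_function M (fun q => c * f q).
Proof.
move=> [sf cf Mf].
have sub : closure [set q | c * f q != 0] `<=` closure [set q | f q != 0].
  by apply: closureS => q /=; rewrite mulf_eq0 negb_or => /andP[].
split.
- move=> vs q; rewrite smooth_foldrZ//; apply: differentiableZ; exact: sf.
- by apply: subclosed_compact sub; first exact: closed_closure.
- exact: subset_trans sub Mf.
Qed.

Section limits.
Variable M : set (R * R).
Hypothesis mM : measurable (M : set (plane R)).

Let sqr f : R := L2dot M f f.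

(** Trading the approximating sequence for a single approximant per tolerance makes diagonal
    arguments unnecessary in the proofs about sums and limits below. *)
Lemma H10_approx f g1 g2 : H10_with_gradient M f g1 g2 <->
  [/\ inL2 M f, inL2 M g1, inL2 M g2 & forall e : R, 0 < e -> exists psi,
    [/\ test_function M psi, sqr (fun q => psi q - f q) <= e,
      sqr (fun q => partial1 psi q - g1 q) <= e &
      sqr (fun q => partial2 psi q - g2 q) <= e]].
Proof.
have cv (a : nat -> R * R -> R) (b : R * R -> R) : (forall n, inL2 M (a n)) -> inL2 M b ->
    L2norm M (a n - b) @[n --> \oo] --> 0%E <->
    sqr (fun q => a n q - b q) @[n --> \oo] --> (0 : R).
  move=> La Lb; apply: (L2norm_cvg0P mM (f := fun n => a n - b)).
  by apply: nearW => n; exact: (inL2B mM (La n) Lb).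
have L psi := test_function_inL2 (M := M) (psi := psi) mM.
split=> -[Lf L1 L2].
  case=> psi [tpsi c0 c1 c2]; split => // e e0.
  have near (a : nat -> R * R -> R) (b : R * R -> R) : (forall n, inL2 M (a n)) -> inL2 M b ->
      L2norm M (a n - b) @[n --> \oo] --> 0%E ->
      \forall n \near \oo, sqr (fun q => a n q - b q) <= e.
    move=> La Lb /(cv _ _ La Lb) /cvgr0Pnorm_le /(_ e e0); apply: filterS => n.
    exact: le_trans (ler_norm _).
  have n0 := near _ _ (fun n => let: And3 h _ _ := L _ (tpsi n) in h) Lf c0.
  have n1 := near _ _ (fun n => let: And3 _ h _ := L _ (tpsi n) in h) L1 c1.
  have n2 := near _ _ (fun n => let: And3 _ _ h := L _ (tpsi n) in h) L2 c2.
  have [N _ H] : \forall n \near \oo, [/\ sqr (fun q => psi n q - f q) <= e,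
      sqr (fun q => partial1 (psi n) q - g1 q) <= e &
      sqr (fun q => partial2 (psi n) q - g2 q) <= e].
    by near=> n; split; near: n.
  by exists (psi N); have [? ? ?] := H N (leqnn N).
move=> H; split => //.
have en n : 0 < n.+1%:R^-1 :> R by rewrite invr_gt0 ltr0n.
have [psi Hpsi] := choice (fun n => H _ (en n)).
have tpsi n : test_function M (psi n) by case: (Hpsi n).
have sq (a : nat -> R * R -> R) (b : R * R -> R) : (forall n, inL2 M (a n)) -> inL2 M b ->
    (forall n, sqr (fun q => a n q - b q) <= n.+1%:R^-1) ->
    L2norm M (a n - b) @[n --> \oo] --> 0%E.
  move=> La Lb ab; apply/cv => //.
  apply: (@squeeze_cvgr _ _ _ _ (cst 0) (fun n => n.+1%:R^-1)).
  - by apply: nearW => n; rewrite ab L2dot_ge0.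
  - exact: cvg_cst.
  - exact: cvg_harmonic.
exists psi; split => //; apply: sq => // n.
- by case: (L _ (tpsi n)).
- by case: (Hpsi n).
- by case: (L _ (tpsi n)).
- by case: (Hpsi n).
- by case: (L _ (tpsi n)).
- by case: (Hpsi n).
Unshelve. all: by end_near.
Qed.

Lemma H10_sum (f g1 g2 : nat -> R * R -> R) (c : nat -> R) N :
  (forall k, H10_with_gradient M (f k) (g1 k) (g2 k)) ->
  H10_with_gradient M (fun q => \sum_(k < N) c k * f k q)
    (fun q => \sum_(k < N) c k * g1 k q) (fun q => \sum_(k < N) c k * g2 k q).
Proof.
move=> H; apply/H10_approx.
have Lf k : inL2 M (f k) by case: (H k).
have L1 k : inL2 M (g1 k) by case: (H k).
have L2 k : inL2 M (g2 k) by case: (H k).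
have Ls (h : nat -> R * R -> R) n : (forall k, inL2 M (h k)) -> inL2 M (fun q => \sum_(k < n) c k * h k q).
  by move=> Lh; apply: inL2_sum => // k; exact: inL2Z.
split; try exact: Ls.
elim: N => [|N IH] e e0.
  exists (cst 0); split.
  - split.
    + suff h vs : foldr (fun v (h : R * R -> R) => 'D_v h) (cst 0) vs = cst 0.
        by move=> vs q; rewrite h; exact: differentiable_cst.
      by elim: vs => //= v vs ->; apply/funext => q; rewrite derive_cst.
    + rewrite (_ : [set _ | _] = set0) ?closure0; first exact: compact0.
      by apply/seteqP; split => q //=; rewrite eqxx.
    + rewrite (_ : [set _ | _] = set0) ?closure0; first exact: sub0set.
      by apply/seteqP; split => q //=; rewrite eqxx.
  - rewrite /sqr /L2dot (@eq_Rintegral _ _ _ _ _ (cst 0)); last first.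
      by move=> q _; rewrite big_ord0 subr0 mulr0.
    by rewrite Rintegral_cst// mul0r ltW.
  - rewrite /sqr /L2dot (@eq_Rintegral _ _ _ _ _ (cst 0)); last first.
      by move=> q _; rewrite big_ord0 /partial1 derive_cst subr0 mulr0.
    by rewrite Rintegral_cst// mul0r ltW.
  - rewrite /sqr /L2dot (@eq_Rintegral _ _ _ _ _ (cst 0)); last first.
      by move=> q _; rewrite big_ord0 /partial2 derive_cst subr0 mulr0.
    by rewrite Rintegral_cst// mul0r ltW.
have e4 : 0 < e / 4 by rewrite divr_gt0.
have [p [tp p0 p1 p2]] := IH _ e4.
have cp : 0 < 1 + c N ^+ 2 by rewrite ltr_pwDl// sqr_ge0.
(* By [L2dot_sqrD] the two squared errors are doubled, and the second one is also multiplied by the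
   square of [c N]; these tolerances keep the total below e. *)
have e5 : 0 < e / 4 / (1 + c N ^+ 2) by rewrite divr_gt0.
have [_ _ _ /(_ _ e5)[r [tr r0 r1 r2]]] := (H10_approx _ _ _).1 (H N).
have [Lp Lp1 Lp2] := test_function_inL2 mM tp.
have [Lr Lr1 Lr2] := test_function_inL2 mM tr.
have est (a b : R * R -> R) (h : nat -> R * R -> R) : inL2 M a -> inL2 M b ->
    (forall k, inL2 M (h k)) -> sqr (fun q => a q - \sum_(k < N) c k * h k q) <= e / 4 ->
    sqr (fun q => b q - h N q) <= e / 4 / (1 + c N ^+ 2) ->
    sqr (fun q => (a q + c N * b q) - \sum_(k < N.+1) c k * h k q) <= e.
  move=> La Lb Lh ha hb.
  have LA := inL2B mM La (Ls _ N Lh).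
  have LB := inL2B mM Lb (Lh N).
  have -> : sqr (fun q => (a q + c N * b q) - \sum_(k < N.+1) c k * h k q) =
      sqr (fun q => (a q - \sum_(k < N) c k * h k q) + c N * (b q - h N q)).
    by apply: L2dot_eq => q _; rewrite big_ord_recr/=; ring.
  apply: (le_trans (L2dot_sqrD mM LA (inL2Z mM (c N) LB))).
  rewrite (L2dotZl mM _ LB (inL2Z mM _ LB)) L2dotC (L2dotZl mM _ LB LB).
  move: hb; rewrite ler_pdivlMr// => hb.
  have := L2dot_ge0 M (fun q => b q - h N q); rewrite -/(sqr _) in hb *.
  move: ha hb; rewrite /sqr; nra.
have D v (q : R * R) : 'D_v (fun q => p q + c N * r q) q = 'D_v p q + c N * 'D_v r q.
  rewrite deriveD ?(@deriveZ _ _ _ _ (c N))//; first exact: test_function_derivable tr _ _.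
  - exact: test_function_derivable tp _ _.
  - apply: derivableZ; exact: test_function_derivable tr _ _.
exists (fun q => p q + c N * r q); split.
- by apply: test_functionD => //; exact: test_functionZ.
- exact: est.
- have -> : partial1 (fun q => p q + c N * r q) = fun q => partial1 p q + c N * partial1 r q.
    by apply/funext => q; exact: D.
  exact: est.
- have -> : partial2 (fun q => p q + c N * r q) = fun q => partial2 p q + c N * partial2 r q.
    by apply/funext => q; exact: D.
  exact: est.
Qed.

(** H^1_0 is closed, and this is what puts an infinite eigenfunction series into the domain of the
    Laplacian. *)
Lemma H10_limit (f g1 g2 : nat -> R * R -> R) (F G1 G2 : R * R -> R) :
  (forall n, H10_with_gradient M (f n) (g1 n) (g2 n)) ->
  inL2 M F -> inL2 M G1 -> inL2 M G2 ->
  sqr (fun q => f n q - F q) @[n --> \oo] --> (0 : R) ->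
  sqr (fun q => g1 n q - G1 q) @[n --> \oo] --> (0 : R) ->
  sqr (fun q => g2 n q - G2 q) @[n --> \oo] --> (0 : R) ->
  H10_with_gradient M F G1 G2.
Proof.
move=> H LF LG1 LG2 c0 c1 c2; apply/H10_approx; split => // e e0.
have e4 : 0 < e / 4 by rewrite divr_gt0.
have near (h : nat -> R) : h n @[n --> \oo] --> (0 : R) -> \forall n \near \oo, h n <= e / 4.
  by move=> /cvgr0Pnorm_le /(_ _ e4); apply: filterS => n; exact: le_trans (ler_norm _).
have n0 := near _ c0; have n1 := near _ c1; have n2 := near _ c2.
have [N _ HN] : \forall n \near \oo, [/\ sqr (fun q => f n q - F q) <= e / 4,
    sqr (fun q => g1 n q - G1 q) <= e / 4 & sqr (fun q => g2 n q - G2 q) <= e / 4].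
  by near=> n; split; near: n.
have [h0 h1 h2] := HN N (leqnn N).
have [Lf L1 L2 /(_ _ e4)[p [tp p0 p1 p2]]] := (H10_approx _ _ _).1 (H N).
have [Lp Lp1 Lp2] := test_function_inL2 mM tp.
have est (a b h : R * R -> R) : inL2 M a -> inL2 M b -> inL2 M h ->
    sqr (fun q => a q - b q) <= e / 4 -> sqr (fun q => b q - h q) <= e / 4 ->
    sqr (fun q => a q - h q) <= e.
  move=> La Lb Lh ab bh.
  have -> : sqr (fun q => a q - h q) = sqr (fun q => (a q - b q) + (b q - h q)).
    by apply: L2dot_eq => q _; ring.
  apply: (le_trans (L2dot_sqrD mM (inL2B mM La Lb) (inL2B mM Lb Lh))).
  by move: ab bh; rewrite /sqr; lra.
exists p; split => //.
- exact: est Lp Lf LF p0 h0.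
- exact: est Lp1 L1 LG1 p1 h1.
- exact: est Lp2 L2 LG2 p2 h2.
Unshelve. all: by end_near.
Qed.

End limits.
End dirichlet_operator.

(** * The heat content of an eigenfunction expansion *)

Section telescoping_series.
Variable R : realType.

(** This is 1 / ((k + 1) (k + 2)): a summable majorant of quadratic decay whose tails are
    explicit. *)
Definition tele (k : nat) : R := k.+1%:R^-1 - k.+2%:R^-1.

Lemma tele_ge0 k : 0 <= tele k.
Proof. by rewrite subr_ge0 lef_pV2 ?posrE ?ltr0n// ler_nat. Qed.

Lemma sum_tele m n : (m <= n)%N -> \sum_(m <= k < n) tele k = m.+1%:R^-1 - n.+1%:R^-1.
Proof.
move=> mn; rewrite (eq_bigr (fun k => (- k.+2%:R^-1) - (- k.+1%:R^-1))); last first.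
  by move=> k _; rewrite opprK addrC.
by rewrite (telescope_sumr (fun k => - k.+1%:R^-1) mn) opprK addrC.
Qed.

Definition tsum (x : nat -> R) : R := limn (fun N => \sum_(k < N) x k).

Lemma tsum_cvg_tail (x : nat -> R) (K : R) : (forall k, `|x k| <= K * tele k) ->
  (\sum_(k < N) x k) @[N --> \oo] --> tsum x /\
  forall N, `|tsum x - \sum_(k < N) x k| <= K / N.+1%:R.
Proof.
move=> xK.
have K0 : 0 <= K.
  have := le_trans (normr_ge0 _) (xK 0%N); rewrite pmulr_lge0// /tele; lra.
have sumB m n : (m <= n)%N -> `|\sum_(k < n) x k - \sum_(k < m) x k| <= K / m.+1%:R.
  move=> mn; rewrite -!(big_mkord xpredT x) (big_cat_nat (leq0n m) mn)/= [X in X - _]addrC addrK.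
  rewrite (le_trans (ler_norm_sum _ _ _))// (le_trans (ler_sum _ (fun k _ => xK k)))//.
  by rewrite -mulr_sumr sum_tele// ler_wpM2l// gerBl invr_ge0.
have cv : cvgn (fun N => \sum_(k < N) x k).
  under eq_fun do rewrite -(big_mkord xpredT x).
  apply: normed_cvg; apply: (@series_le_cvg _ _ (fun k => K * tele k)) => //.
    by move=> n; exact: normr_ge0.
    by move=> n; rewrite mulr_ge0// tele_ge0.
  apply: (cvgP (K * (1 - 0))).
  rewrite (_ : series _ = fun n => K * (1 - n.+1%:R^-1)).
    by apply: cvgMr; apply: cvgB; [exact: cvg_cst|exact: cvg_harmonic].
  by apply/funext => n; rewrite /series/= -mulr_sumr sum_tele// invr1.
split => // N.
have h : `|\sum_(k < n) x k - \sum_(k < N) x k| @[n --> \oo] --> `|tsum x - \sum_(k < N) x k|.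
  by apply: cvg_norm; apply: cvgB => //; exact: cvg_cst.
by apply: (cvgr_to_le h); exists N => //= n; exact: sumB.
Qed.

Lemma tsum_le (x : nat -> R) (K : R) : (forall k, `|x k| <= K * tele k) -> `|tsum x| <= K.
Proof. by move=> /tsum_cvg_tail[_ /(_ 0%N)]; rewrite big_ord0 subr0 divr1. Qed.

Lemma tsum_lin (x y z : nat -> R) (a b c K : R) :
  (forall k, `|x k| <= K * tele k) -> (forall k, `|y k| <= K * tele k) ->
  (forall k, `|z k| <= K * tele k) ->
  tsum (fun k => a * x k + b * y k + c * z k) = a * tsum x + b * tsum y + c * tsum z.
Proof.
move=> /tsum_cvg_tail[cx _] /tsum_cvg_tail[cy _] /tsum_cvg_tail[cz _].
apply/cvg_lim => //.
under eq_fun do rewrite !big_split/= -!mulr_sumr.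
by apply: cvgD; [apply: cvgD|]; apply: cvgMr.
Qed.

End telescoping_series.

(** * A heat solution given by its eigenfunction series *)

Section heat_solution.
Variables (R : realType) (M : set (plane R)) (phi g1 g2 : nat -> plane R -> R)
  (lam : nat -> R) (A : R).
Hypothesis mM : measurable M.
Hypothesis aM : (area R M < +oo)%E.
Hypothesis Hphi : forall k, H10_with_gradient M (phi k) (g1 k) (g2 k).
Hypothesis Hweak : forall k psi, test_function M psi ->
  L2dot M (g1 k) (partial1 psi) + L2dot M (g2 k) (partial2 psi) =
  L2dot M (fun q => lam k * phi k q) psi.
Hypothesis Hon : forall i j, L2dot M (phi i) (phi j) = (i == j)%:R.
Hypothesis lam0 : forall k, 0 <= lam k.
Hypothesis Aphi : forall k q, M q -> `|phi k q| <= A * (1 + lam k) ^+ 2.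
Hypothesis Ag1 : forall k q, M q -> `|g1 k q| <= A * (1 + lam k) ^+ 2.
Hypothesis Ag2 : forall k q, M q -> `|g2 k q| <= A * (1 + lam k) ^+ 2.
Hypothesis Agrowth : forall k, k.+1%:R <= A * (1 + lam k) ^+ 3.

Let one : plane R -> R := cst 1.
Let a k := L2dot M one (phi k).
Let sqr f : R := L2dot M f f.
Hypothesis Hone : sqr (fun q => 1 - \sum_(k < N) a k * phi k q) @[N --> \oo] --> (0 : R).

Let A0 : 0 < A.
Proof.
have := lt_le_trans (ltr0n R 1) (Agrowth 0).
by rewrite pmulr_lgt0// exprn_gt0// ltr_pwDl.
Qed.

Let Lphi k : inL2 M (phi k). Proof. by case: (Hphi k). Qed.

Let Lone : inL2 M one.
Proof. by apply: (@inL2_bounded R M mM one 1 aM) => [|q _]; [exact: measurable_cst|rewrite normr1]. Qed.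

Let a_bound k : `|a k| <= 1 + sqr one.
Proof.
have := L2dot_CauchySchwarz mM Lone (Lphi k); rewrite Hon eqxx mulr1.
rewrite -/(a k) -/(sqr one) => h.
have s0 : 0 <= sqr one by exact: L2dot_ge0.
by rewrite ler_norml; nra.
Qed.

Lemma heat_decay p (t : R) : 0 < t ->
  exists2 K : R, 0 <= K & forall k, (1 + lam k) ^+ p * expR (- (lam k * t)) <= K * tele R k.
Proof.
(* The exponential beats the power m + 1 = p + 6 of x = 1 + [lam k]: p factors cancel x^p, and the
   other six dominate the square of k + 1 by [Agrowth], hence the inverse of [tele]. *)
move=> t0; pose m := (p + 5)%N.
pose K := expR t * (m.+1)`!%:R * t ^- m.+1 * (2 * A ^+ 2).
exists K; first by rewrite !mulr_ge0 ?expR_ge0 ?invr_ge0 ?exprn_ge0 ?ltW.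
move=> k; set x := 1 + lam k.
have x1 : 1 <= x by rewrite lerDl.
have x0 : 0 < x by rewrite (lt_le_trans _ x1).
have -> : - (lam k * t) = t - x * t by rewrite /x; ring.
have h1 : expR (- (x * t)) <= m.+1`!%:R / (x * t) ^+ m.+1.
  have xt0 : 0 < x * t by rewrite mulr_gt0.
  rewrite expRN -[leRHS]invrK lef_pV2 ?posrE ?invr_gt0 ?divr_gt0 ?exprn_gt0 ?ltr0n ?fact_gt0 ?expR_gt0//.
  rewrite invf_div; apply: le_trans (expR_ge1Dxn m (ltW xt0)); by rewrite lerDr.
have h2 : (x ^+ 6)^-1 <= (2 * A ^+ 2) * tele R k.
  have k1 : (0 : R) < k.+1%:R by rewrite ltr0n.
  have -> : tele R k = (k.+1%:R * k.+2%:R)^-1.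
    rewrite /tele -[in k.+2%:R]addn1 natrD; field.
    by have k0 := ler0n R k; apply/andP; split; rewrite gt_eqF//; lra.
  rewrite ler_pdivlMr ?mulr_gt0 ?ltr0n// mulrC ler_pdivrMr ?exprn_gt0//.
  have e6 : x ^+ 6 = x ^+ 3 * x ^+ 3 by rewrite -exprD.
  have k2 : k.+2%:R <= 2 * k.+1%:R :> R by rewrite -natrM ler_nat; lia.
  have := Agrowth k; rewrite -/x e6; set y := x ^+ 3 => hy.
  nra.
apply: (@le_trans _ _ (x ^+ p * (expR t * (m.+1`!%:R / (x * t) ^+ m.+1)))).
  by rewrite expRD ler_wpM2l ?exprn_ge0 ?(ltW x0)// ler_wpM2l ?expR_ge0.
have -> : x ^+ p * (expR t * (m.+1`!%:R / (x * t) ^+ m.+1)) =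
    expR t * m.+1`!%:R * t ^- m.+1 * (x ^+ 6)^-1.
  rewrite exprMn; have -> : x ^+ m.+1 = x ^+ p * x ^+ 6 by rewrite -exprD /m; congr (_ ^+ _); lia.
  by field; rewrite !expf_neq0 ?gt_eqF.
rewrite /K -[leRHS]mulrA ler_wpM2l// !mulr_ge0 ?expR_ge0 ?invr_ge0 ?exprn_ge0 ?ltW//.
Qed.

Let dominated (x : nat -> plane R -> R) (K : R) :=
  forall k q, M q -> `|x k q| <= K * tele R k.

(** The exponent p leaves room for powers of the eigenvalue: it is 0 for the heat series, 1 for its
    Laplacian and 2 for the error of its difference quotient. *)
Let coef_dominated (be : nat -> R) (f : nat -> plane R -> R) (C t : R) p :
  0 < t -> (forall k, `|be k| <= C * ((1 + lam k) ^+ p * expR (- (lam k * t)))) ->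
  (forall k q, M q -> `|f k q| <= A * (1 + lam k) ^+ 2) ->
  exists2 K : R, 0 <= K & dominated (fun k q => be k * f k q) K.
Proof.
move=> t0 beC fA; have [K K0 HK] := heat_decay (p + 2) t0.
exists (`|C| * A * K); first by rewrite !mulr_ge0// ltW.
move=> k q Mq; rewrite normrM.
have x0 : 0 <= 1 + lam k by rewrite addr_ge0.
apply: (@le_trans _ _ (`|C| * ((1 + lam k) ^+ p * expR (- (lam k * t))) * (A * (1 + lam k) ^+ 2))).
  apply: ler_pM => //; last exact: fA.
  apply: (le_trans (beC k)); rewrite ler_wpM2r ?ler_norm//.
  by rewrite mulr_ge0 ?exprn_ge0 ?expR_ge0.
have -> : `|C| * ((1 + lam k) ^+ p * expR (- (lam k * t))) * (A * (1 + lam k) ^+ 2) =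
    `|C| * A * ((1 + lam k) ^+ (p + 2) * expR (- (lam k * t))) by rewrite exprD; ring.
by rewrite -[leRHS]mulrA ler_wpM2l// mulr_ge0// ltW.
Qed.

Let series_inL2 (x : nat -> plane R -> R) K : dominated x K ->
  (forall k, inL2 M (x k)) -> inL2 M (fun q => tsum (x ^~ q)).
Proof.
move=> xK Lx; apply: (@inL2_bounded R M mM _ K aM); last first.
  by move=> q Mq; apply: tsum_le => k; exact: xK.
apply: (@measurable_fun_cvg _ _ _ M (fun N q => \sum_(k < N) x k q)).
  by move=> N; apply: (inL2_measurable mM); exact: inL2_sum.
by move=> q Mq; have [] := tsum_cvg_tail (fun k => xK k q Mq).
Qed.

Let series_cvg (x : nat -> plane R -> R) K : dominated x K ->
  (forall k, inL2 M (x k)) ->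
  sqr (fun q => \sum_(k < N) x k q - tsum (x ^~ q)) @[N --> \oo] --> (0 : R).
Proof.
move=> xK Lx; have LS N : inL2 M (fun q => \sum_(k < N) x k q) by exact: inL2_sum.
have Lt := series_inL2 xK Lx.
have tail N q : M q -> `|\sum_(k < N) x k q - tsum (x ^~ q)| <= K / N.+1%:R.
  by move=> Mq; rewrite distrC; have [_ ->] := tsum_cvg_tail (fun k => xK k q Mq).
apply: (L2_dominated_cvg mM (B := `|K|) aM) => [N|N q Mq|q Mq].
- by apply: (inL2_measurable mM); exact: inL2B.
- apply: (le_trans (tail N q Mq)); apply: (le_trans (ler_norm _)).
  by rewrite normrM ler_piMr// ger0_norm// invf_le1 ?ltr0n// ler1n.
- rewrite -[X in _ --> X](subrr (tsum (x ^~ q))); apply: cvgB; last exact: cvg_cst.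
  by have [] := tsum_cvg_tail (fun k => xK k q Mq).
Qed.

Let heat t q := tsum (fun k => expR (- (lam k * t)) * a k * phi k q).
Let heat_lap t q := tsum (fun k => lam k * (expR (- (lam k * t)) * a k) * phi k q).

Let coef_bound t k : `|expR (- (lam k * t)) * a k| <=
  (1 + sqr one) * ((1 + lam k) ^+ 0 * expR (- (lam k * t))).
Proof.
by rewrite normrM ger0_norm ?expR_ge0// expr0 mul1r mulrC ler_wpM2r ?expR_ge0.
Qed.

Let coef_lap_bound t k : `|lam k * (expR (- (lam k * t)) * a k)| <=
  (1 + sqr one) * ((1 + lam k) ^+ 1 * expR (- (lam k * t))).
Proof.
rewrite normrM ger0_norm// expr1 mulrCA ler_pM//; first by rewrite lerDr.
by apply: le_trans (coef_bound t k) _; rewrite expr0 mul1r.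
Qed.

(** Partial sums lie in H^1_0, and together with their gradients they converge uniformly on [M],
    hence in L^2, since [M] has finite area. The weak equation passes to the limit term by term. *)
Let heat_laplacian t : 0 < t -> dirichlet_laplacian M (heat t) (heat_lap t).
Proof.
move=> t0.
have [K _ HK] := coef_dominated t0 (coef_bound t) Aphi.
have [K1 _ HK1] := coef_dominated t0 (coef_bound t) Ag1.
have [K2 _ HK2] := coef_dominated t0 (coef_bound t) Ag2.
have [K3 _ HK3] := coef_dominated t0 (coef_lap_bound t) Aphi.
have L0 k := inL2Z mM (expR (- (lam k * t)) * a k) (Lphi k).
have L1 k : inL2 M (fun q => expR (- (lam k * t)) * a k * g1 k q).
  by apply: inL2Z => //; case: (Hphi k).
have L2 k : inL2 M (fun q => expR (- (lam k * t)) * a k * g2 k q).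
  by apply: inL2Z => //; case: (Hphi k).
have L3 k := inL2Z mM (lam k * (expR (- (lam k * t)) * a k)) (Lphi k).
split; first exact: series_inL2 HK3 L3.
exists (fun q => tsum (fun k => expR (- (lam k * t)) * a k * g1 k q)),
  (fun q => tsum (fun k => expR (- (lam k * t)) * a k * g2 k q)); split.
  apply: (H10_limit mM (fun N => H10_sum mM (fun k => expR (- (lam k * t)) * a k) N Hphi)).
  - exact: series_inL2 HK L0.
  - exact: series_inL2 HK1 L1.
  - exact: series_inL2 HK2 L2.
  - exact: series_cvg HK L0.
  - exact: series_cvg HK1 L1.
  - exact: series_cvg HK2 L2.
move=> psi tpsi; have [Lp Lp1 Lp2] := test_function_inL2 mM tpsi.
have cv (x : nat -> plane R -> R) K' h : dominated x K' -> (forall k, inL2 M (x k)) -> inL2 M h ->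
    \sum_(k < N) L2dot M (x k) h @[N --> \oo] --> L2dot M (fun q => tsum (x ^~ q)) h.
  move=> xK Lx Lh; under eq_fun do rewrite -L2dot_suml//.
  apply: L2dot_cvg => //; last exact: series_cvg xK Lx.
    by move=> n; exact: inL2_sum.
  exact: series_inL2 xK Lx.
have C3 := cv _ _ _ HK3 L3 Lp.
have C12 : \sum_(k < N) L2dot M (fun q => lam k * (expR (- (lam k * t)) * a k) * phi k q) psi @[N --> \oo] -->
    L2dot M (fun q => tsum (fun k => expR (- (lam k * t)) * a k * g1 k q)) (partial1 psi) +
    L2dot M (fun q => tsum (fun k => expR (- (lam k * t)) * a k * g2 k q)) (partial2 psi).
  rewrite (_ : (fun N => _) = fun N =>
      \sum_(k < N) L2dot M (fun q => expR (- (lam k * t)) * a k * g1 k q) (partial1 psi) +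
      \sum_(k < N) L2dot M (fun q => expR (- (lam k * t)) * a k * g2 k q) (partial2 psi)).
    by apply: cvgD; [exact: cv HK1 L1 Lp1|exact: cv HK2 L2 Lp2].
  apply/funext => N; rewrite -big_split/=; apply: eq_bigr => k _.
  have [_ Lg1 Lg2 _] := Hphi k.
  rewrite (L2dotZl mM _ (Lphi k) Lp) (L2dotZl mM _ Lg1 Lp1) (L2dotZl mM _ Lg2 Lp2).
  by rewrite -mulrDr Hweak// (L2dotZl mM _ (Lphi k) Lp); ring.
exact: (cvg_unique _ C12 C3).
Qed.

Lemma expR_taylor1 (y : R) : `|expR y - 1 - y| <= y ^+ 2 * expR `|y|.
Proof.
have h1 := expR_ge1Dx y; have h2 := expR_ge1Dx (- y).
have e0 := expR_gt0 y.
have h3 : expR y * expR (- y) = 1 by rewrite expRxMexpNx_1.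
(* This is exp (- y) >= 1 - y multiplied by exp y. *)
have h4 : expR y - 1 - y <= y * (expR y - 1) by nra.
rewrite ger0_norm; last by lra.
apply: (le_trans h4); have [y0|y0] := leP 0 y.
  by rewrite ger0_norm//; nra.
rewrite ltr0_norm//; have : 1 <= expR (- y) by rewrite -expR0 ler_expR; lra.
nra.
Qed.

(** The Taylor remainder costs a factor exp (lambda |h|). Since |h| <= t / 2, half of the decay exp
    (- lambda t) pays for it and the other half remains. *)
Let heat_quotient_bound t h k : 0 < t -> h != 0 -> `|h| <= t / 2 ->
  `|h^-1 * (expR (- (lam k * (t + h))) - expR (- (lam k * t))) + lam k * expR (- (lam k * t))| <=
  `|h| * ((1 + lam k) ^+ 2 * expR (- (lam k * (t / 2)))).
Proof.
move=> t0 h0 ht.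
have -> : - (lam k * (t + h)) = - (lam k * t) + (- (lam k * h)) by ring.
rewrite expRD.
have -> : h^-1 * (expR (- (lam k * t)) * expR (- (lam k * h)) - expR (- (lam k * t))) + lam k * expR (- (lam k * t))
   = h^-1 * (expR (- (lam k * t)) * (expR (- (lam k * h)) - 1 - (- (lam k * h)))) by field.
rewrite !normrM normfV (ger0_norm (expR_ge0 _)) ler_pdivrMl ?normr_gt0//.
have := expR_taylor1 (- (lam k * h)); set y := `|expR _ - 1 - _|; move=> hy.
apply: (@le_trans _ _ (expR (- (lam k * t)) * ((- (lam k * h)) ^+ 2 * expR `|- (lam k * h)|))).
  by rewrite ler_wpM2l ?expR_ge0.
have -> : expR (- (lam k * t)) * ((- (lam k * h)) ^+ 2 * expR `|- (lam k * h)|) =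
    (lam k * h) ^+ 2 * expR (- (lam k * t) + `|- (lam k * h)|) by rewrite expRD sqrrN; ring.
have -> : `|h| * (`|h| * ((1 + lam k) ^+ 2 * expR (- (lam k * (t / 2))))) =
    ((1 + lam k) * `|h|) ^+ 2 * expR (- (lam k * (t / 2))) by ring.
apply: ler_pM; rewrite ?sqr_ge0 ?expR_ge0//.
  rewrite -[leLHS](real_normK (num_real _)) lerXn2r ?nnegrE ?mulr_ge0 ?addr_ge0//.
  by rewrite normrM (ger0_norm (lam0 k)) ler_wpM2r// lerDr.
rewrite ler_expR normrN normrM (ger0_norm (lam0 k)).
have : lam k * `|h| <= lam k * (t / 2) by rewrite ler_wpM2l.
lra.
Qed.

Let near0_half (t : R) : 0 < t -> \forall h \near (0 : R)^', h != 0 /\ `|h| <= t / 2.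
Proof.
move=> t0; have t2 : 0 < t / 2 by rewrite divr_gt0.
near=> h; split; first by near: h; exact: nbhs_dnbhs_neq.
by near: h; apply: nbhs_dnbhs; apply/nbhs_ballP; exists (t / 2) => //= z;
  rewrite /ball/= sub0r normrN => /ltW.
Unshelve. all: by end_near.
Qed.

Let heat_inL2 t : 0 < t -> inL2 M (heat t).
Proof. by move=> /heat_laplacian[_ [? [? [[]]]]]. Qed.

Let L2dot_le_bound f (B : R) : inL2 M f -> (forall q, M q -> `|f q| <= B) ->
  sqr f <= B ^+ 2 * fine (area R M).
Proof.
move=> Lf fB; rewrite -Rintegral_cst//; apply: le_Rintegral => //.
- exact: inL2_dot_integrable.
- by apply: (@bounded_integrable _ M (cst (B ^+ 2)) `|B ^+ 2|).
- move=> q Mq; rewrite -expr2 -(real_normK (num_real (f q))) lerXn2r ?nnegrE ?fB//.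
  by rewrite (le_trans (normr_ge0 _) (fB _ Mq)).
Qed.

Let near0_le (d : R) : 0 < d -> \forall h \near (0 : R)^', `|h| <= d.
Proof.
move=> d0; apply: nbhs_dnbhs; apply/nbhs_ballP; exists d => //= z.
by rewrite /ball/= sub0r normrN => /ltW.
Qed.

Let heat_derivative t : 0 < t ->
  L2norm M (fun x => h^-1 * (heat (t + h) x - heat t x) + heat_lap t x) @[h --> 0^'] --> 0%E.
Proof.
move=> t0; have t20 : 0 < t / 2 by rewrite divr_gt0.
have th0 h : `|h| <= t / 2 -> 0 < t + h by rewrite ler_norml; lra.
have [Llap _] := heat_laplacian t0.
have Lq h : h != 0 /\ `|h| <= t / 2 ->
    inL2 M (fun x => h^-1 * (heat (t + h) x - heat t x) + heat_lap t x).
  by move=> [h0 ht]; do 2?[apply: inL2D => //; apply: inL2Z => //; apply: inL2B => //];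
    apply: heat_inL2 => //; exact: th0.
pose be k := (1 + lam k) ^+ 2 * expR (- (lam k * (t / 2))) * a k.
have beb k : `|be k| <= (1 + sqr one) * ((1 + lam k) ^+ 2 * expR (- (lam k * (t / 2)))).
  have x0 : 0 <= (1 + lam k) ^+ 2 * expR (- (lam k * (t / 2))).
    by rewrite mulr_ge0 ?exprn_ge0 ?expR_ge0 ?addr_ge0.
  by rewrite /be normrM (ger0_norm x0) mulrC ler_wpM2r.
have [K K0 HK] := coef_dominated t20 beb Aphi.
have ptw h q : h != 0 /\ `|h| <= t / 2 -> M q ->
    `|h^-1 * (heat (t + h) q - heat t q) + heat_lap t q| <= `|h| * K.
  move=> [h0 ht] Mq.
  have [K1 K10 HK1] := coef_dominated t0 (coef_bound t) Aphi.
  have [K2 K20 HK2] := coef_dominated (th0 _ ht) (coef_bound (t + h)) Aphi.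
  have [K3 K30 HK3] := coef_dominated t0 (coef_lap_bound t) Aphi.
have up (K' x : R) k : K' <= K1 + K2 + K3 -> `|x| <= K' * tele R k ->
      `|x| <= (K1 + K2 + K3) * tele R k.
    by move=> h1 h2; apply: (le_trans h2); rewrite ler_wpM2r// tele_ge0.
  have -> : h^-1 * (heat (t + h) q - heat t q) + heat_lap t q =
      h^-1 * heat (t + h) q + (- h^-1) * heat t q + 1 * heat_lap t q by ring.
  have l1 : K1 <= K1 + K2 + K3 by lra.
  have l2 : K2 <= K1 + K2 + K3 by lra.
  have l3 : K3 <= K1 + K2 + K3 by lra.
  have U1 k := up K1 (expR (- (lam k * t)) * a k * phi k q) k l1 (HK1 k q Mq).
  have U2 k := up K2 (expR (- (lam k * (t + h))) * a k * phi k q) k l2 (HK2 k q Mq).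
  have U3 k := up K3 (lam k * (expR (- (lam k * t)) * a k) * phi k q) k l3 (HK3 k q Mq).
  have := tsum_lin h^-1 (- h^-1) 1 U2 U1 U3.
  rewrite -/(heat (t + h) q) -/(heat t q) -/(heat_lap t q) => <-.
  apply: tsum_le => k.
  have -> : h^-1 * (expR (- (lam k * (t + h))) * a k * phi k q) + - h^-1 * (expR (- (lam k * t)) * a k * phi k q)
      + 1 * (lam k * (expR (- (lam k * t)) * a k) * phi k q) =
    (h^-1 * (expR (- (lam k * (t + h))) - expR (- (lam k * t))) + lam k * expR (- (lam k * t))) * (a k * phi k q).
    by ring.
  rewrite normrM; apply: (@le_trans _ _ (`|h| * ((1 + lam k) ^+ 2 * expR (- (lam k * (t / 2)))) * `|a k * phi k q|)).
    by rewrite ler_wpM2r//; exact: heat_quotient_bound.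
  have x0 : 0 <= (1 + lam k) ^+ 2 * expR (- (lam k * (t / 2))).
    by rewrite mulr_ge0 ?exprn_ge0 ?expR_ge0 ?addr_ge0.
  have := HK k q Mq; rewrite /be -[X in `|X|]mulrA normrM (ger0_norm x0) => hK.
  by rewrite -[leRHS]mulrA -[leLHS]mulrA ler_wpM2l.
apply/(L2norm_cvg0P mM); first by apply: filterS (near0_half t0) => h; exact: Lq.
apply/cvgr0Pnorm_le => e e0; set c := K ^+ 2 * fine (area R M).
have c0 : 0 <= c by rewrite mulr_ge0 ?sqr_ge0 ?fine_ge0.
have d0 : 0 < e / (1 + c) by rewrite divr_gt0// ltr_pwDl.
near=> h.
have [h0 ht] : h != 0 /\ `|h| <= t / 2 by near: h; exact: near0_half.
have h1 : `|h| <= 1 by near: h; exact: near0_le.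
have h2 : `|h| <= e / (1 + c) by near: h; exact: near0_le.
rewrite ger0_norm ?L2dot_ge0//.
apply: (le_trans (L2dot_le_bound (Lq _ (conj h0 ht)) (fun q => ptw h q (conj h0 ht)))).
have -> : (`|h| * K) ^+ 2 * fine (area R M) = `|h| * (`|h| * c) by rewrite /c; ring.
move: h2; rewrite ler_pdivlMr ?ltr_pwDl// mulrDr mulr1.
have := normr_ge0 h; nra.
Unshelve. all: by end_near.
Qed.

Let psum (c : nat -> R) N (q : plane R) : R := \sum_(k < N) c k * phi k q.

Let psum_inL2 c N : inL2 M (psum c N).
Proof. exact: partial_sum_inL2. Qed.
Let psum_dotl c N h : inL2 M h -> L2dot M (psum c N) h = \sum_(k < N) c k * L2dot M (phi k) h.
Proof. exact: partial_sum_dotl. Qed.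

Let psum_distance c N : sqr (fun q => psum c N q - one q) =
  sqr one - 2 * (\sum_(k < N) c k * a k) + \sum_(k < N) c k ^+ 2.
Proof. exact: partial_sum_distance. Qed.
Let defect N : sqr (fun q => psum a N q - one q) = sqr one - \sum_(k < N) a k ^+ 2.
Proof.
by rewrite psum_distance; under eq_bigr do rewrite -expr2; ring.
Qed.

Lemma bessel_one N : \sum_(k < N) a k ^+ 2 <= fine (area R M).
Proof.
have := defect N; have := L2dot_ge0 M (fun q => psum a N q - one q); rewrite -/(sqr _) => h1 h2.
suff : sqr one <= fine (area R M) by lra.
have := L2dot_le_bound (B := 1) Lone; rewrite expr1n mul1r; apply.
by move=> q _; rewrite normr1.
Qed.

Let defect_cvg : sqr (fun q => psum a N q - one q) @[N --> \oo] --> (0 : R).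
Proof.
move: Hone; apply: cvg_trans; apply: near_eq_cvg; apply: nearW => N.
by apply: eq_Rintegral => q _; rewrite /psum /one/=; ring.
Qed.

(** The solution is compared with its partial sums of length n >= N. Their terms with N <= k < n
    cost at most [a k ^+ 2] each, which is what the defect loses between N and n, so a bound in
    terms of N alone survives as n grows. *)
Let initial_estimate t N : 0 < t -> sqr (fun q => heat t q - 1) <=
  2 * (sqr (fun q => psum a N q - one q) +
       \sum_(k < N) (1 - expR (- (lam k * t))) ^+ 2 * a k ^+ 2).
Proof.
move=> t0; pose c k := expR (- (lam k * t)) * a k.
have [K _ HK] := coef_dominated t0 (coef_bound t) Aphi.
have L0 k : inL2 M (fun q => c k * phi k q) by exact: inL2Z.
have cv := series_cvg HK L0.
set rhs := 2 * _.
have est n : (N <= n)%N -> sqr (fun q => heat t q - 1) <=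
    2 * sqr (fun q => psum c n q - heat t q) + rhs.
  move=> Nn.
  have Lh := heat_inL2 t0; have Lpn := psum_inL2 c n.
  have -> : sqr (fun q => heat t q - 1) =
      sqr (fun q => (- 1) * (psum c n q - heat t q) + (psum c n q - one q)).
    by apply: L2dot_eq => q _; rewrite /one/=; ring.
  have LA := inL2B mM Lpn Lh; have LB := inL2B mM Lpn Lone.
  apply: (le_trans (L2dot_sqrD mM (inL2Z mM (-1) LA) LB)).
  rewrite (_ : L2dot M (fun q => -1 * _) _ = sqr (fun q => psum c n q - heat t q)); last first.
    by apply: eq_Rintegral => q _; ring.
  rewrite lerD2l /rhs -/(sqr _) ler_wpM2l// psum_distance defect.
  have -> : sqr one - 2 * (\sum_(k < n) c k * a k) + \sum_(k < n) c k ^+ 2 =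
      sqr one - \sum_(k < n) a k ^+ 2 + \sum_(k < n) (1 - expR (- (lam k * t))) ^+ 2 * a k ^+ 2.
    rewrite -!addrA; congr (_ + _); apply/eqP; rewrite -subr_eq0 opprD opprK mulr_sumr -!sumrN -!big_split/=.
    by apply/eqP; apply: big1 => k _; rewrite /c; ring.
  have split (F : nat -> R) : \sum_(k < n) F k = \sum_(k < N) F k + \sum_(N <= k < n) F k.
    by rewrite -!(big_mkord xpredT F) (big_cat_nat (leq0n N) Nn).
  rewrite (split (fun k => a k ^+ 2)) (split (fun k => (1 - expR (- (lam k * t))) ^+ 2 * a k ^+ 2)).
  suff : \sum_(N <= k < n) (1 - expR (- (lam k * t))) ^+ 2 * a k ^+ 2 <= \sum_(N <= k < n) a k ^+ 2 by lra.
  apply: ler_sum => k _; rewrite ler_piMl ?sqr_ge0//.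
  have e1 : expR (- (lam k * t)) <= 1 by rewrite -expR0 ler_expR oppr_le0 mulr_ge0// ltW.
  have e0 := expR_ge0 (- (lam k * t)).
  by rewrite expr_le1//; lra.
have h : 2 * sqr (fun q => psum c n q - heat t q) + rhs @[n --> \oo] --> 2 * 0 + rhs.
  by apply: cvgD; [apply: cvgMr; exact: cv|exact: cvg_cst].
rewrite mulr0 add0r in h; apply: (cvgr_to_ge h); exists N => //= n; exact: est.
Qed.

Let heat_initial : L2norm M (fun x => heat t x - 1) @[t --> 0^'+] --> 0%E.
Proof.
apply/(L2norm_cvg0P mM).
  near=> t; apply: inL2B => //; apply: heat_inL2; near: t; exact: nbhs_right_gt.
apply/cvgr0Pnorm_le => e e0.
have e4 : 0 < e / 4 by rewrite divr_gt0.
have [N _ HN] : \forall n \near \oo, sqr (fun q => psum a n q - one q) <= e / 4.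
  move: defect_cvg => /cvgr0Pnorm_le /(_ _ e4); apply: filterS => n.
  exact: le_trans (ler_norm _).
(* Since 0 <= 1 - exp (- x) <= x for x >= 0, the finite sum in [initial_estimate] is at most t^2
   c. *)
pose c := \sum_(k < N) lam k ^+ 2 * a k ^+ 2.
have c0 : 0 <= c by apply: sumr_ge0 => k _; rewrite mulr_ge0 ?sqr_ge0.
have d0 : 0 < e / 4 / (1 + c) by rewrite divr_gt0// ltr_pwDl.
near=> t.
have t0 : 0 < t by near: t; exact: nbhs_right_gt.
have t1 : t <= 1 by near: t; exact: nbhs_right_le.
have td : t <= e / 4 / (1 + c) by near: t; exact: nbhs_right_le.
rewrite ger0_norm ?L2dot_ge0//; apply: (le_trans (initial_estimate N t0)).
have := HN N (leqnn N) => /= hN.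
suff : \sum_(k < N) (1 - expR (- (lam k * t))) ^+ 2 * a k ^+ 2 <= e / 4 by lra.
apply: (@le_trans _ _ (t * (1 + c))); last by rewrite -ler_pdivlMr// ltr_pwDl.
apply: (@le_trans _ _ (t ^+ 2 * c)).
  rewrite /c mulr_sumr; apply: ler_sum => k _; rewrite mulrA ler_wpM2r ?sqr_ge0//.
  have e1 : expR (- (lam k * t)) <= 1 by rewrite -expR0 ler_expR oppr_le0 mulr_ge0// ltW.
  have := expR_ge1Dx (- (lam k * t)) => h.
  rewrite (_ : t ^+ 2 * _ = (lam k * t) ^+ 2); last by rewrite exprMn mulrC.
  by rewrite lerXn2r ?nnegrE ?subr_ge0 ?mulr_ge0 ?(ltW t0)//; lra.
rewrite expr2 -mulrA ler_pM2l//; have : t * c <= c by rewrite ler_piMl.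
lra.
Unshelve. all: by end_near.
Qed.

Lemma heat_solution_exists : heat_solution M heat.
Proof.
split; last exact: heat_initial.
move=> t t0; exists (heat_lap t); split; first exact: heat_laplacian.
exact: heat_derivative.
Qed.

Let phi_laplacian k : dirichlet_laplacian M (phi k) (fun q => lam k * phi k q).
Proof.
split; first exact: inL2Z.
by exists (g1 k), (g2 k); split => // psi; exact: Hweak.
Qed.

Let dot_phi_le f k : inL2 M f -> `|L2dot M f (phi k)| <= Num.sqrt (sqr f).
Proof.
move=> Lf; rewrite -sqrtr_sqr ler_sqrt ?L2dot_ge0//.
by apply: le_trans (L2dot_CauchySchwarz mM Lf (Lphi k)) _; rewrite Hon eqxx mulr1.
Qed.

Let dot_phi_cvg0 (T : Type) (F : set_system T) (f : T -> plane R -> R) k : Filter F ->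
  (\forall t \near F, inL2 M (f t)) -> L2norm M (f t) @[t --> F] --> 0%E ->
  L2dot M (f t) (phi k) @[t --> F] --> (0 : R).
Proof.
move=> FF Lf /(L2norm_cvg0P mM FF Lf) h.
apply/norm_cvg0P; apply: (@squeeze_cvgr _ _ _ _ (cst 0) (fun t => Num.sqrt (sqr (f t)))).
- by apply: filterS Lf => t Lft; rewrite normr_ge0/=; exact: dot_phi_le.
- exact: cvg_cst.
- rewrite [X in _ --> X](_ : 0 = Num.sqrt 0); last by rewrite sqrtr0.
  exact: (cvg_comp _ _ h (@sqrt_continuous R _)).
Qed.

(** * The coefficients of an arbitrary heat solution *)

Section uniqueness.
Variable v : R -> plane R -> R.
Hypothesis hv : heat_solution M v.

Let v_inL2 t : 0 < t -> inL2 M (v t).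
Proof. by case: hv => /(_ t) h _ /h[w [[_ [? [? [[]]]]]]]. Qed.

Let coef k t := L2dot M (v t) (phi k).

(** Testing the L^2 derivative of v against [phi k] and moving the Laplacian onto [phi k] by
    symmetry leaves a scalar linear equation. *)
Let coef_derive k (t : R) : 0 < t -> is_derive t (1 : R) (coef k) (- (lam k * coef k t)).
Proof.
move=> t0; have [w [Lw dw]] := hv.1 t t0.
have wphi : L2dot M w (phi k) = lam k * coef k t.
  rewrite (dirichlet_laplacian_sym mM Lw (phi_laplacian k)) L2dotC L2dotZl//.
    by rewrite L2dotC.
  exact: v_inL2.
have Lw2 : inL2 M w by case: Lw.
have near_pos : \forall h \near (0 : R)^', 0 < t + h.
  by apply: filterS (near0_half t0) => h [_]; rewrite ler_norml; lra.
have Lq h : 0 < t + h -> inL2 M (fun x => h^-1 * (v (t + h) x - v t x) + w x).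
  by move=> th; apply: inL2D => //; apply: inL2Z => //; apply: inL2B => //; exact: v_inL2.
have cv : h^-1 *: ((coef k \o shift t) (h *: 1) - coef k t) @[h --> 0^'] --> - (lam k * coef k t).
  rewrite -[X in _ --> X]add0r.
  have : L2dot M (fun x => h^-1 * (v (t + h) x - v t x) + w x) (phi k) - lam k * coef k t
      @[h --> 0^'] --> 0 - lam k * coef k t.
    apply: cvgB; last exact: cvg_cst.
    by apply: dot_phi_cvg0 => //; apply: filterS near_pos => h; exact: Lq.
  apply: cvg_trans; apply: near_eq_cvg; apply: filterS near_pos => h th.
  have Lvh := v_inL2 th; have Lv := v_inL2 t0; have Ld := inL2B mM Lvh Lv.
  rewrite (L2dotDl mM (inL2Z mM _ Ld) Lw2 (Lphi k)) (L2dotZl mM _ Ld (Lphi k)).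
  rewrite (L2dotBl mM Lvh Lv (Lphi k)) wphi addrK /= /GRing.scale/= mulr1 /coef.
  by rewrite [h + t]addrC.
by split; [exact: (cvgP _ cv)|exact: (cvg_lim _ cv)].
Qed.

Let coef_initial k : coef k t @[t --> 0^'+] --> a k.
Proof.
apply/subr_cvg0.
have : L2dot M (fun x => v t x - 1) (phi k) @[t --> 0^'+] --> (0 : R).
  apply: dot_phi_cvg0; last exact: hv.2.
  near=> t; apply: inL2B => //; apply: v_inL2; near: t; exact: nbhs_right_gt.
apply: cvg_trans; apply: near_eq_cvg; near=> t.
have t0 : 0 < t by near: t; exact: nbhs_right_gt.
by rewrite (L2dotBl mM (v_inL2 t0) Lone (Lphi k)).
Unshelve. all: by end_near.
Qed.

Let coefE k t : 0 < t -> coef k t = expR (- (lam k * t)) * a k.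
Proof.
(* The substitution t = exp s moves the half-line to the whole line, where a function with zero
   derivative is constant. *)
pose G s := expR (lam k * expR s) * coef k (expR s).
have dG s : is_derive s (1 : R) G 0.
  have h1 : is_derive s (1 : R) (coef k \o expR) (- (lam k * coef k (expR s)) * expR s).
    exact: is_derive1_comp (coef_derive k (expR_gt0 s)) (is_derive_expR s).
  have h2 : is_derive s (1 : R) (fun s => lam k * expR s) (lam k * expR s).
    by apply: is_derive_eq; rewrite /GRing.scale/= ?mulr0 ?addr0.
  have h3 : is_derive s (1 : R) (expR \o (fun s => lam k * expR s))
     (expR (lam k * expR s) * (lam k * expR s)).
    exact: is_derive1_comp.
  have h4 := is_deriveM h3 h1.
  apply: is_derive_eq h4 _; rewrite /GRing.scale/=; ring.
have Gc s s' : G s = G s' by exact: is_derive_0_is_cst.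
have lim : expR (lam k * t) * coef k t @[t --> 0^'+] --> 1 * a k.
  apply: cvgM; last exact: coef_initial.
  have : expR (lam k * x) @[x --> (0 : R)] --> expR (lam k * 0).
    apply: (@continuous_comp _ _ _ (fun x => lam k * x) expR); last exact: continuous_expR.
    exact: mulrl_continuous.
  by rewrite mulr0 expR0 => /cvg_at_right_filter.
move=> t0; have tE : expR (ln t) = t by rewrite lnK.
have : expR (lam k * t) * coef k t = a k.
  have cst_lim : expR (lam k * s) * coef k s @[s --> 0^'+] --> expR (lam k * t) * coef k t.
    have E : {near (0 : R)^'+, cst (expR (lam k * t) * coef k t) =1
        (fun s => expR (lam k * s) * coef k s)}.
      near=> s; have s0 : 0 < s by near: s; exact: nbhs_right_gt.
      by have := Gc (ln t) (ln s); rewrite /G !lnK.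
    exact: (cvg_trans (near_eq_cvg E) (cvg_cst _)).
  by rewrite -[RHS]mul1r; exact: (cvg_unique _ cst_lim lim).
move=> <-; rewrite mulrA expRN mulVf ?mul1r// gt_eqF// expR_gt0.
Unshelve. all: by end_near.
Qed.

(** The integral of [v t] is its product with the constant 1, so expanding 1 is enough: the partial
    expansions of 1 converge in L^2 and [coefE] evaluates their products with [v t]. *)
Lemma heat_solution_content t : 0 < t ->
  \sum_(k < N) expR (- (lam k * t)) * a k ^+ 2 @[N --> \oo] --> \int[area R]_(q in M) v t q.
Proof.
move=> t0; have -> : \int[area R]_(q in M) v t q = L2dot M one (v t).
  by apply: eq_Rintegral => q _; rewrite mul1r.
rewrite (_ : (fun N => _) = fun N => L2dot M (psum a N) (v t)).
  exact: (L2dot_cvg mM (psum_inL2 a) Lone (v_inL2 t0) defect_cvg).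
apply/funext => N; rewrite psum_dotl//; last exact: v_inL2.
by apply: eq_bigr => k _; rewrite L2dotC -/(coef k t) coefE//; ring.
Qed.

End uniqueness.

(** All heat solutions have the same integral by [heat_solution_content], so [xget] only has to be
    known to return one of them. *)
Lemma heat_content_cvg t : 0 < t ->
  \sum_(k < N) expR (- (lam k * t)) * a k ^+ 2 @[N --> \oo] --> heat_content M t.
Proof.
move=> t0; apply: heat_solution_content => //.
by apply: (@xgetI _ (fun=> fun=> 0) _ heat); exact: heat_solution_exists.
Qed.

End heat_solution.

(** * Completeness of the sine products *)

Section step_polynomials.
Variable R : realType.

Lemma bernoulli (x : R) n : -1 <= x -> 1 + n%:R * x <= (1 + x) ^+ n.
Proof.
move=> x1; elim: n => [|n IH]; first by rewrite mul0r addr0 expr0.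
rewrite exprS; apply: (@le_trans _ _ ((1 + x) * (1 + n%:R * x))); last by rewrite ler_wpM2l//; lra.
by rewrite -natr1; have := ler0n R n; nra.
Qed.

(** With r = s^2, the Bernoulli inequality for 1 / s bounds n s^n by 1 / (1 - s), and the remaining
    factor s^n tends to 0. *)
Lemma cvg_natmul_expr (r : R) : 0 <= r < 1 -> n%:R * r ^+ n @[n --> \oo] --> (0 : R).
Proof.
move=> /andP[r0 r1]; pose s := Num.sqrt r.
have s0 : 0 <= s by exact: sqrtr_ge0.
have ss : s * s = r by rewrite -expr2 sqr_sqrtr.
have s1 : s < 1 by have := s0; nra.
have bound n : n%:R * s ^+ n * (1 - s) <= 1.
  have [s00|sp] := eqVneq s 0.
    by case: n => [|n]; rewrite ?mul0r// s00 exprS mul0r mulr0 mul0r.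
  have sp' : 0 < s by rewrite lt0r sp.
  have v1 : 1 <= s^-1 by rewrite invf_ge1// ltW.
  have : 1 + n%:R * (s^-1 - 1) <= (s ^+ n)^-1.
    have := @bernoulli (s^-1 - 1) n; rewrite [1 + (_ - 1)]addrC subrK exprVn; apply; lra.
  have sn : 0 < s ^+ n by rewrite exprn_gt0.
  have sn1 : s ^+ n * (s ^- n) = 1 by rewrite mulfV// gt_eqF.
  have sv1 : s * s^-1 = 1 by rewrite mulfV.
  set u := s ^+ n in sn sn1 *; set w := u^-1; set v := s^-1.
  move=> h1; have n0 := ler0n R n.
  have h2 : n%:R * (v - 1) * u <= 1 - u.
    have : (1 + n%:R * (v - 1)) * u <= w * u by rewrite ler_pM2r.
    by rewrite [w * u]mulrC sn1; lra.
  have h3 : n%:R * u * (1 - s) = (n%:R * (v - 1) * u) * s.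
    by transitivity (n%:R * u * (s * v - s)); [rewrite sv1|ring].
  rewrite h3; apply: (@le_trans _ _ ((1 - u) * s)); first by rewrite ler_wpM2r.
  nra.
have s1' : 0 < 1 - s by rewrite subr_gt0.
apply: (@squeeze_cvgr _ _ _ _ (cst 0) (fun n => (1 - s)^-1 * s ^+ n)).
- near=> n; rewrite mulr_ge0 ?exprn_ge0//= -ss exprMn mulrA ler_wpM2r ?exprn_ge0//.
  by rewrite -[leRHS]mul1r ler_pdivlMr.
- exact: cvg_cst.
- rewrite [X in _ --> X](_ : 0 = (1 - s)^-1 * 0); last by rewrite mulr0.
  by apply: cvgMr; apply: cvg_expr; rewrite ger0_norm.
Unshelve. all: by end_near.
Qed.

(* The polynomial of the Brosowski-Deutsch proof of the Stone-Weierstrass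
   theorem; the extra factor n in the exponent makes the limit 0 at 1/2. *)
Definition step_poly (n : nat) (y : R) : R := (1 - y ^+ n) ^+ (n * 2 ^ n).

Lemma step_poly_bounds n y : 0 <= y <= 1 -> 0 <= step_poly n y <= 1.
Proof.
move=> /andP[y0 y1]; have yn : 0 <= y ^+ n <= 1 by rewrite exprn_ge0//= exprn_ile1.
by rewrite /step_poly exprn_ge0 ?exprn_ile1//; lra.
Qed.

Lemma step_poly_cvg1 y : 0 <= y < 1/2 -> step_poly n y @[n --> \oo] --> (1 : R).
Proof.
move=> /andP[y0 y2].
apply: (@squeeze_cvgr _ _ _ _ (fun n => 1 - n%:R * (2 * y) ^+ n) (cst 1)).
- near=> n; have y01 : 0 <= y <= 1 by apply/andP; split; lra.
  have /andP[_ ->] := step_poly_bounds n y01.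
  have : y ^+ n <= 1 by rewrite exprn_ile1//; lra.
  have yn : 0 <= y ^+ n by rewrite exprn_ge0.
  rewrite andbT => yn1; apply: le_trans (bernoulli (n * 2 ^ n) _); last by lra.
  by rewrite natrM natrX exprMn; lra.
- rewrite -[X in _ --> X]subr0; apply: cvgB; first exact: cvg_cst.
  by apply: cvg_natmul_expr; apply/andP; split; lra.
- exact: cvg_cst.
Unshelve. all: by end_near.
Qed.

Lemma step_poly_cvg0 y : 1/2 <= y <= 1 -> step_poly n y @[n --> \oo] --> (0 : R).
Proof.
move=> /andP[y2 y1]; have y0 : 0 <= y by lra.
apply: (@squeeze_cvgr _ _ _ _ (cst 0) (fun n => n.+1%:R^-1)); [|exact: cvg_cst|exact: cvg_harmonic].
near=> n; have y01 : 0 <= y <= 1 by rewrite y0.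
have /andP[-> _] /= := step_poly_bounds n y01.
(* The worst case is y = 1/2: the base is then at most exp (- 2^-n), and the exponent n 2^n turns
   this into exp (- n). *)
have h1 : 1 - y ^+ n <= expR (- (2^-1) ^+ n).
  apply: le_trans (expR_ge1Dx _); rewrite lerD2l lerN2 lerXn2r ?nnegrE//; lra.
have yn1 : y ^+ n <= 1 by rewrite exprn_ile1.
apply: (@le_trans _ _ (expR (- (2^-1) ^+ n) ^+ (n * 2 ^ n))).
  by rewrite lerXn2r ?nnegrE ?expR_ge0// subr_ge0.
rewrite -expRM_natl (_ : (n * 2 ^ n)%:R * _ = - n%:R); last first.
  by rewrite natrM natrX mulrN exprVn mulfK// expf_neq0.
rewrite expRN lef_pV2 ?posrE ?expR_gt0 ?ltr0n// (le_trans _ (expR_ge1Dx _))//.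
by rewrite -natr1 addrC.
Unshelve. all: by end_near.
Qed.

(* Newton iteration for 1 / |s|, times s *)
Fixpoint sign_poly (n : nat) (s : R) : R :=
  if n is m.+1 then sign_poly m s * (3 - sign_poly m s ^+ 2) / 2 else s.

Lemma sign_poly_bounds n s : 0 <= s <= 1 -> s <= sign_poly n s <= 1.
Proof.
move=> /andP[s0 s1]; elim: n => [|n /andP[h1 h2]] /=; first by rewrite lexx.
set v := sign_poly n s in h1 h2 *.
apply/andP; split.
  suff : v <= v * (3 - v ^+ 2) / 2 by lra.
  have : 0 <= v * (1 - v ^+ 2) by rewrite mulr_ge0//; nra.
  lra.
suff : 0 <= (1 - v) ^+ 2 * (2 + v) by lra.
by rewrite mulr_ge0 ?sqr_ge0//; lra.
Qed.

Lemma sign_poly_cvg s : 0 < s <= 1 -> sign_poly n s @[n --> \oo] --> (1 : R).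
Proof.
move=> /andP[s0 s1]; have s01 : 0 <= s <= 1 by rewrite ltW.
have H n : 1 - sign_poly n s <= (1 - s / 2) ^+ n.
  elim: n => [|n IH]; first by rewrite expr0 /=; lra.
  have /andP[h1 h2] := sign_poly_bounds n s01; rewrite exprS /=.
  set v := sign_poly n s in IH h1 h2 *.
  apply: (@le_trans _ _ ((1 - s / 2) * (1 - v))); last by rewrite ler_wpM2l//; lra.
  (* The next error is 1 - v (3 - v^2) / 2 = (1 - v) (1 - (v + v^2) / 2), and v >= s; the quantity
     here is twice the gap to be shown non-negative. *)
  have : 0 <= (1 - v) * (v ^+ 2 + (v - s)) by rewrite mulr_ge0//; nra.
  lra.
apply: (@squeeze_cvgr _ _ _ _ (fun n => 1 - (1 - s / 2) ^+ n) (cst 1)).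
- near=> n; have /andP[_ ->] := sign_poly_bounds n s01; rewrite andbT.
  by have := H n; lra.
- rewrite -[X in _ --> X]subr0; apply: cvgB; first exact: cvg_cst.
  by apply: cvg_expr; rewrite ltr_norml; lra.
- exact: cvg_cst.
Unshelve. all: by end_near.
Qed.

End step_polynomials.

(** * Trigonometric approximation of indicators of quadrants *)

Section sine_span.
Variable R : realType.

Inductive sine_span : (R -> R -> R) -> Prop :=
| sine_span0 : sine_span (fun _ _ => 0)
| sine_span_add c m n h : sine_span h ->
    sine_span (fun x y => c * (sin (m.+1%:R * x) * sin (n.+1%:R * y)) + h x y).

Lemma sine_span_ext f g : (forall x y, f x y = g x y) -> sine_span f -> sine_span g.
Proof. by move=> fg; rewrite (_ : f = g)//; apply/funext => x; apply/funext. Qed.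

Lemma sine_spanD f g : sine_span f -> sine_span g -> sine_span (fun x y => f x y + g x y).
Proof.
move=> sf sg; elim: sf => [|c m n h _ IH].
  by apply: sine_span_ext sg => x y; rewrite add0r.
by apply: sine_span_ext (sine_span_add c m n IH) => x y; rewrite addrA.
Qed.

Lemma sine_spanZ a f : sine_span f -> sine_span (fun x y => a * f x y).
Proof.
elim=> [|c m n h _ IH].
  by apply: sine_span_ext sine_span0 => x y; rewrite mulr0.
by apply: sine_span_ext (sine_span_add (a * c) m n IH) => x y; ring.
Qed.

(** Sine products are not closed under multiplication, but their span is stable under multiplication
    by polynomials in cos x and cos y. Every approximant is therefore built as sin x sin y times
    such a polynomial. *)
Definition multiplier (h : R -> R -> R) :=
  forall f, sine_span f -> sine_span (fun x y => h x y * f x y).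

Lemma cos_mul_sin (m : nat) (x : R) :
  cos x * sin (m.+1%:R * x) = (sin (m.+2%:R * x) + sin (m%:R * x)) / 2.
Proof.
have -> : m.+2%:R * x = m.+1%:R * x + x by rewrite -[m.+2]addn1 natrD; ring.
have -> : m%:R * x = m.+1%:R * x - x by rewrite -[m.+1]addn1 natrD; ring.
by rewrite sinD sinB; field.
Qed.

Lemma multiplier_cosx : multiplier (fun x _ => cos x).
Proof.
move=> f; elim=> [|c m n h _ IH].
  by apply: sine_span_ext sine_span0 => x y; rewrite mulr0.
have := sine_span_add (c / 2) m.+1 n IH.
(* For frequency 1 the lower of the two new frequencies is 0, whose sine vanishes; the index shift
   by one forces a separate case. *)
case: m => [|m] H; last have {}H := sine_span_add (c / 2) m n H.
  apply: sine_span_ext H => x y; rewrite mulrDr; congr (_ + _).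
  by have := cos_mul_sin 0 x; rewrite mul0r sin0 addr0 => E; rewrite !mulrA -[_ * c * _]mulrAC E; ring.
apply: sine_span_ext H => x y; rewrite mulrDr addrA; congr (_ + _).
by have E := cos_mul_sin m.+1 x; rewrite !mulrA -[_ * c * _]mulrAC E; ring.
Qed.

Lemma multiplier_cosy : multiplier (fun _ y => cos y).
Proof.
move=> f; elim=> [|c m n h _ IH].
  by apply: sine_span_ext sine_span0 => x y; rewrite mulr0.
have := sine_span_add (c / 2) m n.+1 IH.
case: n => [|n] H; last have {}H := sine_span_add (c / 2) m n H.
  apply: sine_span_ext H => x y; rewrite mulrDr; congr (_ + _).
  have := cos_mul_sin 0 y; rewrite mul0r sin0 addr0 => E.
  by transitivity (c * sin (m.+1%:R * x) * (cos y * sin (1%:R * y))); [rewrite E|]; ring.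
apply: sine_span_ext H => x y; rewrite mulrDr addrA; congr (_ + _).
have E := cos_mul_sin n.+1 y.
by transitivity (c * sin (m.+1%:R * x) * (cos y * sin (n.+2%:R * y))); [rewrite E|]; ring.
Qed.

Lemma multiplier_cst c : multiplier (fun _ _ => c).
Proof. exact: sine_spanZ. Qed.

Lemma multiplierD f g : multiplier f -> multiplier g -> multiplier (fun x y => f x y + g x y).
Proof.
move=> mf mg h sh; apply: sine_span_ext (sine_spanD (mf h sh) (mg h sh)) => x y.
by rewrite mulrDl.
Qed.

Lemma multiplierM f g : multiplier f -> multiplier g -> multiplier (fun x y => f x y * g x y).
Proof. by move=> mf mg h /mg /mf; apply: sine_span_ext => x y; rewrite mulrA. Qed.

Lemma multiplierX f n : multiplier f -> multiplier (fun x y => f x y ^+ n).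
Proof.
move=> mf; elim: n => [|n IH]; first exact: multiplier_cst.
by move=> h /(multiplierM mf IH); apply: sine_span_ext => x y; rewrite exprS.
Qed.

Lemma multiplier_step n f : multiplier f -> multiplier (fun x y => step_poly n (f x y)).
Proof.
move=> mf; apply: multiplierX.
have m1 := multiplierM (multiplier_cst (-1)) (multiplierX n mf).
move=> h /(multiplierD (multiplier_cst 1) m1); apply: sine_span_ext => x y; ring.
Qed.

(* sign_poly n (sin z) = sin z * sign_quotient n (cos z) *)
Fixpoint sign_quotient (n : nat) (c : R) : R :=
  if n is m.+1 then
    sign_quotient m c * (3 + - 1 * ((1 + -1 * c ^+ 2) * sign_quotient m c ^+ 2)) * 2^-1
  else 1.

Lemma sign_polyE n z : sign_poly n (sin z) = sin z * sign_quotient n (cos z).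
Proof.
elim: n => [|n IH] /=; first by rewrite mulr1.
rewrite IH; have E := sin2cos2 z.
rewrite exprMn E; ring.
Qed.

Lemma multiplier_sign_quotient n f : multiplier f ->
  multiplier (fun x y => sign_quotient n (f x y)).
Proof.
move=> mf; elim: n => [|n IH] /=; first exact: multiplier_cst.
apply: multiplierM; last exact: multiplier_cst.
apply: multiplierM => //; apply: multiplierD; first exact: multiplier_cst.
apply: multiplierM; first exact: multiplier_cst.
apply: multiplierM; last exact: multiplierX.
apply: multiplierD; first exact: multiplier_cst.
by apply: multiplierM; [exact: multiplier_cst|exact: multiplierX].
Qed.

(** [sign_poly] is odd, so one sine factors out and the quotient is a polynomial in the cosine.
    These two factors tend to 1 in the open square, which removes the weight sin x sin y that
    membership in the span imposes. *)
Lemma sine_span_weight n rho : multiplier rho -> sine_span (fun x y =>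
  sign_poly n (sin x) * sign_poly n (sin y) * rho x y).
Proof.
move=> mr; have := sine_span_add 1 0 0 sine_span0.
move=> /mr /(multiplier_sign_quotient n multiplier_cosx) /(multiplier_sign_quotient n multiplier_cosy).
by apply: sine_span_ext => x y; rewrite !sign_polyE !mul1r; ring.
Qed.

(** As cos decreases on the interval from 0 to pi, x > c means that the argument is below 1/2, the
    jump of [step_poly]. The division by 4 keeps the argument between 0 and 1. *)
Definition angle_step (n : nat) (c x : R) : R := step_poly n (1/2 + (cos x - cos c) / 4).

Lemma cos_bounds (x : R) : -1 <= cos x <= 1.
Proof. by rewrite cos_geN1 cos_le1. Qed.

Lemma angle_step_bounds n c x : 0 <= angle_step n c x <= 1.
Proof.
apply: step_poly_bounds; have /andP[? ?] := cos_bounds x; have /andP[? ?] := cos_bounds c.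
by apply/andP; split; lra.
Qed.

Lemma ltr_cos_angle (c x : R) : 0 <= c <= pi -> 0 <= x <= pi -> (cos x < cos c) = (c < x).
Proof. by move=> c0p x0p; rewrite ltr_cos// in_itv. Qed.

Lemma angle_step_cvg (c x : R) : 0 <= c <= pi -> 0 <= x <= pi ->
  angle_step n c x @[n --> \oo] --> ((c < x)%R%:R : R).
Proof.
move=> c0p x0p; rewrite -(ltr_cos_angle c0p x0p).
have /andP[? ?] := cos_bounds x; have /andP[? ?] := cos_bounds c.
case: ltP => cx.
  by apply: step_poly_cvg1; apply/andP; split; lra.
by apply: step_poly_cvg0; apply/andP; split; lra.
Qed.

(** For angles between 0 and pi, x + y < pi is equivalent to cos x + cos y > 0, that is, to the
    argument being below 1/2. *)
Definition below_diagonal (tri : bool) (n : nat) (x y : R) : R :=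
  if tri then step_poly n (1/2 + (- (cos x + cos y)) / 4) else 1.

Lemma below_diagonal_bounds tri n x y : 0 <= below_diagonal tri n x y <= 1.
Proof.
case: tri; last by rewrite ler01 lexx.
apply: step_poly_bounds; have /andP[? ?] := cos_bounds x; have /andP[? ?] := cos_bounds y.
by apply/andP; split; lra.
Qed.

Lemma below_diagonal_cvg tri (x y : R) : 0 <= x <= pi -> 0 <= y <= pi ->
  below_diagonal tri n x y @[n --> \oo] --> ((tri ==> (x + y < pi))%R%:R : R).
Proof.
move=> x0p y0p; case: tri => /=; last exact: cvg_cst.
have /andP[? ?] := cos_bounds x; have /andP[? ?] := cos_bounds y.
have py : 0 <= pi - y <= pi by apply/andP; split; lra.
have -> : (x + y < pi) = (cos (pi - y) < cos x).
  by rewrite (ltr_cos_angle x0p py) ltrBrDr.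
have -> : cos (pi - y) = - cos y by rewrite cosB sinpi cospi; ring.
case: ltP => h.
  by apply: step_poly_cvg1; apply/andP; split; lra.
by apply: step_poly_cvg0; apply/andP; split; lra.
Qed.

(* Bounded trigonometric approximation of the indicator of a quadrant, cut off
   by the diagonal x + y = pi when tri holds. *)
Lemma quadrant_approximation (tri : bool) (c d : R) :
  exists h : nat -> R -> R -> R, [/\ forall n, sine_span (h n),
    forall n (x y : R), 0 < x < pi -> 0 < y < pi -> 0 <= h n x y <= 1 &
    forall x y : R, 0 < x < pi -> 0 < y < pi -> h n x y @[n --> \oo] -->
      ([&& c < x, d < y & tri ==> (x + y < pi)]%R%:R : R)].
Proof.
(* The corner of the quadrant is arbitrary, while [angle_step] needs a threshold between 0 and pi;
   clamping does not affect comparisons with angles strictly between these bounds. *)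
pose cl (c : R) := Num.min (Num.max c 0) pi.
have p0 : 0 <= pi :> R by exact: pi_ge0.
have clb z : 0 <= cl z <= pi.
  by rewrite /cl ge_min lexx orbT andbT le_min p0 andbT le_max lexx orbT.
have clE z x : 0 < x < pi -> (cl z < x) = (z < x).
  by move=> /andP[x0 xp]; rewrite /cl gt_min (ltNge pi) (ltW xp) orbF gt_max x0 andbT.
have sinb (x : R) : 0 < x < pi -> 0 < sin x <= 1.
  by move=> x0p; rewrite sin_le1 andbT sin_gt0_pi.
exists (fun n x y => sign_poly n (sin x) * sign_poly n (sin y) *
  (angle_step n (cl c) x * angle_step n (cl d) y * below_diagonal tri n x y)); split.
- move=> n; apply: sine_span_weight.
  have mstep z f : multiplier f -> multiplier (fun x y => step_poly n (1/2 + (f x y - z) / 4)).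
    move=> mf; apply: multiplier_step; apply: multiplierD; first exact: multiplier_cst.
    apply: multiplierM; last exact: multiplier_cst.
    by apply: multiplierD => //; exact: multiplier_cst.
  apply: multiplierM; first apply: multiplierM.
  + exact: mstep multiplier_cosx.
  + exact: mstep multiplier_cosy.
  + rewrite /below_diagonal; case: (tri); last exact: multiplier_cst.
    apply: multiplier_step; apply: multiplierD; first exact: multiplier_cst.
    apply: multiplierM; last exact: multiplier_cst.
    move=> f sf; have := multiplierM (multiplier_cst (-1)) (multiplierD multiplier_cosx multiplier_cosy) sf.
    by apply: sine_span_ext => x y; rewrite mulN1r.
- move=> n x y /sinb/andP[sx0 sx1] /sinb/andP[sy0 sy1].
  have sx : 0 <= sin x <= 1 by rewrite ltW.
  have sy : 0 <= sin y <= 1 by rewrite ltW.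
  have /andP[a1 a2] := sign_poly_bounds n sx; have /andP[b1 b2] := sign_poly_bounds n sy.
  have /andP[c1 c2] := angle_step_bounds n (cl c) x; have /andP[d1 d2] := angle_step_bounds n (cl d) y.
  have /andP[e1 e2] := below_diagonal_bounds tri n x y.
  have a0 := le_trans (ltW sx0) a1; have b0 := le_trans (ltW sy0) b1.
  by rewrite !mulr_ge0//= !mulr_ile1 ?mulr_ge0.
- move=> x y x0p y0p; have [/sinb sx /sinb sy] := (x0p, y0p).
  have xw : 0 <= x <= pi by case/andP: x0p => /ltW -> /ltW ->.
  have yw : 0 <= y <= pi by case/andP: y0p => /ltW -> /ltW ->.
  rewrite -(clE c x x0p) -(clE d y y0p).
  have -> : [&& cl c < x, cl d < y & tri ==> (x + y < pi)]%R%:R =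
      1 * 1 * ((cl c < x)%R%:R * (cl d < y)%R%:R * (tri ==> (x + y < pi))%R%:R) :> R.
    by rewrite mulr1 mul1r -mulrA -!natrM !mulnb.
  apply: cvgM; first by apply: cvgM; exact: sign_poly_cvg.
  apply: cvgM; last exact: below_diagonal_cvg.
  by apply: cvgM; exact: angle_step_cvg.
Qed.

End sine_span.

(** * Functions with vanishing integral over all quadrants *)

Section quadrant_determination.
Variables (R : realType) (Psi Phi : plane R -> plane R) (g : plane R -> R) (c0 : R).
Hypotheses (mPsi : measurable_fun setT Psi) (mPhi : measurable_fun setT Phi)
  (PhiK : forall q, Phi (Psi q) = q)
  (ig : (area R).-integrable setT (EFin \o g))
  (g0 : forall q, (Psi q).1 <= c0 \/ (Psi q).2 <= c0 -> g q = 0)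
  (gq : forall c d, \int[area R]_(q in Psi @^-1` (`]c, +oo[%classic `*` `]d, +oo[%classic)) g q = 0).

Let I (A : set (plane R)) := (\int[area R]_(q in Psi @^-1` A) (g q)%:E)%E.

Let mpre A : measurable A -> measurable (Psi @^-1` A).
Proof. by move=> mA; rewrite -[X in measurable X]setTI; exact: mPsi. Qed.

Let igA A : measurable A -> (area R).-integrable (Psi @^-1` A) (EFin \o g).
Proof. by move=> mA; apply: integrableS ig => //; exact: mpre. Qed.

Let I_eq A B : (forall q, (A (Psi q) <-> B (Psi q)) \/ g q = 0) -> I A = I B.
Proof.
move=> AB; rewrite /I integral_mkcond [RHS]integral_mkcond; apply: eq_integral => q _.
rewrite !patchE; have [ABq|->] := AB q; last by rewrite !if_same.
by have -> : (q \in Psi @^-1` A) = (q \in Psi @^-1` B) by apply/idP/idP => /set_mem h;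
  apply/mem_set; apply/ABq.
Qed.

Let I_setC A B C : measurable A -> measurable B -> A `|` B = C -> A `&` B = set0 ->
  I C = 0%E -> I A = 0%E -> I B = 0%E.
Proof.
move=> mA mB ABC AB IC IA; have := IC; rewrite -ABC /I preimage_setU.
have mAB : measurable (A `|` B) by exact: measurableU.
rewrite integral_setU; first by rewrite -/(I A) IA add0e.
- exact: mpre.
- exact: mpre.
- by rewrite -preimage_setU; apply: measurable_int; exact: igA.
- by apply/disj_setPS; rewrite -preimage_setI AB preimage_set0.
Qed.

Let I_bigcup (F : nat -> set (plane R)) : (forall n, measurable (F n)) ->
  trivIset setT F -> (forall n, I (F n) = 0%E) -> I (\bigcup_k F k) = 0%E.
Proof.
move=> mF tF IF; rewrite /I preimage_bigcup integral_bigcup.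
- by rewrite eseries0// => k _ _; exact: IF.
- by apply/trivIsetP => i j _ _ ij; rewrite -preimage_setI;
    move/trivIsetP : tF => -> //; rewrite preimage_set0.
- by move=> k; exact: mpre.
- by rewrite -preimage_bigcup; apply: igA; exact: bigcup_measurable.
Qed.

Let ray (c : R) : set (measurableTypeR R) := `]c, +oo[%classic.

Let mray c : measurable (ray c). Proof. exact: measurable_itv. Qed.

Let rayI : setI_closed (@RGenOInfty.G R).
Proof.
move=> _ _ [x ->] [y ->]; exists (Num.max x y).
by apply/seteqP; split => z /=; rewrite !in_itv/= !andbT gt_max => /andP.
Qed.

Let I_quadrant c d : I (ray c `*` ray d) = 0%E.
Proof.
have mq : measurable (ray c `*` ray d) by exact: measurableX.
have fin : I (ray c `*` ray d) \is a fin_num.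
  exact: (integrable_fin_num (mpre mq) (igA mq)).
by rewrite -(fineK fin); congr (_%:E); exact: gq.
Qed.

Let mrays : @measurable _ (measurableTypeR R) = <<s @RGenOInfty.G R >>.
Proof. exact: RGenOInfty.measurableE. Qed.

(** Dynkin induction in the first factor, the second one being a fixed ray. The full line is not a
    ray, but it may be replaced by the ray above c0 because g vanishes elsewhere. *)
Let rect1 d (A : set (measurableTypeR R)) : measurable A -> I (A `*` ray d) = 0%E.
Proof.
rewrite mrays; move: A; apply: (dynkin_induction mrays rayI).
- rewrite (@I_eq _ (ray c0 `*` ray d)) ?I_quadrant// => q.
  have [qc|qc] := leP (Psi q).1 c0; first by right; apply: g0; left.
  by left; split => -[_ h]; split => //=; rewrite /ray/= in_itv/= qc.
- by move=> _ [c ->]; exact: I_quadrant.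
- move=> S mS IS; apply: (@I_setC (S `*` ray d) _ (setT `*` ray d)) => //.
  + exact: measurableX.
  + by apply: measurableX => //; exact: measurableC.
  + apply/seteqP; split => -[x y]; first by case => -[].
    by move=> [_ ry]; have [Sx|Sx] := pselect (S x); [left|right].
  + by apply/seteqP; split => -[x y] //= [[Sx _] []].
  + rewrite (@I_eq _ (ray c0 `*` ray d)) ?I_quadrant// => q.
    have [qc|qc] := leP (Psi q).1 c0; first by right; apply: g0; left.
    by left; split => -[_ h]; split => //=; rewrite /ray/= in_itv/= qc.
- move=> F mF tF IF; rewrite setX_bigcupl; apply: I_bigcup => //.
    by move=> n; exact: measurableX.
  apply/trivIsetP => i j _ _ ij; apply/seteqP; split => -[x y] //= [[Fi _] [Fj _]].
  have : (F i `&` F j) x by [].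
  by move/trivIsetP : tF => ->.
Qed.

Let rect2 (A B : set (measurableTypeR R)) : measurable A -> measurable B -> I (A `*` B) = 0%E.
Proof.
move=> mA; have IT : I (A `*` setT) = 0%E.
  rewrite (@I_eq _ (A `*` ray c0)) ?rect1// => q.
  have [qc|qc] := leP (Psi q).2 c0; first by right; apply: g0; right.
  by left; split => -[h _]; split => //=; rewrite /ray/= in_itv/= qc.
rewrite mrays; move: B; apply: (dynkin_induction mrays rayI) => //.
- by move=> _ [d ->]; exact: rect1.
- move=> S mS IS; apply: (@I_setC (A `*` S) _ (A `*` setT)) => //.
  + exact: measurableX.
  + by apply: measurableX => //; exact: measurableC.
  + apply/seteqP; split => -[x y]; first by case => -[].
    by move=> [ry _]; have [Sx|Sx] := pselect (S y); [left|right].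
  + by apply/seteqP; split => -[x y] //= [[_ Sx] []].
- move=> F mF tF IF; rewrite setX_bigcupr; apply: I_bigcup => //.
    by move=> n; exact: measurableX.
  apply/trivIsetP => i j _ _ ij; apply/seteqP; split => -[x y] //= [[_ Fi] [_ Fj]].
  have : (F i `&` F j) y by [].
  by move/trivIsetP : tF => ->.
Qed.

Let all_sets S : measurable S -> I S = 0%E.
Proof.
have mE := @measurable_prod_measurableType _ _ (measurableTypeR R) (measurableTypeR R).
have IT : I setT = 0%E by rewrite -setXTT rect2.
rewrite mE; move: S; apply: (dynkin_induction mE) => //.
- move=> _ _ [A1 mA1 [B1 mB1 <-]] [A2 mA2 [B2 mB2 <-]].
  exists (A1 `&` A2); first exact: measurableI.
  by exists (B1 `&` B2); [exact: measurableI|rewrite setXI].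
- by move=> _ [A mA [B mB <-]]; exact: rect2.
- move=> S mS IS; apply: (@I_setC S _ setT) => //; first exact: measurableC.
    by rewrite setUv.
  by rewrite setICr.
Qed.

(** Since [Phi] is a measurable left inverse of [Psi], every measurable set is a preimage under
    [Psi]. So g has zero integral over all measurable sets. *)
Lemma quadrant_ae0 : {ae area R, forall q, g q = 0}.
Proof.
have := @integral_ae_eq _ _ R (area R) setT measurableT (cst 0%E) (EFin \o g) ig.
move=> /(_ (measurable_cst _)) H; have : ae_eq (area R) setT (EFin \o g) (cst 0%E).
  apply: H => E _ mE; rewrite integral0.
  have -> : E = Psi @^-1` (Phi @^-1` E) by apply/seteqP; split => q /=; rewrite PhiK.
  by apply: all_sets; rewrite -[X in measurable X]setTI; exact: mPhi.
by apply: filterS => q /(_ Logic.I) [].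
Qed.

End quadrant_determination.

(** * Completeness of the modes on a countable union of components *)

Section completeness.
Variables (R : realType) (M : set (plane R)) (P : nat -> set (plane R)).
Variables (ang inv : nat -> plane R -> plane R) (tri : nat -> bool).
Variable phi : nat -> plane R -> R.

(* When t holds, z is in the triangle x, y > 0, x + y < pi, and h is made
   antisymmetric in (x, y) -> (pi - y, pi - x). *)
Definition reduced (t : bool) (h : R -> R -> R) (z : plane R) : R :=
  h z.1 z.2 - (if t then h (pi - z.2) (pi - z.1) else 0).

(* The frequencies are m + 1 and n + 1. *)
Definition mode (t : bool) (m n : nat) : plane R -> R :=
  reduced t (fun x y => sin (m.+1%:R * x) * sin (n.+1%:R * y)).

Hypotheses (mM : measurable M) (aM : (area R M < +oo)%E)
  (mP : forall j, measurable (P j)) (MP : M = \bigcup_j P j)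
  (tP : trivIset setT P) (mang : forall j, measurable_fun setT (ang j))
  (minv : forall j, measurable_fun setT (inv j))
  (angK : forall j q, inv j (ang j q) = q)
  (angP : forall j q, P j q -> [/\ 0 < (ang j q).1 < pi, 0 < (ang j q).2 < pi
     & tri j ==> ((ang j q).1 + (ang j q).2 < pi)])
  (Lphi : forall k, inL2 M (phi k))
  (Hon : forall i j, L2dot M (phi i) (phi j) = (i == j)%:R)
  (Hmode : forall j m n, exists (c : R) (k : nat), forall q, M q ->
     ((mode (tri j) m n \o ang j) \_ (P j)) q = c * phi k q).

(** The identity is asked for all large N, with one coefficient sequence, so that two
    representations can be added at a common length. *)
Let spanned (f : plane R -> R) := exists (N0 : nat) (c : nat -> R),
  forall N q, (N0 <= N)%N -> M q -> f q = \sum_(k < N) c k * phi k q.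

Let spanned0 : spanned (fun=> 0).
Proof.
by exists 0%N, (fun=> 0) => N q _ _; rewrite big1// => k _; rewrite mul0r.
Qed.

Let spannedD f1 f2 : spanned f1 -> spanned f2 -> spanned (fun q => f1 q + f2 q).
Proof.
move=> [N1 [c1 h1]] [N2 [c2 h2]]; exists (maxn N1 N2), (fun k => c1 k + c2 k) => N q.
rewrite geq_max => /andP[n1 n2] Mq; rewrite (h1 N)// (h2 N)// -big_split/=.
by apply: eq_bigr => k _; rewrite mulrDl.
Qed.

Let spanned_phi c k : spanned (fun q => c * phi k q).
Proof.
exists k.+1, (fun i => if i == k then c else 0) => N q kN _.
rewrite (bigD1 (Ordinal kN))//= eqxx big1 ?addr0// => i ik.
by rewrite (_ : (i == k :> nat) = false) ?mul0r//; exact/negbTE.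
Qed.

Let spanned_eq f1 f2 : (forall q, M q -> f1 q = f2 q) -> spanned f1 -> spanned f2.
Proof.
by move=> e [N [c h]]; exists N, c => n q Nn Mq; rewrite -e//; exact: h.
Qed.

Let spannedZ c f : spanned f -> spanned (fun q => c * f q).
Proof.
move=> [N0 [a h]]; exists N0, (fun k => c * a k) => N q n Mq.
by rewrite (h N)// mulr_sumr; apply: eq_bigr => k _; rewrite mulrA.
Qed.

Let spanned_sine j h : sine_span h -> spanned ((reduced (tri j) h \o ang j) \_ (P j)).
Proof.
elim=> [|c m n {}h _ IH].
  apply: spanned_eq spanned0 => q _; rewrite patchE; case: ifP => // _.
  by rewrite /reduced/=; case: ifP; rewrite subr0.
have [c' [k hk]] := Hmode j m n.
apply: spanned_eq (spannedD (spannedZ c (spanned_phi c' k)) IH) => q Mq.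
rewrite -hk// !patchE; case: ifP => _; last by rewrite mulr0 addr0.
by rewrite /mode /reduced/=; case: ifP => _; ring.
Qed.

Let sine_measurable j h : sine_span h ->
  measurable_fun setT ((reduced (tri j) h \o ang j) \_ (P j)).
Proof.
move=> sh; apply/(measurable_restrictT _ (mP j)); apply: measurable_funTS.
apply: measurableT_comp (mang j).
have mh (u v : plane R -> R) : measurable_fun setT u -> measurable_fun setT v ->
    measurable_fun setT (fun z => h (u z) (v z)).
  have ms (k : R) (w : plane R -> R) : measurable_fun setT w ->
      measurable_fun setT (fun z => sin (k * w z)).
    move=> mw; apply: (@measurableT_comp _ _ _ _ _ _ (@sin R)).
      exact: continuous_measurable_fun (@continuous_sin R).
    exact: measurable_funM.
  move=> mu mv; elim: sh => [|c m n {}h _ IH]; first exact: measurable_cst.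
  apply: measurable_funD => //; apply: measurable_funM => //; apply: measurable_funM.
    exact: ms.
  exact: ms.
apply: measurable_funB; first exact: mh.
by case: (tri j); [apply: mh; apply: measurable_funB|exact: measurable_cst].
Qed.

Let inL2_spanned f : spanned f -> inL2 M f.
Proof.
move=> [N [c h]]; apply: inL2_eq (partial_sum_inL2 mM Lphi c N) => q Mq.
by rewrite (h N).
Qed.

Let quadrant_functions j (c d : R) : exists H : nat -> plane R -> R,
  [/\ forall n, spanned (H n), forall n, measurable_fun setT (H n),
      forall n q, M q -> `|H n q| <= 1, forall n q, ~ P j q -> H n q = 0
    & forall q, M q -> H n q @[n --> \oo] -->
        ((if q \in P j then [&& c < (ang j q).1 & d < (ang j q).2]%R%:R else 0) : R)].
Proof.
have [h [sh hb hl]] := quadrant_approximation (tri j) c d.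
exists (fun n => (reduced (tri j) (h n) \o ang j) \_ (P j)); split.
- by move=> n; exact: spanned_sine.
- by move=> n; exact: sine_measurable.
- move=> n q _; rewrite patchE; case: ifPn => [/set_mem Pq|_]; last by rewrite normr0.
  have [x0 y0 t0] := angP Pq; rewrite /reduced/=.
  have := hb n _ _ x0 y0; case: ifP => tj; last by rewrite subr0 ler_norml; lra.
  have := hb n (pi - (ang j q).2) (pi - (ang j q).1); rewrite ler_norml; lra.
- by move=> n q Pq; rewrite patchE memNset.
move=> q _; rewrite (_ : (fun n => _) = fun n => if q \in P j then reduced (tri j) (h n) (ang j q) else 0); last first.
  by apply/funext => n; rewrite patchE.
case: ifPn => [/set_mem Pq|_]; last exact: cvg_cst.
have [x0 y0 t0] := angP Pq; rewrite /reduced/=.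
have h1 := hl _ _ x0 y0; rewrite t0 andbT in h1.
case tj: (tri j) t0 h1 => /= t0 h1; last first.
  by under eq_fun do rewrite subr0.
(* The reflection sends a point with x + y < pi to one with x + y > pi, where the approximants cut
   off by the diagonal tend to 0; so antisymmetrising does not change the limit. *)
rewrite -[X in _ --> X]subr0; apply: cvgB => //.
have x1 : 0 < pi - (ang j q).2 < pi by lra.
have y1 : 0 < pi - (ang j q).1 < pi by lra.
have := hl _ _ x1 y1; rewrite (_ : [&& _, _ & _] = false)//.
apply/negbTE; rewrite tj/= !negb_and -!leNgt; apply/orP; right; apply/orP; right; lra.
Qed.

(** On each component f is orthogonal to the indicators of quadrants in angle coordinates, these
    being bounded limits of finite combinations of modes. Then [quadrant_ae0] applies, and countably
    many null sets are collected. *)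
Lemma modes_complete f : inL2 M f -> (forall k, L2dot M f (phi k) = 0) ->
  {ae area R, forall q, M q -> f q = 0}.
Proof.
move=> Lf f0.
have fs g : spanned g -> L2dot M f g = 0.
  move=> [N [c h]]; rewrite (L2dot_eq (f' := f) (g' := fun q => \sum_(k < N) c k * phi k q))//; last first.
    by move=> q Mq; rewrite (h N).
  rewrite L2dotC partial_sum_dotl// big1// => k _.
  by rewrite L2dotC f0 mulr0.
have PM j : P j `<=` M by rewrite MP => q Pq; exists j.
have fj j : {ae area R, forall q, (f \_ (P j)) q = 0}.
  have ifj : (area R).-integrable setT (EFin \o (f \_ (P j))).
    have -> : EFin \o (f \_ (P j)) = (EFin \o f) \_ (P j).
      by apply/funext => q; rewrite /= !patchE; case: ifP.
    apply/(integrable_mkcond _ (mP j)); apply: (integrableS mM (mP j) (PM j)).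
    have L1 : inL2 M (cst 1) by apply: (inL2_bounded mM (B := 1)) => // q _; rewrite normr1.
    have := inL2_dot_integrable mM Lf L1; apply: eq_integrable => // q _ /=.
    by rewrite mulr1.
  apply: (quadrant_ae0 (c0 := 0) (mang j) (minv j) (angK j) ifj).
    move=> q hq; rewrite patchE; case: ifPn => // /set_mem /angP[]; lra.
  move=> c d; have [H [sH mH Hb _ Hl]] := quadrant_functions j c d.
  pose G (q : plane R) : R := if q \in P j then [&& c < (ang j q).1 & d < (ang j q).2]%R%:R else 0.
  pose A := ang j @^-1` (`]c, +oo[%classic `*` `]d, +oo[%classic).
  have mA : measurable A.
    rewrite -[X in measurable X]setTI; apply: mang => //; exact: measurableX.
  have GE : G = \1_(A `&` P j).
    apply/funext => q; rewrite /G indicE in_setI; case: ifPn => _; last by rewrite andbF.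
    rewrite andbT; congr (_%:R); congr nat_of_bool; apply/idP/idP.
      by move=> /andP[? ?]; rewrite inE /A/=; split; rewrite /= in_itv/= andbT.
    by rewrite inE /A/= => -[]; rewrite /= !in_itv/= !andbT => -> ->.
  have Gb q : `|G q| <= 1.
    rewrite /G; case: ifP => _; last by rewrite normr0.
    by rewrite ger0_norm ?ler0n// lern1 leq_b1.
  have LG : inL2 M G.
    apply: (inL2_bounded mM (B := 1)) => //.
    by rewrite GE; apply: measurable_funTS; apply: measurable_indic; exact: measurableI.
  have L0 : L2dot M f G = 0.
    have C1 : L2dot M (H n) f @[n --> \oo] --> L2dot M G f.
      apply: (L2dot_cvg mM) => //; first by move=> n; exact: inL2_spanned.
      apply: (L2_dominated_cvg mM (B := 2)) => //.
      - move=> n; apply: measurable_funB; first exact: measurable_funTS.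
        exact: inL2_measurable LG.
      - move=> n q Mq; apply: le_trans (ler_normB _ _) _.
        have := Hb n q Mq; have := Gb q; lra.
      - by move=> q Mq; apply/subr_cvg0; exact: Hl.
    have C2 : L2dot M (H n) f @[n --> \oo] --> (0 : R).
      by under eq_fun do rewrite L2dotC fs//; exact: cvg_cst.
    by rewrite L2dotC; exact: (cvg_unique _ C1 C2).
  rewrite -[RHS]L0 /L2dot [LHS]Rintegral_mkcond [RHS]Rintegral_mkcond.
  apply: eq_Rintegral => q _; rewrite !patchE GE indicE in_setI.
  case: (boolP (q \in P j)) => [/set_mem/PM Mq|_]; last by rewrite andbF mulr0 !if_same.
  by rewrite (mem_set Mq) andbT; case: ifP => _; rewrite ?mulr1 ?mulr0.
apply: filterS (ae_foralln fj) => q hq; rewrite MP => -[j _ Pq].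
by have := hq j; rewrite patchE mem_set.
Qed.

(** An explicit approximation replaces an abstract expansion theorem. With corner (0, 0) the
    quadrant contains all angles, so the sum of the approximants on the first n components tends to
    1 boundedly, and the orthogonal projections of 1 do at least as well by [best_approximation]. *)
Lemma one_expansion :
  L2dot M (fun q => 1 - \sum_(k < N) L2dot M (cst 1) (phi k) * phi k q)
          (fun q => 1 - \sum_(k < N) L2dot M (cst 1) (phi k) * phi k q) @[N --> \oo] --> (0 : R).
Proof.
have [H HP] := choice (fun j => quadrant_functions j 0 0).
pose W n (q : plane R) := \sum_(j < n) H j n q.
have L1 : inL2 M (cst 1) by apply: (inL2_bounded mM (B := 1)) => // q _; rewrite normr1.
have WE j n q : P j q -> W n q = if (j < n)%N then H j n q else 0.
  move=> Pq; have Hi (i : nat) : i != j -> H i n q = 0.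
    move=> ij; have [_ _ _ H0 _] := HP i; apply: H0 => Piq.
    by have := tP (Logic.I : setT i) (Logic.I : setT j); move=> /(_ (ex_intro _ q (conj Piq Pq))) /eqP; rewrite (negbTE ij).
  rewrite /W; case: ltnP => [jn|nj].
    by rewrite (bigD1 (Ordinal jn))//= big1 ?addr0// => i ij; exact: Hi.
  by rewrite big1// => i _; apply: Hi; rewrite neq_ltn (leq_trans (ltn_ord i)).
have Wl : L2dot M (fun q => W n q - 1) (fun q => W n q - 1) @[n --> \oo] --> (0 : R).
  apply: (L2_dominated_cvg mM (B := 2)) => //.
  - move=> n; apply: measurable_funTS; apply: measurable_funB => //.
    apply: measurable_sum => j; by have [_ + _ _ _] := HP j.
  - move=> n q Mq; apply: le_trans (ler_normB _ _) _; rewrite normr1.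
    suff : `|W n q| <= 1 by lra.
    move: (Mq); rewrite MP => -[j _ Pq]; rewrite (WE j)//.
    by case: ifP => _; rewrite ?normr0//; have [_ _ Hb _ _] := HP j; exact: Hb.
  - move=> q Mq; apply/subr_cvg0; move: (Mq); rewrite MP => -[j _ Pq].
    have [_ _ _ _ /(_ _ Mq)] := HP j; rewrite mem_set//.
    have [/andP[-> _] /andP[-> _] _] := angP Pq; move=> /=; apply: cvg_trans.
    apply: near_eq_cvg; near=> n; rewrite (WE j)//.
    by rewrite (_ : (j < n)%N = true)//; near: n; exact: nbhs_infty_gt.
have Ws n : spanned (W n).
  rewrite /W; have : forall s : seq 'I_n, spanned (fun q => \sum_(j <- s) H j n q).
    elim=> [|j s IH]; first by apply: spanned_eq spanned0 => q _; rewrite big_nil.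
    have [sj _ _ _ _] := HP j; apply: spanned_eq (spannedD (sj n) IH) => q _.
    by rewrite big_cons.
  exact.
apply/cvgrPdist_le => e e0; move/cvgrPdist_le: Wl => /(_ e e0) -[n _ /(_ n (leqnn _))].
rewrite /= sub0r normrN (ger0_norm (L2dot_ge0 _ _)) => hn.
have [N0 [c hc]] := Ws n; exists N0 => // N /= N0N.
rewrite sub0r normrN (ger0_norm (L2dot_ge0 _ _)); apply: le_trans hn.
have := best_approximation mM Lphi Hon c L1 N0N.
rewrite (L2dot_eq (M := M) (f := fun q => \sum_(k < N0) c k * phi k q - cst 1 q) (f' := fun q => W n q - 1) (g' := fun q => W n q - 1)); last first.
- by move=> q Mq; rewrite (hc N0).
- by move=> q Mq; rewrite (hc N0).
by apply: le_trans; rewrite le_eqVlt; apply/orP; left; apply/eqP; apply: eq_Rintegral => q _; rewrite /=; ring.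
Unshelve. all: by end_near. Qed.

End completeness.

(** * Eigenfunctions of rectangles and triangles *)

Section waves.
Variable R : realType.
Implicit Types (l : R * R * R) (q v : R * R).

Definition slope l v : R := l.1.1 * v.1 + l.1.2 * v.2.

Definition wave l1 l2 q : R := sin (affine l1 q) * sin (affine l2 q).

Lemma elementary_wave l1 l2 : elementary (wave l1 l2).
Proof. by apply: elementaryM; apply: elementary_sin; exact: elementary_affine. Qed.

Lemma derive_sin_affine l v q :
  'D_v (fun q => sin (affine l q)) q = cos (affine l q) * slope l v.
Proof.
rewrite (derive_comp_real (h := @sin R) _ (elementary_differentiable _ (elementary_affine l)) (is_derive_sin _)).
by rewrite derive_affine.
Qed.

Lemma derive_cos_affine l v q :
  'D_v (fun q => cos (affine l q)) q = - sin (affine l q) * slope l v.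
Proof.
rewrite (derive_comp_real (h := @cos R) _ (elementary_differentiable _ (elementary_affine l)) (is_derive_cos _)).
by rewrite derive_affine.
Qed.

Lemma derive_wave l1 l2 v q : 'D_v (wave l1 l2) q =
  slope l1 v * (cos (affine l1 q) * sin (affine l2 q)) +
  slope l2 v * (sin (affine l1 q) * cos (affine l2 q)).
Proof.
rewrite elementary_deriveM; try by apply: elementary_sin; exact: elementary_affine.
by rewrite !derive_sin_affine; ring.
Qed.

Lemma derive2_wave l1 l2 v q : 'D_v ('D_v (wave l1 l2)) q =
  - (slope l1 v ^+ 2 + slope l2 v ^+ 2) * wave l1 l2 q +
  2 * (slope l1 v * slope l2 v) * (cos (affine l1 q) * cos (affine l2 q)).
Proof.
have es l := elementary_sin (elementary_affine l); have ec l := elementary_cos (elementary_affine l).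
rewrite (funext (derive_wave l1 l2 v)) elementary_deriveD; try by apply: elementaryZ; exact: elementaryM.
rewrite !elementary_deriveZ; try exact: elementaryM.
rewrite !elementary_deriveM// !derive_sin_affine !derive_cos_affine /wave; ring.
Qed.

Lemma wave_le1 l1 l2 q : `|wave l1 l2 q| <= 1.
Proof. by rewrite /wave normrM mulr_ile1// sin_max. Qed.

Lemma derive_wave_le l1 l2 v q :
  `|'D_v (wave l1 l2) q| <= `|slope l1 v| + `|slope l2 v|.
Proof.
rewrite derive_wave; apply: le_trans (ler_normD _ _) _.
by rewrite !normrM; apply: lerD; apply: ler_piMr => //; rewrite mulr_ile1// ?sin_max ?cos_max.
Qed.

Lemma sin_subr_le (x y : R) : `|sin x - sin y| <= `|x - y|.
Proof.
wlog xy : x y / y <= x => [H|].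
  by have [/H//|/ltW /H] := leP y x; rewrite distrC (distrC x).
have [|c _ ->] := @MVT_segment R sin cos _ _ xy.
  by apply: continuous_subspaceT => z; exact: continuous_sin.
by rewrite normrM; apply: ler_piMl => //; exact: cos_max.
Qed.

Lemma sin_natpiB n (x : R) : sin (n%:R * (pi - x)) = (-1) ^+ n.+1 * sin (n%:R * x).
Proof.
rewrite mulrBr sinB [_ * pi]mulr_natl.
have -> : sin (pi *+ n) = 0 :> R by elim: n => [|n IH]; rewrite ?mulr0n ?sin0// mulrSr (sinDpi (pi *+ n)) IH oppr0.
have -> : cos (pi *+ n) = (-1) ^+ n :> R.
  by elim: n => [|n IH]; rewrite ?mulr0n ?cos0// mulrSr (cosDpi (pi *+ n)) IH exprS mulN1r.
by rewrite exprS; ring.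
Qed.
End waves.

(** * Integrals of sines over an interval *)

Section trigonometric_integrals.
Variable R : realType.

Lemma integral_open_derivative (F f : R -> R) (c d : R) : c < d -> continuous f ->
  (forall x : R, is_derive x (1 : R) F (f x)) ->
  \int[@lebesgue_measure R]_(x in `]c, d[) f x = F d - F c.
Proof.
move=> cd cf dF.
have cF : continuous F.
  by move=> y; apply/differentiable_continuous/derivable1_diffP; case: (dF y).
rewrite /Rintegral.
rewrite -(@integral_itv_bndoo R c d (EFin \o f) true false) /=; last first.
  by apply/measurable_EFinP/measurable_funTS; exact: continuous_measurable_fun.
rewrite (@continuous_FTC2 R f F)//.
- exact: continuous_subspaceT.
- split; first by move=> y _; case: (dF y).
    by apply: cvg_at_right_filter; exact: cF.
  by apply: cvg_at_left_filter; exact: cF.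
- by move=> y _; rewrite derive1E; case: (dF y).
Qed.

Lemma is_derive_sinZ (w x : R) : is_derive x (1 : R) (fun x => sin (w * x)) (w * cos (w * x)).
Proof.
have h : is_derive x (1 : R) (fun x => w * x) w.
  by apply: is_derive_eq; rewrite /GRing.scale/= mulr1.
by have := is_derive1_comp (is_derive_sin (w * x)) h; rewrite mulrC.
Qed.

Lemma is_derive_cosZ (w x : R) : is_derive x (1 : R) (fun x => cos (w * x)) (- w * sin (w * x)).
Proof.
have h : is_derive x (1 : R) (fun x => w * x) w.
  by apply: is_derive_eq; rewrite /GRing.scale/= mulr1.
by have := is_derive1_comp (is_derive_cos (w * x)) h; rewrite mulrC mulrN mulNr.
Qed.

Lemma continuous_sinZ (w : R) : continuous (fun x : R => sin (w * x)).
Proof.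
by move=> x; apply/differentiable_continuous/derivable1_diffP; case: (is_derive_sinZ w x).
Qed.

Lemma sin_natpi n : sin (n%:R * pi) = 0 :> R.
Proof. by have := sin_natpiB n (0 : R); rewrite subr0 mulr0 sin0 mulr0. Qed.

Lemma integral_sin_sin (c : R) m n : 0 < c ->
  \int[@lebesgue_measure R]_(x in `]0, c[)
    (sin (m.+1%:R * (pi / c * x)) * sin (n.+1%:R * (pi / c * x))) =
  c / 2 * (m == n)%:R.
Proof.
move=> c0; set w := pi / c.
have w0 : w != 0 by rewrite gt_eqF// divr_gt0// pi_gt0.
have wc : w * c = pi by rewrite /w divfK// gt_eqF.
pose k : R := m.+1%:R; pose l : R := n.+1%:R; rewrite -/k -/l.
have k0 : k != 0 by rewrite pnatr_eq0.
have ck : continuous (fun x : R => sin (k * (w * x)) * sin (l * (w * x))).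
  have cs (j : R) : continuous (fun x : R => sin (j * (w * x))).
    by rewrite (_ : (fun x => _) = fun x => sin (j * w * x));
      [exact: continuous_sinZ|apply/funext => x; rewrite mulrA].
  by move=> x; apply: cvgM; exact: cs.
have sk : sin (k * w * c) = 0 by rewrite -mulrA wc sin_natpi.
have sl : sin (l * w * c) = 0 by rewrite -mulrA wc sin_natpi.
have [mn|mn] := eqVneq m n.
  have kl : k = l by rewrite /k /l mn.
  have FD (x : R) : is_derive x (1 : R)
      (fun x => x / 2 - sin (k * w * x) * cos (k * w * x) / (2 * (k * w)))
      (sin (k * (w * x)) * sin (l * (w * x))).
    have ds := is_derive_sinZ (k * w) x; have dc := is_derive_cosZ (k * w) x.
    apply: is_derive_eq; rewrite /GRing.scale/= -kl (mulrA k w x).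
    have := cos2Dsin2 (k * w * x); set s := sin _; set t := cos _ => st.
    (* The derivative agrees with the integrand only modulo cos^2 + sin^2 = 1, which is inserted by
       hand to leave a field identity. *)
    have h : 2^-1 = (t ^+ 2 + s ^+ 2) / 2 by rewrite st mul1r.
    rewrite mulr1 [X in _ + X - _]h; clear - k0 w0; clearbody k w s t.
    by field; rewrite w0 k0.
  rewrite (integral_open_derivative c0 ck FD).
  by rewrite sk mulr0 sin0 !mul0r !subr0 mulr1.
have kl : k ^+ 2 - l ^+ 2 != 0.
  by rewrite subr_eq0 -!natrX eqr_nat eqn_exp2r// eqSS.
have FD (x : R) : is_derive x (1 : R) (fun x => (l * (sin (k * w * x) * cos (l * w * x))
    - k * (cos (k * w * x) * sin (l * w * x))) / (w * (k ^+ 2 - l ^+ 2)))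
    (sin (k * (w * x)) * sin (l * (w * x))).
  have ds j := is_derive_sinZ (j * w) x; have dc j := is_derive_cosZ (j * w) x.
  apply: is_derive_eq; rewrite /GRing.scale/= (mulrA k w x) (mulrA l w x).
  move: (sin _) (cos _) (sin _) (cos _) => s1 t1 s2 t2.
  by clear - kl w0; clearbody k l w; field; rewrite w0 kl.
rewrite (integral_open_derivative c0 ck FD).
by rewrite sk sl !mulr0 !sin0 !(mul0r, mulr0, subrr).
Qed.
End trigonometric_integrals.

(** * Integrals over a right isosceles triangle *)

Section triangle.
Variables (R : realType) (l : R).
Hypothesis l0 : 0 < l.

Definition triangle : set (plane R) := [set z | [/\ 0 < z.1, 0 < z.2 & z.1 + z.2 < l]].

Definition box (a b : R) : set (plane R) := `]0, a[%classic `*` `]0, b[%classic.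

Lemma boxE a b z : box a b z <-> 0 < z.1 < a /\ 0 < z.2 < b.
Proof. by rewrite /box/= !in_itv. Qed.

Lemma measurable_box a b : measurable (box a b).
Proof. exact: measurableX. Qed.

Lemma measurable_triangle : measurable triangle.
Proof.
rewrite (_ : triangle = polygon [:: (1, 0, 0); (0, 1, 0); (-1, -1, l)]); first exact: measurable_polygon.
apply/seteqP; split => z; rewrite /triangle /polygon/=.
  by move=> [h1 h2 h3] k; rewrite !inE => /or3P[] /eqP->; rewrite /affine/=; lra.
move=> h; have := h (1, 0, 0); have := h (0, 1, 0); have := h (-1, -1, l).
by rewrite !inE !eqxx !orbT /affine/= => /(_ isT) ? /(_ isT) ? /(_ isT) ?; split; lra.
Qed.

Lemma box_bounded a b z : 0 < a -> 0 < b -> box a b z -> `|z.1| <= a + b /\ `|z.2| <= a + b.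
Proof. by move=> a0 b0 /boxE[h1 h2]; rewrite !ger0_norm; lra. Qed.

Lemma triangle_box : triangle `<=` box l l.
Proof. by move=> z [h1 h2 h3]; apply/boxE; lra. Qed.

(** The square consists of the triangle, its mirror image and the diagonal between them; the latter
    is a null set because each vertical section has at most one point. *)
Lemma half_square (h : plane R -> R) (B : R) : measurable_fun setT h -> (forall z, `|h z| <= B) ->
  (forall z, h (diag_reflection l z) = h z) ->
  \int[area R]_(z in box l l) h z = 2 * \int[area R]_(z in triangle) h z.
Proof.
move=> mh hB hs.
pose T' := diag_reflection l @^-1` triangle.
pose Dg : set (plane R) := box l l `\` (triangle `|` T').
have ap := area_preserving_diag_reflection l.
have mT' : measurable T'.
  by rewrite -[X in measurable X]setTI; apply: ap.1 => //; exact: measurable_triangle.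
have mT := measurable_triangle.
have mD : measurable Dg by apply: measurableD; [exact: measurable_box|exact: measurableU].
have T'b : T' `<=` box l l by move=> z [/= h1 h2 h3]; apply/boxE; lra.
have bE : box l l = triangle `|` (T' `|` Dg).
  rewrite setUA; apply/seteqP; split => z.
    by move=> bz; have [?|?] := pselect ((triangle `|` T') z); [left|right].
  by move=> [[/triangle_box|/T'b]|[]].
have blty : (area R (box l l) < +oo)%E.
  by apply: area_box_lty (measurable_box _ _) _ => z; exact: box_bounded.
have ih : (area R).-integrable (box l l) (EFin \o h).
  by apply: (bounded_integrable (measurable_box _ _) blty (measurable_funTS mh)) => z _; exact: hB.
have iS S : measurable S -> S `<=` box l l -> (area R).-integrable S (EFin \o h).
  by move=> mS Sb; apply: integrableS ih => //; exact: measurable_box.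
have D0 : \int[area R]_(z in Dg) h z = 0.
  rewrite (@area_iterated_integral _ (l + l) B Dg h mD) //; last first.
    by move=> z [bz _]; exact: box_bounded.
  transitivity (\int[@lebesgue_measure R]_x (cst 0 : _ -> R) x); last first.
    by rewrite Rintegral_cst// mul0r.
  apply: eq_Rintegral => x _; rewrite /Rintegral (@integral_Sset1 _ _ _ (l - x))//.
  move=> y; rewrite /xsection/= inE => -[/boxE/= [h1 h2]] /not_orP[n1 n2].
  apply/eqP; rewrite eq_le; apply/andP; split; rewrite leNgt; apply/negP => c.
    by apply: n2; split; rewrite /=; lra.
  by apply: n1; split; rewrite /=; lra.
have dis (A1 A2 : set (plane R)) : (forall z, A1 z -> A2 z -> False) -> [disjoint A1 & A2].
  by move=> H; apply/disj_setPS => z [/H].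
rewrite bE Rintegral_setU//; first last.
- by apply: dis => z Tz [[/=]|[_ []]]; [case: Tz; lra|left].
- by rewrite -bE.
- exact: measurableU.
rewrite Rintegral_setU//; first last.
- by apply: dis => z Tz [_ []]; right.
- apply: iS; first exact: measurableU.
  by move=> z [/T'b|[]].
have : \int[area R]_(z in T') h (diag_reflection l z) = \int[area R]_(z in triangle) h z.
  apply: area_preserving_integral => //.
  rewrite (_ : _ \o _ = EFin \o h); first exact: iS.
  by apply/funext => z /=; rewrite hs.
rewrite D0 addr0 => TT'.
rewrite (_ : \int[area R]_(z in T') h z = \int[area R]_(z in triangle) h z); first by ring.
by rewrite -TT'; apply: eq_Rintegral => z _; rewrite hs.
Qed.

(** The integrand is the lowest mode of the triangle, with frequencies 2 and 1: reflecting the sine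
    product changes its sign, so subtracting the reflection produces a sum. *)
Lemma triangle_sine_integral : let w := pi / l in
  \int[area R]_(z in triangle) (sin (2 * (w * z.1)) * sin (w * z.2) + sin (w * z.1) * sin (2 * (w * z.2))) =
  8 / 3 * (l / pi) ^+ 2.
Proof.
move=> w.
have w0 : w != 0 by rewrite gt_eqF// divr_gt0// pi_gt0.
have wl : w * l = pi by rewrite /w divfK// gt_eqF.
have sin2 (u : R) : sin (2 * u) = 2 * (sin u * cos u) by rewrite mulr_natl sin_mulr2n; ring.
have cos2 (u : R) : cos (2 * u) = 2 * cos u ^+ 2 - 1.
  by rewrite mulr_natl cos_mulr2n; ring.
have ms (u v : plane R -> R) : measurable_fun setT u -> measurable_fun setT v ->
    measurable_fun setT (fun z => sin (u z) * sin (v z)).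
  by move=> mu mv; apply: measurable_funM; apply: measurableT_comp => //; exact: continuous_measurable_fun (@continuous_sin R).
rewrite (@area_iterated_integral _ (l + l) 2 triangle); first last.
- move=> z _; apply: le_trans (ler_normD _ _) _; rewrite !normrM.
  have p (u v : R) : `|sin u| * `|sin v| <= 1 by rewrite mulr_ile1// sin_max.
  by have := p (2 * (w * z.1)) (w * z.2); have := p (w * z.1) (2 * (w * z.2)); lra.
- by apply: measurable_funD; apply: ms; repeat apply: measurable_funM => //.
- by move=> z /triangle_box /box_bounded; apply.
- exact: measurable_triangle.
have inner (x : R) : x < l -> \int[@lebesgue_measure R]_(y in `]0, l - x[)
    (sin (2 * (w * x)) * sin (w * y) + sin (w * x) * sin (2 * (w * y))) =
    (sin (w * x) * cos (w * x) ^+ 2 + sin (w * x) + 2 * sin (w * x) * cos (w * x)) / w.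
  move=> xl; have c0 : 0 < l - x by rewrite subr_gt0.
  have FD (y : R) : is_derive y (1 : R)
      (fun y => - (sin (2 * (w * x)) * cos (w * y) / w + sin (w * x) * cos (2 * w * y) / (2 * w)))
      (sin (2 * (w * x)) * sin (w * y) + sin (w * x) * sin (2 * (w * y))).
    have d1 := is_derive_cosZ w y; have d2 := is_derive_cosZ (2 * w) y.
    apply: is_derive_eq; rewrite /GRing.scale/= (mulrA 2 w y).
    have E (s1 s2 s3 s4 t1 t2 : R) : - (s4 * t2 * 0 + w^-1 * (s4 * (- w * s3)) +
       (s2 * t1 * 0 + (2 * w)^-1 * (s2 * (- (2 * w) * s1)))) = s4 * s3 + s2 * s1 by field.
    exact: E.
  have cf : continuous (fun y : R => sin (2 * (w * x)) * sin (w * y) + sin (w * x) * sin (2 * (w * y))).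
    move=> y; apply: cvgD; apply: cvgM; try exact: cvg_cst; first exact: continuous_sinZ.
    rewrite (_ : (fun y => _) = fun y => sin (2 * w * y)); last by apply/funext => y'; rewrite mulrA.
    by rewrite mulrA; exact: continuous_sinZ.
  rewrite (integral_open_derivative c0 cf FD) -(mulrA 2 w) !mulr0 cos0 mulrBr wl !cos2 sin2.
  rewrite cosB cospi sinpi.
  have := cos2Dsin2 (w * x); move: (sin (w * x)) (cos (w * x)) => s c sc.
  by field.
transitivity (\int[@lebesgue_measure R]_(x in `]0, l[)
    ((sin (w * x) * cos (w * x) ^+ 2 + sin (w * x) + 2 * sin (w * x) * cos (w * x)) / w)).
  rewrite [RHS]Rintegral_mkcond; apply: eq_Rintegral => x _; rewrite patchE.
  case: ifPn => [|xl].
    rewrite inE/= in_itv/= => /andP[x0 xl]; rewrite -inner//; congr Rintegral.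
    apply/seteqP; split => y; rewrite /xsection/= inE in_itv/=.
      by move=> [/= _ h1 h2]; lra.
    by move=> h; split => /=; lra.
  rewrite (_ : xsection _ _ = set0) ?Rintegral_set0//; apply/seteqP; split => y //.
  rewrite /xsection/= inE => -[/= h1 h2 h3]; move: xl; rewrite mem_set//= in_itv/=; lra.
have FD (x : R) : is_derive x (1 : R)
    (fun x => - (cos (w * x) ^+ 3 / 3 + cos (w * x) + cos (w * x) ^+ 2) / w ^+ 2)
    ((sin (w * x) * cos (w * x) ^+ 2 + sin (w * x) + 2 * sin (w * x) * cos (w * x)) / w).
  have d1 := is_derive_cosZ w x.
  apply: is_derive_eq; rewrite /GRing.scale/=.
  move: (sin _) (cos _) => s c.
  by field.
have cf : continuous (fun x : R => (sin (w * x) * cos (w * x) ^+ 2 + sin (w * x) + 2 * sin (w * x) * cos (w * x)) / w).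
  have cc : continuous (fun x : R => cos (w * x)).
    by move=> x; apply/differentiable_continuous/derivable1_diffP; case: (is_derive_cosZ w x).
  have cs := @continuous_sinZ R w.
  move=> x; apply: cvgM; last exact: cvg_cst.
  apply: cvgD; [apply: cvgD|].
  - apply: cvgM; [exact: cs|apply: cvgM; exact: cc].
  - exact: cs.
  - by apply: cvgM; [apply: cvgM; [exact: cvg_cst|exact: cs]|exact: cc].
rewrite (integral_open_derivative l0 cf FD) wl cospi mulr0 cos0.
have -> : l / pi = w^-1 by rewrite /w invf_div.
by field.
Qed.
End triangle.

(** * Modes of a single rectangle or triangle *)

Section component.
Variables (R : realType) (t : bool) (p e : R * R) (a b : R).
Hypotheses (ue : unit_vector e) (a0 : 0 < a) (b0 : 0 < b) (tab : t -> a = b).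

(** The linear vanishing at each side that [polygon_H10] requires. For the triangle, the last bound
    concerns the hypotenuse. *)
Lemma mode_bounds m n (x y : R) : 0 < x < pi -> 0 < y < pi -> t ==> (x + y < pi) ->
  [/\ `|mode t m n (x, y)| <= (m + n).+2%:R * x,
      `|mode t m n (x, y)| <= (m + n).+2%:R * y,
      ~~ t -> `|mode t m n (x, y)| <= (m + n).+2%:R * (pi - x),
      ~~ t -> `|mode t m n (x, y)| <= (m + n).+2%:R * (pi - y)
    & t -> `|mode t m n (x, y)| <= (m + n).+2%:R * (pi - x - y)].
Proof.
move=> x0 y0 xy.
have -> : (m + n).+2%:R = m.+1%:R + n.+1%:R :> R by rewrite -natrD addnS addSn.
have s_le k (u : R) : 0 <= u -> `|sin (k.+1%:R * u)| <= k.+1%:R * u.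
  move=> u0; have := sin_subr_le (k.+1%:R * u) 0; rewrite sin0 !subr0.
  by rewrite (ger0_norm (x := _ * u)) ?mulr_ge0.
have s_piB k (u : R) : `|sin (k.+1%:R * (pi - u))| = `|sin (k.+1%:R * u)|.
  by rewrite sin_natpiB normrM normrX normrN1 expr1n mul1r.
have s_leC k (u : R) : 0 <= pi - u -> `|sin (k.+1%:R * u)| <= k.+1%:R * (pi - u).
  by move=> u0; rewrite -s_piB s_le.
have pl (u v B C : R) : 0 <= C -> `|u| <= B -> `|v| <= 1 -> `|u * v| <= B + C.
  move=> C0 uB v1; rewrite normrM; apply: (@le_trans _ _ `|u|); first exact: ler_piMr.
  lra.
have m0 := ler0n R m.+1; have n0 := ler0n R n.+1.
rewrite /mode /reduced /=; case: t xy => /= xy; split => //; rewrite ?subr0 ?mulrDl.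
- apply: le_trans (ler_normB _ _) _; apply: lerD; rewrite normrM ?s_piB.
    by apply: (@le_trans _ _ `|sin (m.+1%:R * x)|); [apply: ler_piMr => //; exact: sin_max|apply: s_le; lra].
  by apply: (@le_trans _ _ `|sin (n.+1%:R * x)|); [apply: ler_piMl => //; exact: sin_max|apply: s_le; lra].
- rewrite [leRHS]addrC; apply: le_trans (ler_normB _ _) _; apply: lerD; rewrite normrM ?s_piB.
    by apply: (@le_trans _ _ `|sin (n.+1%:R * y)|); [apply: ler_piMl => //; exact: sin_max|apply: s_le; lra].
  by apply: (@le_trans _ _ `|sin (m.+1%:R * y)|); [apply: ler_piMr => //; exact: sin_max|apply: s_le; lra].
(* On the hypotenuse x = pi - y. The mode is rewritten so that both differences compare sines of
   arguments at distance s. *)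
- move=> _; set s := pi - x - y.
  rewrite (_ : _ - _ = (sin (m.+1%:R * x) - sin (m.+1%:R * (pi - y))) * sin (n.+1%:R * y) +
    sin (m.+1%:R * (pi - y)) * (sin (n.+1%:R * y) - sin (n.+1%:R * (pi - x)))); last by ring.
  have D k (u v : R) : `|u - v| = s -> `|sin (k.+1%:R * u) - sin (k.+1%:R * v)| <= k.+1%:R * s.
    by move=> <-; apply: le_trans (sin_subr_le _ _) _; rewrite -mulrBr normrM ger0_norm.
  apply: le_trans (ler_normD _ _) _; apply: lerD; rewrite normrM.
    apply: le_trans (ler_piMr _ (sin_max _)) (D _ _ _ _) => //.
    by rewrite ltr0_norm /s; lra.
  apply: le_trans (ler_piMl _ (sin_max _)) (D _ _ _ _) => //.
  by rewrite ltr0_norm /s; lra.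
- by apply: pl; rewrite ?sin_max// ?mulr_ge0 ?s_le//; lra.
- by rewrite [leRHS]addrC mulrC; apply: pl; rewrite ?sin_max// ?mulr_ge0 ?s_le//; lra.
- by move=> _; apply: pl; rewrite ?sin_max ?mulr_ge0 ?s_leC//; lra.
- by move=> _; rewrite [leRHS]addrC mulrC; apply: pl; rewrite ?sin_max ?mulr_ge0 ?s_leC//; lra.
Qed.

(* The component is the rectangle with sides a, b in the frame (p, e) or, when t
   holds, the triangle with legs a = b.  The angles are pi x / a and pi y / b. *)
Definition angle1 : R * R * R :=
  (pi / a * e.1, pi / a * e.2, - (pi / a * (e.1 * p.1 + e.2 * p.2))).
Definition angle2 : R * R * R :=
  (- (pi / b * e.2), pi / b * e.1, pi / b * (e.2 * p.1 - e.1 * p.2)).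

Definition angles (q : R * R) : R * R := (affine angle1 q, affine angle2 q).

Definition of_angles (z : R * R) : R * R := in_frame p e (a / pi * z.1) (b / pi * z.2).

Definition scale_form (c : R) (l : R * R * R) : R * R * R := (c * l.1.1, c * l.1.2, c * l.2).
Definition co_angle (l : R * R * R) : R * R * R := (- l.1.1, - l.1.2, pi - l.2).
Definition co_sum (l1 l2 : R * R * R) : R * R * R :=
  (- (l1.1.1 + l2.1.1), - (l1.1.2 + l2.1.2), pi - (l1.2 + l2.2)).

Definition sides : seq (R * R * R) :=
  [:: angle1, angle2 & if t then [:: co_sum angle1 angle2]
     else [:: co_angle angle1; co_angle angle2]].

Definition component : set (R * R) := polygon sides.

(** The factor normalises both shapes. On the rectangle a sine product has squared norm a b / 4; for
    distinct frequencies the antisymmetrised product has a b / 2 on the square, and half of that on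
    the triangle. *)
Definition sine_mode m n (q : R * R) : R := 2 / Num.sqrt (a * b) * mode t m n (angles q).

Definition frequency m n : R := pi ^+ 2 * ((m.+1%:R / a) ^+ 2 + (n.+1%:R / b) ^+ 2).

Lemma affine_scale c l q : affine (scale_form c l) q = c * affine l q.
Proof. by rewrite /affine/=; ring. Qed.

Lemma affine_co_angle l q : affine (co_angle l) q = pi - affine l q.
Proof. by rewrite /affine/=; ring. Qed.

Lemma affine_co_sum l1 l2 q : affine (co_sum l1 l2) q = pi - affine l1 q - affine l2 q.
Proof. by rewrite /affine/=; ring. Qed.

Lemma anglesE q : angles q = (pi / a * (frame_coord p e q).1, pi / b * (frame_coord p e q).2).
Proof. by rewrite /angles /affine/frame_coord/=; congr pair; ring. Qed.

Lemma anglesK q : of_angles (angles q) = q.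
Proof.
have p0 : pi != 0 :> R by rewrite gt_eqF// pi_gt0.
have an : a != 0 by rewrite gt_eqF. have bn : b != 0 by rewrite gt_eqF.
have c (k r x : R) : r != 0 -> k != 0 -> k / r * (r / k * x) = x.
  by move=> r0 k0; field; rewrite r0 k0.
by rewrite anglesE /of_angles !c// frame_coordK.
Qed.

Lemma in_component q : component q <->
  [/\ 0 < (angles q).1 < pi, 0 < (angles q).2 < pi & t ==> ((angles q).1 + (angles q).2 < pi)].
Proof.
rewrite /component /polygon /sides/=; split.
  move=> h; have := h angle1; have := h angle2; rewrite !inE !eqxx ?orbT => /(_ isT) h2 /(_ isT) h1.
  case: t h => h /=.
    have := h (co_sum angle1 angle2).
    by rewrite !inE eqxx !orbT affine_co_sum => /(_ isT) ?; split => //; lra.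
  have := h (co_angle angle1); have := h (co_angle angle2).
  by rewrite !inE !eqxx !orbT !affine_co_angle => /(_ isT) ? /(_ isT) ?; split => //; lra.
move=> [/andP[x0 x1] /andP[y0 y1] xy] l; rewrite !inE => /orP[/eqP->//|/orP[/eqP->//|]].
case: t xy => /= xy; rewrite !inE; last first.
  by move=> /orP[] /eqP->; rewrite affine_co_angle subr_gt0.
by move=> /eqP->; rewrite affine_co_sum; move: xy; rewrite /angles/=; lra.
Qed.

Lemma component_frame q : component q <->
  [/\ 0 < (frame_coord p e q).1 < a, 0 < (frame_coord p e q).2 < b
    & t ==> ((frame_coord p e q).1 + (frame_coord p e q).2 < a)].
Proof.
have p0 : 0 < pi :> R by exact: pi_gt0.
have S (c x : R) : 0 < c -> (0 < pi / c * x < pi) = (0 < x < c).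
  move=> c0; rewrite pmulr_rgt0 ?divr_gt0//; congr andb.
  by rewrite mulrAC ltr_pdivrMr// ltr_pM2l.
rewrite in_component anglesE /= !S//; case: t tab => //= /(_ isT) <-.
by rewrite -mulrDr mulrAC ltr_pdivrMr// ltr_pM2l.
Qed.

Let kappa : R := 2 / Num.sqrt (a * b).
Let gamma : R := if t then -1 else 0.
Let W1 m n := wave (scale_form m.+1%:R angle1) (scale_form n.+1%:R angle2).
Let W2 m n := wave (scale_form m.+1%:R (co_angle angle2)) (scale_form n.+1%:R (co_angle angle1)).

Let sine_modeE m n : sine_mode m n = fun q => kappa * (W1 m n q + gamma * W2 m n q).
Proof.
apply/funext => q; rewrite /sine_mode /mode /reduced/= /W1 /W2 /wave !affine_scale !affine_co_angle.
by rewrite /gamma -/kappa; case: t; congr (_ * _); rewrite ?mulN1r ?mul0r ?subr0 ?addr0.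
Qed.

Lemma elementary_sine_mode m n : elementary (sine_mode m n).
Proof.
rewrite sine_modeE; apply: elementaryZ; apply: elementaryD; first exact: elementary_wave.
by apply: elementaryZ; exact: elementary_wave.
Qed.

Let derive_sine_mode m n v q : 'D_v (sine_mode m n) q =
  kappa * ('D_v (W1 m n) q + gamma * 'D_v (W2 m n) q).
Proof.
have e1 : elementary (W1 m n) by exact: elementary_wave.
have e2 : elementary (W2 m n) by exact: elementary_wave.
rewrite sine_modeE elementary_deriveZ; last by apply: elementaryD => //; exact: elementaryZ.
by rewrite elementary_deriveD ?elementary_deriveZ//; exact: elementaryZ.
Qed.

Lemma sine_mode_laplacian m n q :
  partial1 (partial1 (sine_mode m n)) q + partial2 (partial2 (sine_mode m n)) q =
  - frequency m n * sine_mode m n q.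
Proof.
have e1 : elementary (W1 m n) by exact: elementary_wave.
have e2 : elementary (W2 m n) by exact: elementary_wave.
have D v : 'D_v ('D_v (sine_mode m n)) q =
    kappa * ('D_v ('D_v (W1 m n)) q + gamma * 'D_v ('D_v (W2 m n)) q).
  have d1 := elementary_derive v e1; have d2 := elementary_derive v e2.
  rewrite (funext (derive_sine_mode m n v)) elementary_deriveZ; last first.
    by apply: elementaryD => //; exact: elementaryZ.
  by rewrite elementary_deriveD ?elementary_deriveZ//; exact: elementaryZ.
pose s1 := slope angle1; pose s2 := slope angle2.
have D2 v : 'D_v ('D_v (sine_mode m n)) q = kappa * (
    - ((m.+1%:R * s1 v) ^+ 2 + (n.+1%:R * s2 v) ^+ 2) * W1 m n q
      + 2 * (m.+1%:R * n.+1%:R * (s1 v * s2 v)) * (cos (m.+1%:R * affine angle1 q) * cos (n.+1%:R * affine angle2 q))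
    + gamma * (- ((m.+1%:R * s2 v) ^+ 2 + (n.+1%:R * s1 v) ^+ 2) * W2 m n q
      + 2 * (m.+1%:R * n.+1%:R * (s1 v * s2 v)) * (cos (m.+1%:R * affine (co_angle angle2) q) * cos (n.+1%:R * affine (co_angle angle1) q)))).
  have S c l : slope (scale_form c l) v = c * slope l v by rewrite /slope/=; ring.
  have N l : slope (co_angle l) v = - slope l v by rewrite /slope/=; ring.
  rewrite D; congr (kappa * (_ + gamma * _)).
    by rewrite /W1 derive2_wave !S !affine_scale -/(s1 v) -/(s2 v); ring.
  by rewrite /W2 derive2_wave !S !N !affine_scale -/(s1 v) -/(s2 v); ring.
have := ue; rewrite /unit_vector /frequency => u.
(* The two angles have orthogonal gradients of lengths pi / a and pi / b. Orthogonality cancels the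
   mixed cosine terms of the two second derivatives, and the lengths give the eigenvalue. *)
have s12 : s1 (1, 0) * s2 (1, 0) = - (s1 (0, 1) * s2 (0, 1)) by rewrite /s1 /s2 /slope/=; ring.
have s11 : s1 (1, 0) ^+ 2 = (pi / a) ^+ 2 - s1 (0, 1) ^+ 2.
  by rewrite (_ : (pi / a) ^+ 2 = (pi / a) ^+ 2 * (e.1 ^+ 2 + e.2 ^+ 2)); [rewrite /s1 /slope/=; ring|by rewrite u mulr1].
have s22 : s2 (1, 0) ^+ 2 = (pi / b) ^+ 2 - s2 (0, 1) ^+ 2.
  by rewrite (_ : (pi / b) ^+ 2 = (pi / b) ^+ 2 * (e.1 ^+ 2 + e.2 ^+ 2)); [rewrite /s2 /slope/=; ring|by rewrite u mulr1].
apply: etrans (congr2 +%R (D2 (1, 0)) (D2 (0, 1))) _.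
rewrite s12 !exprMn s11 s22 sine_modeE.
move: (cos _ * cos _) (cos _ * cos _) => c1 c2.
(* [W2] has the frequencies attached to the opposite axes; it belongs to the same eigenvalue because
   it is present only when a = b. *)
have [->|<-] : gamma = 0 \/ a = b by rewrite /gamma; case: t tab => [/(_ isT)|]; [right|left].
  by ring.
ring.
Qed.

Let sqrt_ab : 0 < Num.sqrt (a * b). Proof. by rewrite sqrtr_gt0 mulr_gt0. Qed.

Let frequency_ge0 m n : 0 <= frequency m n.
Proof. by rewrite mulr_ge0 ?sqr_ge0// addr_ge0 ?sqr_ge0. Qed.

(** The normalising factor grows as the component shrinks, but its square 4 / (a b) is at most the
    lowest eigenvalue. This makes the bounds on the modes uniform over all components. *)
Let kappa_le m n : kappa <= 1 + frequency m n.
Proof.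
have pi2 : 2 <= pi :> R by exact: pi_ge2.
have h : kappa ^+ 2 <= frequency m n.
  rewrite /kappa expr_div_n sqr_sqrtr; last by apply: mulr_ge0; exact: ltW.
  have x1 : a^-1 <= m.+1%:R / a by apply: ler_peMl; rewrite ?ler1n// invr_ge0 ltW.
  have y1 : b^-1 <= n.+1%:R / b by apply: ler_peMl; rewrite ?ler1n// invr_ge0 ltW.
  have x0 : 0 <= a^-1 by rewrite invr_ge0 ltW.
  have y0 : 0 <= b^-1 by rewrite invr_ge0 ltW.
  rewrite /frequency invfM.
  apply: (@le_trans _ _ (2 ^+ 2 * (a^-1 ^+ 2 + b^-1 ^+ 2))); first by nra.
  by apply: ler_pM; rewrite ?addr_ge0 ?sqr_ge0// ?lerD ?lerXn2r ?nnegrE//; lra.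
have := frequency_ge0 m n; have : 0 <= kappa by rewrite divr_ge0 ?ltW.
nra.
Qed.

Lemma sine_mode_bounds m n q :
  [/\ `|sine_mode m n q| <= 2 * (1 + frequency m n) ^+ 2,
      `|partial1 (sine_mode m n) q| <= 4 * (1 + frequency m n) ^+ 2
    & `|partial2 (sine_mode m n) q| <= 4 * (1 + frequency m n) ^+ 2].
Proof.
have g1 : `|gamma| <= 1 by rewrite /gamma; case: t; rewrite ?normrN ?normr1 ?normr0.
have k0 : 0 <= kappa by rewrite divr_ge0 ?ltW.
have kl := kappa_le m n; have f0 := frequency_ge0 m n.
have bnd (u v B : R) : `|u| <= B -> `|v| <= B -> `|kappa * (u + gamma * v)| <= kappa * (2 * B).
  move=> uB vB; rewrite normrM (ger0_norm k0); apply: ler_wpM2l => //.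
  apply: le_trans (ler_normD _ _) _; rewrite normrM.
  have := ler_piMl (normr_ge0 v) g1; lra.
have D v : `|v.1| + `|v.2| <= 1 ->
    `|'D_v (sine_mode m n) q| <= 4 * (1 + frequency m n) ^+ 2.
  move=> v1; rewrite derive_sine_mode.
  (* A bound for the directional derivatives of both waves, whose square is at most twice the
     eigenvalue. *)
  pose s := pi * (m.+1%:R / a + n.+1%:R / b).
  have s0 : 0 <= s by rewrite mulr_ge0 ?pi_ge0// addr_ge0// divr_ge0// ltW.
  have sl : s <= 2 * (1 + frequency m n).
    have : s ^+ 2 <= 2 * frequency m n.
      rewrite /s /frequency exprMn [leRHS]mulrCA; apply: ler_wpM2l; first exact: sqr_ge0.
      by have := sqr_ge0 (m.+1%:R / a - n.+1%:R / b); nra.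
    by nra.
  have ev : `|e.1 * v.1 + e.2 * v.2| <= 1 /\ `|- e.2 * v.1 + e.1 * v.2| <= 1.
    have e1 : `|e.1| <= 1 by rewrite ler_norml; have := ue; rewrite /unit_vector; nra.
    have e2 : `|e.2| <= 1 by rewrite ler_norml; have := ue; rewrite /unit_vector; nra.
    have tr (x y z w : R) : `|x| <= 1 -> `|y| <= 1 -> `|z| + `|w| <= 1 -> `|x * z + y * w| <= 1.
      move=> x1 y1 zw; apply: le_trans (ler_normD _ _) _; rewrite !normrM.
      have := ler_piMl (normr_ge0 z) x1; have := ler_piMl (normr_ge0 w) y1; lra.
    by split; apply: tr => //; rewrite normrN.
  have sc c d (x : R) : 0 < d -> 0 <= c -> `|x| <= 1 -> `|c * (pi / d * x)| <= pi * (c / d).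
    move=> d0 c0 x1; rewrite mulrA normrM (_ : c * (pi / d) = pi * (c / d)); last by ring.
    have h : 0 <= pi * (c / d) by rewrite mulr_ge0 ?pi_ge0// divr_ge0// ltW.
    by rewrite (ger0_norm h); exact: ler_piMr.
  have [ev1 ev2] := ev.
  have S1 : `|'D_v (W1 m n) q| <= s.
    apply: le_trans (derive_wave_le _ _ _ _) _; rewrite /s mulrDr /slope/=; apply: lerD.
      rewrite (_ : _ + _ = m.+1%:R * (pi / a * (e.1 * v.1 + e.2 * v.2))); last by ring.
      exact: sc.
    rewrite (_ : _ + _ = n.+1%:R * (pi / b * (- e.2 * v.1 + e.1 * v.2))); last by ring.
    exact: sc.
  have S2 : `|gamma| * `|'D_v (W2 m n) q| <= s.
    rewrite /gamma; case: t tab => [/(_ isT) ab|_]; last by rewrite normr0 mul0r.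
    rewrite normrN1 mul1r; apply: le_trans (derive_wave_le _ _ _ _) _.
    rewrite /s mulrDr /slope/=; apply: lerD.
      rewrite (_ : _ + _ = - (m.+1%:R * (pi / b * (- e.2 * v.1 + e.1 * v.2)))); last by ring.
      by rewrite normrN -ab; exact: sc.
    rewrite (_ : _ + _ = - (n.+1%:R * (pi / a * (e.1 * v.1 + e.2 * v.2)))); last by ring.
    by rewrite normrN -ab; exact: sc.
  rewrite normrM (ger0_norm k0).
  have h : `|'D_v (W1 m n) q + gamma * 'D_v (W2 m n) q| <= 2 * s.
    by apply: le_trans (ler_normD _ _) _; rewrite normrM; lra.
  by have := normr_ge0 ('D_v (W1 m n) q + gamma * 'D_v (W2 m n) q); nra.
split; last 2 first.
- by apply: D; rewrite normr1 normr0 addr0.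
- by apply: D; rewrite normr1 normr0 add0r.
rewrite sine_modeE; have := bnd _ _ 1 (wave_le1 _ _ q) (wave_le1 _ _ q) : `|kappa * (W1 m n q + gamma * W2 m n q)| <= _.
nra.
Qed.

Lemma component_bounded q : component q ->
  `|q.1| <= `|p.1| + `|p.2| + a + b /\ `|q.2| <= `|p.1| + `|p.2| + a + b.
Proof.
move=> /component_frame[/andP[x0 xa] /andP[y0 yb] _].
have := frame_coordK p q ue; move: x0 xa y0 yb.
move: (frame_coord p e q).1 (frame_coord p e q).2 => x y x0 xa y0 yb <- /=.
have e1 : `|e.1| <= 1 by rewrite ler_norml; have := ue; rewrite /unit_vector; nra.
have e2 : `|e.2| <= 1 by rewrite ler_norml; have := ue; rewrite /unit_vector; nra.
have h (c u z : R) : `|u| <= 1 -> 0 < z < c -> `|z * u| <= c.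
  move=> u1 /andP[z0 zc]; rewrite normrM (gtr0_norm z0).
  by have := ler_piMr (ltW z0) u1; lra.
have := h a e.1 x e1; have := h a e.2 x e2; have := h b e.1 y e1; have := h b e.2 y e2.
rewrite x0 xa y0 yb => /(_ isT) h1 /(_ isT) h2 /(_ isT) h3 /(_ isT) h4.
have tr (u v w : R) : `|u + v + w| <= `|u| + `|v| + `|w|.
  by apply: le_trans (ler_normD _ _) _; rewrite lerD2r ler_normD.
have := normr_ge0 p.1; have := normr_ge0 p.2.
split; apply: le_trans (tr _ _ _) _; rewrite ?normrN; lra.
Qed.

Lemma measurable_component : measurable (component : set (plane R)).
Proof. exact: measurable_polygon. Qed.

Lemma component_area_lty : (area R component < +oo)%E.
Proof.
exact: (area_box_lty measurable_component component_bounded).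
Qed.

Lemma sine_mode_H10 (M : set (plane R)) m n :
  measurable M -> (area R M < +oo)%E -> component `<=` M ->
  H10_with_gradient M (sine_mode m n \_ component)
    (partial1 (sine_mode m n) \_ component) (partial2 (sine_mode m n) \_ component).
Proof.
move=> mM aM PM.
have k0 : 0 <= kappa by rewrite divr_ge0 ?ltW.
apply: (@polygon_H10 _ _ _ _ (`|p.1| + `|p.2| + a + b) (kappa * (m + n).+2%:R)
  (4 * (1 + frequency m n) ^+ 2)) => //.
- exact: component_bounded.
- exact: elementary_sine_mode.
- move=> q l Pq ls; rewrite /sine_mode -/kappa normrM (ger0_norm k0) -mulrA.
  apply: ler_wpM2l => //.
  have /in_component[x0 y0 xy] := Pq.
  have [h1 h2 h3 h4 h5] := mode_bounds m n x0 y0 xy.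
  move: ls; rewrite /sides !inE => /orP[/eqP->|/orP[/eqP->|]].
  + exact: h1.
  + exact: h2.
  case: t h3 h4 h5 => h3 h4 h5; rewrite !inE.
    by move=> /eqP->; rewrite affine_co_sum; exact: h5.
  by move=> /orP[] /eqP->; rewrite affine_co_angle; [exact: h3|exact: h4].
move=> q _; have [h1 h2 h3] := sine_mode_bounds m n q; split=> //.
by apply: le_trans h1 _; apply: ler_wpM2r; [exact: sqr_ge0|rewrite ler_nat].
Qed.

Lemma sine_mode_weak (M P' : set (R * R)) m n psi : open P' -> component `&` P' = set0 ->
  M = component `|` P' -> test_function M psi ->
  L2dot M (partial1 (sine_mode m n) \_ component) (partial1 psi) +
  L2dot M (partial2 (sine_mode m n) \_ component) (partial2 psi) =
  L2dot M (fun q => frequency m n * (sine_mode m n \_ component) q) psi.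
Proof.
move=> oP' PP' MP tp.
have r0 : 0 < `|p.1| + `|p.2| + a + b.
  by have := normr_ge0 p.1; have := normr_ge0 p.2; have := a0; have := b0; lra.
apply: (@weak_equation _ M component P' psi _ oP' PP' MP tp _ (`|p.1| + `|p.2| + a + b)).
- exact: open_polygon.
- exact: r0.
- exact: elementary_sine_mode.
- by move=> q /component_bounded ?; apply/square_boxE.
- exact: sine_mode_laplacian.
Qed.

Lemma measurable_angles : measurable_fun setT (angles : plane R -> plane R).
Proof.
by apply: measurable_fun_pair; apply: elementary_measurable; exact: elementary_affine.
Qed.

Lemma measurable_of_angles : measurable_fun setT (of_angles : plane R -> plane R).
Proof.
have h (c d f : R) : measurable_fun setT (fun z : plane R => c + d * z.1 + f * z.2).
  by apply: measurable_funD; [apply: measurable_funD => //|]; exact: measurable_funM.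
apply: measurable_fun_pair.
  apply: eq_measurable_fun (h p.1 (a / pi * e.1) (- (b / pi * e.2))) => z _.
  by rewrite /=; ring.
by apply: eq_measurable_fun (h p.2 (a / pi * e.2) (b / pi * e.1)) => z _ /=; ring.
Qed.

Definition frame_domain : set (plane R) := if t then triangle a else box a b.

Let measurable_frame_domain : measurable frame_domain.
Proof. by rewrite /frame_domain; case: t; [exact: measurable_triangle|exact: measurable_box]. Qed.

Let component_preimage : component = frame_coord p e @^-1` frame_domain.
Proof.
apply/seteqP; split => q; rewrite /= component_frame /frame_domain; move: (frame_coord p e q) => z.
  by case: t => /= -[/andP[h1 h2] /andP[h3 h4] h5]; [|apply/boxE; rewrite h1 h2 h3].
by case: t tab => [/(_ isT) ab [h1 h2 h3]|_ /boxE[h1 h2]]; split => //; lra.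
Qed.

Let frame_domain_lty : (area R frame_domain < +oo)%E.
Proof.
apply: (area_box_lty measurable_frame_domain (K := a + b)) => z.
rewrite /frame_domain; case: t tab => [/(_ isT) <- /triangle_box|_]; exact: box_bounded.
Qed.

Lemma component_integral (h : plane R -> R) (B : R) : measurable_fun setT h -> (forall z, `|h z| <= B) ->
  \int[area R]_(q in component) h (frame_coord p e q) = \int[area R]_(z in frame_domain) h z.
Proof.
move=> mh hB; rewrite component_preimage.
have apf := area_preserving_frame_coord p ue.
apply: area_preserving_integral => //.
rewrite -component_preimage; apply: (bounded_integrable measurable_component component_area_lty (K := B)) => //.
  by apply: measurable_funTS; apply: measurableT_comp => //; exact: apf.1.
by move=> q _; exact: hB.
Qed.

Lemma component_area : area R component = (if t then a * b / 2 else a * b)%:E.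
Proof.
rewrite component_preimage (area_preserving_frame_coord p ue).2//.
have area_box c d : 0 < c -> 0 < d -> area R (box c d) = (c * d)%:E.
  move=> c0 d0; rewrite /box areaX// !lebesgue_measure_itv/= !lte_fin c0 d0.
  by rewrite -!EFinD !subr0 -EFinM.
rewrite /frame_domain; case: t tab => [/(_ isT) <-|_]; last exact: area_box.
have h1 (z : plane R) : `|cst 1 z| <= 1 :> R by rewrite /= normr1.
have := half_square a0 (measurable_cst _) h1 (fun=> erefl).
rewrite (Rintegral_cst _ (measurable_box a a)) (Rintegral_cst _ (measurable_triangle a)).
rewrite !mul1r area_box// => h.
rewrite -[LHS]fineK; last first.
  rewrite ge0_fin_numE//; apply: (area_box_lty (measurable_triangle a) (K := a + a)) => z.
  by move=> /triangle_box; exact: box_bounded.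
congr EFin; apply: (@mulfI _ 2); first by rewrite pnatr_eq0.
by rewrite -h [fine _]/= mulrCA divff ?mulr1// pnatr_eq0.
Qed.

Let u m n (z : plane R) : R := sin (m.+1%:R * (pi / a * z.1)) * sin (n.+1%:R * (pi / b * z.2)).

Let measurable_u m n : measurable_fun setT (u m n).
Proof.
by apply: measurable_funM; apply: (measurableT_comp (continuous_measurable_fun (@continuous_sin R)));
  repeat apply: measurable_funM => //.
Qed.

Let u_le1 m n z : `|u m n z| <= 1.
Proof. by rewrite /u normrM mulr_ile1// sin_max. Qed.

Let box_lty : (area R (box a b) < +oo)%E.
Proof. by apply: area_box_lty (measurable_box a b) _ => z; exact: box_bounded. Qed.

Let u_inL2 m n : inL2 (box a b) (u m n).
Proof.
apply: (inL2_bounded (measurable_box a b) (B := 1)) => //; exact: measurable_funTS.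
Qed.

Let u_orthogonal m n m' n' : L2dot (box a b) (u m n) (u m' n') =
  a * b / 4 * ((m == m') && (n == n'))%:R.
Proof.
pose s c k l (x : R) := sin (k.+1%:R * (pi / c * x)) * sin (l.+1%:R * (pi / c * x)).
have ms c k l : measurable_fun setT (s c k l).
  by apply: measurable_funM; apply: (measurableT_comp (continuous_measurable_fun (@continuous_sin R)));
    repeat apply: measurable_funM => //.
have sb c k l x : `|s c k l x| <= 1 by rewrite /s normrM mulr_ile1// sin_max.
transitivity (\int[area R]_(z in box a b) (s a m m' z.1 * s b n n' z.2)).
  by apply: eq_Rintegral => z _; rewrite /u /s; ring.
have xa x : `]0, a[%classic x -> `|x| <= a + b.
  by rewrite /= in_itv/= => /andP[? ?]; have := b0; rewrite ger0_norm; lra.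
have xb x : `]0, b[%classic x -> `|x| <= a + b.
  by rewrite /= in_itv/= => /andP[? ?]; have := a0; rewrite ger0_norm; lra.
rewrite (@area_product_integral _ (a + b) 1)// !integral_sin_sin//.
by case: (m == m'); case: (n == n'); rewrite /= ?mulr0 ?mul0r ?mulr1//; field.
Qed.

Let modeE m n (z : R * R) : mode t m n (pi / a * z.1, pi / b * z.2) =
  u m n z - (t%:R * (-1) ^+ (m + n)) * u n m z.
Proof.
rewrite /mode /reduced/u/=; case: t tab => [/(_ isT) <-|_]; last by rewrite !mul0r.
rewrite !sin_natpiB mul1r exprD !exprS; ring.
Qed.

Let measurable_mode m n :
  measurable_fun setT (fun z : plane R => mode t m n (pi / a * z.1, pi / b * z.2)).
Proof.
rewrite (funext (modeE m n)); apply: measurable_funB; first exact: measurable_u.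
by apply: measurable_funM => //; exact: measurable_u.
Qed.

Let mode_le2 m n (z : plane R) : `|mode t m n (pi / a * z.1, pi / b * z.2)| <= 2.
Proof.
rewrite modeE; apply: le_trans (ler_normB _ _) _.
have := u_le1 m n z; have := u_le1 n m z; rewrite !normrM normrX normrN1 expr1n mulr1.
by case: t; rewrite ?normr1 ?normr0; lra.
Qed.

Lemma sine_mode_orthonormal m n m' n' : (t -> n < m)%N -> (t -> n' < m')%N ->
  L2dot component (sine_mode m n) (sine_mode m' n') = ((m == m') && (n == n'))%:R.
Proof.
move=> nm nm'; pose h m n (z : plane R) := mode t m n (pi / a * z.1, pi / b * z.2).
have mh k l : measurable_fun setT (h k l) by exact: measurable_mode.
have hh z : `|h m n z * h m' n' z| <= 4.
  rewrite normrM (_ : 4 = 2 * 2 :> R); last by rewrite -natrM.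
  by apply: ler_pM => //; exact: mode_le2.
transitivity (kappa ^+ 2 * \int[area R]_(z in frame_domain) (h m n z * h m' n' z)).
  rewrite -(component_integral (B := 4)); first last.
  - exact: hh.
  - exact: measurable_funM.
  rewrite -RintegralZl//; last 2 first.
  - exact: measurable_component.
  - apply: (bounded_integrable measurable_component component_area_lty (K := 4)).
      apply: measurable_funTS; apply: (@measurableT_comp _ _ _ _ _ _ (fun z => h m n z * h m' n' z)).
        exact: measurable_funM.
      exact: (area_preserving_frame_coord p ue).1.
    by move=> q _; rewrite /=; exact: hh.
  by apply: eq_Rintegral => q _; rewrite /sine_mode anglesE -/kappa /h; ring.
have k2 : kappa ^+ 2 = 4 / (a * b).
  rewrite /kappa expr_div_n sqr_sqrtr; last by apply: mulr_ge0; exact: ltW.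
  by rewrite -natrX.
have ab0 : a * b != 0 by rewrite mulf_neq0// gt_eqF.
rewrite k2 /frame_domain; case tE: t.
  have ab := tab tE.
  (* Each mode is antisymmetric in the diagonal reflection, so a product of two modes is symmetric
     and its integral over the triangle is half of that over the square. *)
  have h_diag k l z : h k l (diag_reflection a z) = - h k l z.
    rewrite /h /mode /reduced tE /= -ab !mulrBr !divfK ?gt_eqF// !subKr; ring.
  have half : \int[area R]_(z in triangle a) (h m n z * h m' n' z) = L2dot (box a b) (h m n) (h m' n') / 2.
    rewrite /L2dot -ab (half_square a0 (measurable_funM (mh m n) (mh m' n')) hh).
      by rewrite mulrAC divff ?mul1r// pnatr_eq0.
    by move=> z; rewrite /= !h_diag mulrNN.
  have L_h k l : inL2 (box a b) (h k l).
    by apply: (inL2_bounded (measurable_box a b) (B := 2)) => //; [exact: measurable_funTS|move=> z _; exact: mode_le2].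
  have mB := measurable_box a b.
  have expand k l f : inL2 (box a b) f -> L2dot (box a b) (h k l) f =
      L2dot (box a b) (u k l) f - (-1) ^+ (k + l) * L2dot (box a b) (u l k) f.
    move=> Lf; rewrite (_ : h k l = fun z => u k l z - (-1) ^+ (k + l) * u l k z); last first.
      by apply/funext => z; rewrite /h modeE tE mul1r.
    by rewrite (L2dotBl mB (u_inL2 _ _) (inL2Z mB _ (u_inL2 _ _)) Lf) (L2dotZl mB _ (u_inL2 _ _) Lf).
  rewrite half expand// ![L2dot _ _ (h m' n')]L2dotC !expand// !u_orthogonal.
  have {}nm := nm tE; have {}nm' := nm' tE.
  (* Ordered frequencies cannot match crosswise, so only the straight pairings contribute to the
     product. *)
  have -> : (m' == n) && (n' == m) = false by apply/negP => /andP[/eqP h1 /eqP h2]; lia.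
  have -> : (n' == n) && (m' == m) = (m == m') && (n == n').
    by rewrite andbC (eq_sym m') (eq_sym n').
  have -> : (n' == m) && (m' == n) = false by apply/negP => /andP[/eqP h1 /eqP h2]; lia.
  rewrite (eq_sym m') (eq_sym n'); case: eqP => [->|_]; case: eqP => [->|_] /=;
    rewrite ?mulr0 ?subr0 ?sub0r ?mulr1 ?mulr0 ?oppr0 ?mulr0 ?subr0 ?mul0r ?mulr0//.
  have ss : (-1) ^+ (m' + n') * (-1) ^+ (m' + n') = 1 :> R by rewrite -expr2 sqrr_sign.
  by rewrite mulrN opprK (mulrA ((-1) ^+ (m' + n'))) ss mul1r; field; rewrite !gt_eqF.
rewrite (_ : \int[area R]_(z in _) _ = L2dot (box a b) (u m n) (u m' n')); last first.
  by apply: eq_Rintegral => z _; rewrite /h !modeE tE !mul0r !subr0.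
by rewrite u_orthogonal; field; rewrite !gt_eqF.
Qed.

Let mean_sine_mode m n : L2dot component (cst 1) (sine_mode m n) =
  kappa * \int[area R]_(z in frame_domain) mode t m n (pi / a * z.1, pi / b * z.2).
Proof.
rewrite -(component_integral (B := 2) (measurable_mode m n) (mode_le2 m n)) -RintegralZl//.
- by apply: eq_Rintegral => q _; rewrite /sine_mode anglesE mul1r.
- exact: measurable_component.
apply: (bounded_integrable measurable_component component_area_lty (K := 2)).
  apply: measurable_funTS; apply: (measurableT_comp (measurable_mode m n)).
  exact: (area_preserving_frame_coord p ue).1.
by move=> q _; exact: (mode_le2 m n (frame_coord p e q)).
Qed.

Let kappa_sqr : kappa ^+ 2 = 4 / (a * b).
Proof.
rewrite /kappa expr_div_n sqr_sqrtr; last by apply: mulr_ge0; exact: ltW.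
by rewrite -natrX.
Qed.

Lemma mean_rectangle_mode : ~~ t ->
  L2dot component (cst 1) (sine_mode 0 0) ^+ 2 = 64 * a * b / pi ^+ 4.
Proof.
move=> /negbTE tF; rewrite mean_sine_mode /frame_domain tF.
have int_sin c : 0 < c -> \int[@lebesgue_measure R]_(x in `]0, c[) sin (pi / c * x) = 2 * c / pi.
  move=> c0; have FD (x : R) : is_derive x (1 : R) (fun x => - cos (pi / c * x) * (c / pi)) (sin (pi / c * x)).
    have d1 := is_derive_cosZ (pi / c) x; apply: is_derive_eq; rewrite /GRing.scale/=.
    have E (s v r k : R) : r != 0 -> k != 0 -> - s * 0 + k / r * - (- (r / k) * v) = v.
      by move=> r0 k0; field; rewrite r0 k0.
    by apply: E; rewrite gt_eqF// pi_gt0.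
  rewrite (integral_open_derivative c0 (@continuous_sinZ R (pi / c)) FD) divfK ?gt_eqF//.
  by rewrite cospi mulr0 cos0; ring.
rewrite (_ : Rintegral _ _ _ = \int[area R]_(z in box a b) (sin (pi / a * z.1) * sin (pi / b * z.2))); last first.
  by apply: eq_Rintegral => z _; rewrite /mode /reduced/= !mul1r subr0.
have xa x : `]0, a[%classic x -> `|x| <= a + b.
  by rewrite /= in_itv/= => /andP[? ?]; have := b0; rewrite ger0_norm; lra.
have xb x : `]0, b[%classic x -> `|x| <= a + b.
  by rewrite /= in_itv/= => /andP[? ?]; have := a0; rewrite ger0_norm; lra.
have ms c : measurable_fun setT (fun x : R => sin (pi / c * x)).
  exact: continuous_measurable_fun (@continuous_sinZ R (pi / c)).
rewrite (@area_product_integral _ (a + b) 1 _ _ (fun x => sin (pi / a * x)) (fun y => sin (pi / b * y)))//;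
  try by move=> x _; exact: sin_max.
rewrite !int_sin// exprMn kappa_sqr.
have E (x y r : R) : x != 0 -> y != 0 -> r != 0 ->
    4 / (x * y) * (2 * x / r * (2 * y / r)) ^+ 2 = 64 * x * y / r ^+ 4.
  by move=> x0 y0 r0; field; rewrite x0 y0 r0.
by apply: E; rewrite gt_eqF// pi_gt0.
Qed.

Lemma mean_triangle_mode : t ->
  L2dot component (cst 1) (sine_mode 1 0) ^+ 2 = 256 * a ^+ 2 / (9 * pi ^+ 4).
Proof.
move=> tT; rewrite mean_sine_mode /frame_domain tT.
have ab := tab tT.
have := triangle_sine_integral a0; cbv zeta; move=> I.
rewrite (_ : Rintegral _ _ _ = 8 / 3 * (a / pi) ^+ 2); last first.
  rewrite -I; apply: eq_Rintegral => z _.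
  by have := modeE 1 0 z; rewrite tT => ->; rewrite /u -ab addn0 expr1 !mul1r; ring.
rewrite exprMn kappa_sqr -ab.
have E (x r : R) : x != 0 -> r != 0 ->
    4 / (x * x) * (8 / 3 * (x / r) ^+ 2) ^+ 2 = 256 * x ^+ 2 / (9 * r ^+ 4).
  by move=> x0 r0; field; rewrite x0 r0.
by apply: E; rewrite gt_eqF// pi_gt0.
Qed.
End component.

(** * Matching the eigenvalues *)

Section sorted_enumeration.
Local Open Scope nat_scope.
Variables (T : eqType) (w : T -> nat) (box : nat -> seq T) (x : nat -> T).
Hypotheses (box_uniq : forall N, uniq (box N))
  (boxP : forall t N, w t <= N -> t \in box N) (xinj : injective x).

Let level N := [seq t <- box N | w t == N].
Let prefix_of N := flatten [seq level i | i <- iota 0 N].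

Let prefixS N : prefix_of N.+1 = prefix_of N ++ level N.
Proof. by rewrite /prefix_of -addn1 iotaD map_cat flatten_cat /= cats0. Qed.

Let mem_level t N : (t \in level N) = (w t == N).
Proof.
rewrite mem_filter; case: eqP => //= wt; apply: boxP; by rewrite wt.
Qed.

Let mem_prefix t N : (t \in prefix_of N) = (w t < N).
Proof.
elim: N => [|N IH]; first by rewrite ltn0.
by rewrite prefixS mem_cat IH mem_level ltnS orbC -leq_eqVlt.
Qed.

Let prefix_uniq N : uniq (prefix_of N).
Proof.
elim: N => // N IH; rewrite prefixS cat_uniq IH filter_uniq// andbT /=.
by apply/hasPn => t; rewrite mem_level mem_prefix => /eqP ->; rewrite ltnn.
Qed.

Let prefix_sorted N : sorted leq (map w (prefix_of N)).
Proof.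
elim: N => // N IH; rewrite prefixS map_cat.
rewrite (sorted_pairwise leq_trans) pairwise_cat -!(sorted_pairwise leq_trans) IH /=.
apply/andP; split.
  apply/allrelP => _ _ /mapP[t + ->] /mapP[s + ->]; rewrite mem_prefix mem_level.
  by move=> /ltnW + /eqP ->.
have /all_pred1P -> : all (pred1 N) (map w (level N)).
  by apply/allP => _ /mapP[t + ->]; rewrite mem_level.
by elim: (size _) => // -[|n] //= ->; rewrite leqnn.
Qed.

(** The prefix below this level contains the distinct elements x 0, ..., x k and therefore has more
    than k entries. *)
Let bound k := (\max_(i < k.+1) w (x i)).+1.

Let size_bound k : k < size (prefix_of (bound k)).
Proof.
rewrite -(size_iota 0 k.+1) -(size_map x); apply: uniq_leq_size.
  by rewrite map_inj_uniq ?iota_uniq.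
move=> _ /mapP[i + ->]; rewrite mem_iota add0n => /= ik.
by rewrite mem_prefix ltnS (leq_bigmax (F := fun i : 'I_k.+1 => w (x i)) (Ordinal ik)).
Qed.

Let nth_prefix M N k : M <= N -> k < size (prefix_of M) ->
  nth (x 0) (prefix_of N) k = nth (x 0) (prefix_of M) k.
Proof.
move=> MN kM; rewrite -(subnKC MN); elim: (N - M) => [|d IH]; first by rewrite addn0.
rewrite addnS prefixS nth_cat IH; case: ltnP => // h.
have : size (prefix_of M) <= size (prefix_of (M + d)).
  apply: uniq_leq_size => // t; rewrite !mem_prefix => /leq_trans; apply; exact: leq_addr.
by move=> /(leq_trans kM); rewrite ltnNge h.
Qed.

Let e k := nth (x 0) (prefix_of (bound k)) k.

Let eE N k : k < size (prefix_of N) -> e k = nth (x 0) (prefix_of N) k.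
Proof.
move=> kN; rewrite /e -(nth_prefix (leq_maxl (bound k) N) (size_bound k)).
by rewrite (nth_prefix (leq_maxr (bound k) N) kN).
Qed.

Let common i j : exists N, i < size (prefix_of N) /\ j < size (prefix_of N).
Proof.
exists (maxn (bound i) (bound j)); split.
  apply: leq_trans (size_bound i) _; apply: uniq_leq_size => // t.
  by rewrite !mem_prefix leq_max => ->.
apply: leq_trans (size_bound j) _; apply: uniq_leq_size => // t.
by rewrite !mem_prefix leq_max orbC => ->.
Qed.

(** Listing the finite levels one after another gives a sorted sequence without repetition; the k-th
    term is read off any sufficiently long prefix. The last claim holds because the first k + 1
    terms are distinct and all lie in the box of the k-th weight; it becomes the growth of the
    eigenvalues. *)
Lemma sorted_enumeration : exists e : nat -> T,
  [/\ injective e, forall t, exists k, e k = t,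
      {homo w \o e : i j / i <= j} & forall k, k < size (box (w (e k)))].
Proof.
have einj : injective e.
  move=> i j; have [N [iN jN]] := common i j.
  by rewrite (eE iN) (eE jN) => /eqP; rewrite nth_uniq// => /eqP.
have emono : {homo w \o e : i j / i <= j}.
  move=> i j ij; have [N [iN jN]] := common i j; rewrite /= (eE iN) (eE jN).
  have := sorted_leq_nth leq_trans leqnn (w (x 0)) (prefix_sorted N).
  move=> /(_ i j); rewrite !inE !size_map => /(_ iN jN ij).
  by rewrite !(nth_map (x 0)).
exists e; split => //.
- move=> t; have tp : t \in prefix_of (w t).+1 by rewrite mem_prefix.
  by exists (index t (prefix_of (w t).+1)); rewrite (eE (N := (w t).+1)) ?index_mem// nth_index.
- move=> k; rewrite -(size_iota 0 k.+1) -(size_map e); apply: uniq_leq_size.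
    by rewrite map_inj_uniq ?iota_uniq.
  move=> _ /mapP[i + ->]; rewrite mem_iota add0n => /= ik.
  by apply: boxP; apply: emono.
Qed.
End sorted_enumeration.

(** * The bijection between the modes of D and those of C *)

Section modes_correspondence.
Local Open Scope nat_scope.
Implicit Types (i : nat * nat * nat) (z : nat * nat).

Definition weight i : nat := 2 ^ i.1.1 * (4 * i.1.2.+1 ^ 2 + i.2.+1 ^ 2).

(** Eigenvalues of C divided by pi^2 / 4. The legs of the triangle have length 2, which gives the
    sum of two squares, while the square of area 2^-c contributes the extra factor 4 times 2^c. *)
Definition weight_squares i : nat :=
  if i.1.1 is c.+1 then 2 ^ c * (4 * (i.1.2.+1 ^ 2 + i.2.+1 ^ 2)) else i.1.2.+1 ^ 2 + i.2.+1 ^ 2.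

(* In D, the index (j, p, q) stands for the mode with frequencies p + 1, q + 1 of
   the rectangle Rect j.  In C, component 0 is the triangle and component j + 1
   is the square Sq j. *)
Definition base_pair p q : nat * nat :=
  if q.+1 < 2 * p.+1 then (2 * p.+1, q.+1) else (q.+1, 2 * p.+1).

(** Only pairs with positive second entry below the first are turned. For these the truncated
    subtraction is exact, and the image is again such a pair. *)
Definition turn z : nat * nat := (z.1 + z.2, z.1 - z.2).

(** Indices are one less than frequencies, so [odd q] is the case of an even second frequency; the
    predecessors in the other branch are exact because all turned entries are positive. *)
Definition transfer i : nat * nat * nat :=
  let: (j, p, q) := i in
  if odd q then (j.+1, p, q./2)
  else let z := iter j turn (base_pair p q) in (0, z.1.-1, z.2.-1).

Let base_pairP p q : ~~ odd q -> [/\ 0 < (base_pair p q).2, (base_pair p q).2 < (base_pair p q).1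
  & odd ((base_pair p q).1 + (base_pair p q).2)].
Proof.
move=> oq; rewrite /base_pair; have := odd_double_half q; rewrite (negbTE oq) add0n => E.
case: (ltnP q.+1 (2 * p.+1)) => h /=; split => //; rewrite ?oddD ?oddM/= ?(negbTE oq)//; lia.
Qed.

Let iter_turnP p q j : ~~ odd q -> 0 < (iter j turn (base_pair p q)).2 < (iter j turn (base_pair p q)).1.
Proof.
move=> oq; elim: j => [|j]; first by have [-> ->] := base_pairP p oq.
by rewrite iterS; case: (iter j turn _) => X Y; rewrite /turn/=; lia.
Qed.

Let turn_even z : z.2 < z.1 -> ~~ odd ((turn z).1 + (turn z).2).
Proof. by case: z => X Y /= h; rewrite (_ : _ + _ = X.*2) ?odd_double//; lia. Qed.

Let iter_turn_inj p q p' q' j j' : ~~ odd q -> ~~ odd q' ->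
  iter j turn (base_pair p q) = iter j' turn (base_pair p' q') ->
  j = j' /\ base_pair p q = base_pair p' q'.
Proof.
move=> oq oq'; elim: j j' => [|j IH] [|j'] //=.
- move=> E; have [_ _] := base_pairP p oq; rewrite E.
  have /andP[_ h] := iter_turnP p' j' oq'.
  by rewrite (negbTE (turn_even h)).
- move=> E; have [_ _] := base_pairP p' oq'; rewrite -E.
  have /andP[_ h] := iter_turnP p j oq.
  by rewrite (negbTE (turn_even h)).
have /andP[_ h] := iter_turnP p j oq; have /andP[_ h'] := iter_turnP p' j' oq'.
move=> E; have [|-> ->] := IH j'; last by [].
move: h h' E; case: (iter j turn _) => X Y; case: (iter j' turn _) => X' Y'.
by rewrite /turn/= => h h' [E1 E2]; congr pair; lia.
Qed.

Let base_pair_inj p q p' q' : ~~ odd q -> ~~ odd q' -> base_pair p q = base_pair p' q' ->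
  p = p' /\ q = q'.
Proof.
move=> oq oq'; have := odd_double_half q; have := odd_double_half q'.
rewrite (negbTE oq) (negbTE oq') /base_pair !add0n.
by case: (ltnP q.+1 _) => h; case: (ltnP q'.+1 _) => h' h1 h2 [E1 E2]; split; lia.
Qed.

Lemma transfer_inj : injective transfer.
Proof.
move=> [[j p] q] [[j' p'] q'] /=; case: ifPn => oq; case: ifPn => oq' //.
  case=> -> -> E; congr (_, _, _).
  by rewrite -(odd_double_half q) -(odd_double_half q') oq oq' E.
case; have /andP[h1 h2] := iter_turnP p j oq; have /andP[h1' h2'] := iter_turnP p' j' oq'.
move=> E1 E2; have [|-> E] := @iter_turn_inj p q p' q' j j' oq oq'.
  move: h1 h2 h1' h2' E1 E2; case: (iter j turn _) => X Y; case: (iter j' turn _) => X' Y' /=.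
  by move=> h1 h2 h1' h2' E1 E2; congr pair; lia.
by have [-> ->] := base_pair_inj oq oq' E.
Qed.

Lemma transfer_admissible i : (transfer i).1.1 = 0 -> (transfer i).2 < (transfer i).1.2.
Proof.
case: i => [[j p] q] /=; case: ifPn => oq //= _.
by have := iter_turnP p j oq; case: (iter j turn _) => X Y /=; lia.
Qed.

Lemma transfer_weight i : weight_squares (transfer i) = weight i.
Proof.
case: i => [[j p] q]; rewrite /transfer /weight_squares /weight; case: ifPn => oq /=.
  have -> : q.+1 = 2 * q./2.+1 by have := odd_double_half q; rewrite oq; lia.
  by congr (_ * _); rewrite expnMn; lia.
have /andP[h1 h2] := iter_turnP p j oq.
rewrite !prednK//; last by apply: leq_trans h2.
have -> : 4 * p.+1 ^ 2 + q.+1 ^ 2 = (base_pair p q).1 ^ 2 + (base_pair p q).2 ^ 2.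
  by rewrite /base_pair; case: ifP => _ /=; ring.
clear h1 h2; elim: j => [|j IH]; first by rewrite mul1n.
have /andP[h1 h2] := iter_turnP p j oq.
rewrite iterS (expnS 2 j) -mulnA -IH; move: (iter j turn _) h1 h2 => [X Y] /= h1 h2.
have [d ->] : exists d, X = d + Y by exists (X - Y); lia.
by rewrite addnK; ring.
Qed.

Lemma transfer_surjective c m n : (c = 0 -> n < m) -> exists i, transfer i = (c, m, n).
Proof.
case: c => [|c] h; last first.
  by exists (c, m, n.*2.+1); rewrite /= odd_double/= uphalf_double.
have {}h := h erefl.
suff [j [p [q [oq E]]]] : exists j p q, ~~ odd q /\ iter j turn (base_pair p q) = (m.+1, n.+1).
  by exists (j, p, q); rewrite /transfer (negbTE oq) E.
have : n.+1 < m.+1 by []. have : 0 < n.+1 by []. move: m.+1 n.+1 => X Y {h m n}.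
have [N] := ubnP (X + Y); elim: N X Y => // N IH X Y; rewrite ltnS => XYN Y0 YX.
have [oS|oS] := boolP (odd (X + Y)).
  exists 0; have [oY|oY] := boolP (odd Y).
    exists X./2.-1, Y.-1; split; first by rewrite -oddS prednK.
    have oX : ~~ odd X by move: oS; rewrite oddD oY addbT.
    have := odd_double_half X; rewrite (negbTE oX) add0n => E.
    rewrite /base_pair prednK// prednK; last by lia.
    by rewrite mul2n E YX.
  have oX : odd X by move: oS; rewrite oddD (negbTE oY) addbF.
  exists Y./2.-1, X.-1; split; first by rewrite -oddS prednK//; lia.
  have := odd_double_half Y; rewrite (negbTE oY) add0n => E.
  rewrite /base_pair prednK//; last by lia.
  rewrite prednK; last by lia.
  by rewrite mul2n E /= ltnNge (ltnW YX).
(* With equal parities, (X, Y) is the turn of the half sum and the half difference. These add up to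
   X, which is smaller than X + Y, so the induction proceeds. *)
have E : odd X = odd Y by move: oS; rewrite oddD; case: (odd X); case: (odd Y).
have EX := odd_double_half X; have EY := odd_double_half Y.
have [|||j [p [q [oq Eq]]]] := IH ((X + Y)./2) ((X - Y)./2).
- have e1 := odd_double_half (X + Y); have e2 := odd_double_half (X - Y).
  by move: e1 e2; rewrite oddB ?(ltnW YX)// oddD E; case: (odd Y) => /=; lia.
- have e2 := odd_double_half (X - Y).
  by move: e2; rewrite oddB ?(ltnW YX)// E; case: (odd Y) => /=; lia.
- have e1 := odd_double_half (X + Y); have e2 := odd_double_half (X - Y).
  by move: e1 e2; rewrite oddB ?(ltnW YX)// oddD E; case: (odd Y) => /=; lia.
exists j.+1, p, q; split => //=; rewrite Eq /turn/=.
have e1 := odd_double_half (X + Y); have e2 := odd_double_half (X - Y).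
move: e1 e2; rewrite oddB ?(ltnW YX)// oddD E; case: (odd Y) => /= e1 e2.
  by congr pair; lia.
by congr pair; lia.
Qed.

(** A weight at most N bounds each of the three indices by N. The resulting crude count (N + 1)^3 is
    the source of the third power in the growth hypothesis on the eigenvalues. *)
Lemma sorted_weights : exists e : nat -> nat * nat * nat,
  [/\ injective e, forall t, exists k, e k = t,
      {homo weight \o e : i j / i <= j} & forall k, k < (weight (e k)).+1 ^ 3].
Proof.
pose box N := [seq (jp, q) | jp <- [seq (j, p) | j <- iota 0 N.+1, p <- iota 0 N.+1], q <- iota 0 N.+1].
have box_uniq N : uniq (box N).
  by rewrite !allpairs_uniq ?iota_uniq// => -[? ?] [? ?] _ _ [-> ->].
have boxP i N : weight i <= N -> i \in box N.
  case: i => [[j p] q]; rewrite /weight/= => h.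
  have jN : j < 2 ^ j by exact: ltn_expl.
  have h2 : 0 < 2 ^ j by rewrite expn_gt0.
  have hS := leq_trans (leq_pmull _ h2) h; rewrite -!mulnn in hS h.
  have hK : 2 ^ j <= N by apply: leq_trans h; apply: leq_pmulr; rewrite addn_gt0.
  have io k : k <= N -> k \in iota 0 N.+1 by rewrite mem_iota.
  apply/allpairsP; exists ((j, p), q); split => //; last by apply: (io q); nia.
  by apply/allpairsP; exists (j, p); split => //; [apply: (io j); lia|apply: (io p); nia].
have xinj : injective (fun k : nat => (0, 0, k)) by move=> k l [].
have [e [e1 e2 e3 e4]] := sorted_enumeration box_uniq boxP xinj.
exists e; split => // k; have := e4 k; rewrite !size_allpairs !size_iota.
by rewrite !expnS expn0 muln1 mulnA.
Qed.

(** The index (0, 0, 0) has weight 5 and (0, 0, 1) has weight 8: this is the gap between the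
    exponents 5 pi^2 / 4 and 2 pi^2. *)
Lemma weight_min i : i != (0, 0, 0) -> 8 <= weight i.
Proof.
case: i => [[j p] q]; rewrite /weight/= => h.
have [jE|j0] := eqVneq j 0; last first.
  by have : 2 <= 2 ^ j; [rewrite -{1}(expn1 2) leq_exp2l// lt0n|nia].
subst j; have [qE|q0] := eqVneq q 0; last by nia.
subst q; by case: p h => // p _; nia.
Qed.
End modes_correspondence.

(** * Disjoint unions of rectangles and triangles *)

(** On a triangle, interchanging the frequencies amounts to the reflection up to sign, so m > n
    lists each mode once and m = n gives 0. *)
Lemma mode_swap (R : realType) m n (z : R * R) : mode true m n z = - (-1) ^+ (m + n) * mode true n m z.
Proof.
have sq k : (-1) ^+ k * (-1) ^+ k = 1 :> R by rewrite -expr2 sqrr_sign.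
rewrite /mode /reduced/= !sin_natpiB exprD !exprS.
have := sq m; have := sq n; move: ((-1) ^+ m) ((-1) ^+ n) (sin _) (sin _) (sin _) (sin _).
move=> s r x1 x2 x3 x4 rr ss.
have E (x y : R) : x - y = x * (s * s) * (r * r) - y by rewrite ss rr !mulr1.
by rewrite E; ring.
Qed.

Section union_of_components.
Variables (R : realType) (t : nat -> bool) (p e : nat -> R * R) (a b : nat -> R).
Hypotheses (ue : forall c, unit_vector (e c)) (a0 : forall c, 0 < a c) (b0 : forall c, 0 < b c)
  (tab : forall c, t c -> a c = b c).
Let P c := component (t c) (p c) (e c) (a c) (b c).
Let F c m n := sine_mode (t c) (p c) (e c) (a c) (b c) m n.
Variables (M : set (plane R)) (index : nat -> nat * nat * nat) (A : R).
Let lam k := frequency (a (index k).1.1) (b (index k).1.1) (index k).1.2 (index k).2.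
Hypotheses (MP : M = \bigcup_c P c) (tP : trivIset setT P) (aM : (area R M < +oo)%E)
  (index_inj : injective index)
  (index_adm : forall k, t (index k).1.1 -> ((index k).2 < (index k).1.2)%N)
  (index_surj : forall c m n, (t c -> n < m)%N -> exists k, index k = (c, m, n))
  (lam_mono : nondecreasing_seq lam) (A4 : 4 <= A)
  (growth : forall k, k.+1%:R <= A * (1 + lam k) ^+ 3).

Let phi k : plane R -> R := (F (index k).1.1 (index k).1.2 (index k).2) \_ (P (index k).1.1).
Let g1 k : plane R -> R := (partial1 (F (index k).1.1 (index k).1.2 (index k).2)) \_ (P (index k).1.1).
Let g2 k : plane R -> R := (partial2 (F (index k).1.1 (index k).1.2 (index k).2)) \_ (P (index k).1.1).

Let PM c : P c `<=` M. Proof. by rewrite MP => q Pq; exists c. Qed.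
Let mP c : measurable (P c : set (plane R)). Proof. exact: measurable_component. Qed.
Let mM : measurable M. Proof. by rewrite MP; apply: bigcupT_measurable => c; exact: mP. Qed.

Let Hphi k : H10_with_gradient M (phi k) (g1 k) (g2 k).
Proof. exact: (sine_mode_H10 (ue _) (a0 _) (b0 _) (@tab _) _ _ mM aM (@PM _)). Qed.

Let Hweak k psi : test_function M psi ->
  L2dot M (g1 k) (partial1 psi) + L2dot M (g2 k) (partial2 psi) =
  L2dot M (fun q => lam k * phi k q) psi.
Proof.
set c := (index k).1.1.
apply: (@sine_mode_weak _ _ _ _ _ _ (ue c) (a0 c) (b0 c) (@tab c) _ (\bigcup_(j in [set~ c]) P j)).
- by apply: bigcup_open => j _; exact: open_polygon.
- apply/seteqP; split => // q [Pq [j /= jc Pjq]].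
  by apply: jc; apply: (tP _ _) => //; exists q.
- rewrite MP; apply/seteqP; split => q.
    move=> [j _ Pq]; have [jc|jc] := eqVneq j c; first by left; move: Pq; rewrite jc.
    by right; exists j => //=; exact/eqP.
  by move=> [Pq|[j _ Pq]]; [exists c|exists j].
Qed.

Let Lphi k : inL2 M (phi k). Proof. by case: (Hphi k). Qed.

Let L2dot_component c c' (f g : plane R -> R) : L2dot M (f \_ (P c)) (g \_ (P c')) =
  if c == c' then L2dot (P c) f g else 0.
Proof.
rewrite /L2dot; case: eqP => [<-|cc'].
  rewrite [LHS]Rintegral_mkcond [RHS]Rintegral_mkcond; apply: eq_Rintegral => q _.
  rewrite !patchE; case: (boolP (q \in P c)) => [/set_mem Pq|_]; first by rewrite (mem_set (PM Pq)).
  by rewrite mulr0 if_same.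
transitivity (\int[area R]_(q in M) (cst 0 : _ -> R) q); last by rewrite Rintegral_cst// mul0r.
apply: eq_Rintegral => q _; rewrite !patchE; case: (boolP (q \in P c)) => [/set_mem Pq|_]; last by rewrite mul0r.
case: (boolP (q \in P c')) => [/set_mem Pq'|_]; last by rewrite mulr0.
by exfalso; apply: cc'; apply: (tP _ _) => //; exists q.
Qed.

Let Hon i j : L2dot M (phi i) (phi j) = (i == j)%:R.
Proof.
rewrite /phi L2dot_component; case: eqP => [cc|cc]; last first.
  by rewrite (_ : (i == j) = false)//; apply/eqP => ij; apply: cc; rewrite ij.
have adm : t (index i).1.1 -> ((index j).2 < (index j).1.2)%N by rewrite cc; exact: index_adm.
rewrite -cc (sine_mode_orthonormal _ (ue _) (a0 _) (b0 _) (@tab _) (@index_adm i) adm).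
congr (nat_of_bool _)%:R; rewrite -(inj_eq index_inj i j).
case: (index i) (index j) cc => [[c m] n] [[c' m'] n'] /= ->.
by rewrite !xpair_eqE eqxx.
Qed.

Let lam0 k : 0 <= lam k.
Proof. by rewrite mulr_ge0 ?sqr_ge0// addr_ge0// sqr_ge0. Qed.

Let bounds k q : [/\ `|phi k q| <= A * (1 + lam k) ^+ 2, `|g1 k q| <= A * (1 + lam k) ^+ 2
  & `|g2 k q| <= A * (1 + lam k) ^+ 2].
Proof.
have h0 : 0 <= (1 + lam k) ^+ 2 by exact: sqr_ge0.
have [h1 h2 h3] := sine_mode_bounds (p (index k).1.1) (ue (index k).1.1) (a0 (index k).1.1) (b0 (index k).1.1)
  (@tab (index k).1.1) (index k).1.2 (index k).2 q.
rewrite -/(lam k) in h1 h2 h3.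
have h4 : 4 * (1 + lam k) ^+ 2 <= A * (1 + lam k) ^+ 2 by exact: ler_wpM2r.
have h5 : 0 <= A * (1 + lam k) ^+ 2 by apply: le_trans h4; rewrite mulr_ge0.
have h6 : 2 * (1 + lam k) ^+ 2 <= A * (1 + lam k) ^+ 2.
  by apply: le_trans h4; apply: ler_wpM2r => //; rewrite ler_nat.
have patched (f : plane R -> R) c : `|f q| <= A * (1 + lam k) ^+ 2 ->
    `|(f \_ (P c)) q| <= A * (1 + lam k) ^+ 2.
  by rewrite patchE; case: ifP => _; rewrite ?normr0.
split; apply: patched; [exact: le_trans h1 h6|exact: le_trans h2 h4|exact: le_trans h3 h4].
Qed.

Let Hmode c m n : exists (x : R) (k : nat), forall q, M q ->
  ((mode (t c) m n \o angles (p c) (e c) (a c) (b c)) \_ (P c)) q = x * phi k q.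
Proof.
pose kap : R := 2 / Num.sqrt (a c * b c).
have k0 : kap != 0 by rewrite /kap mulf_neq0 ?invr_eq0 ?gt_eqF// sqrtr_gt0 mulr_gt0.
have direct m' n' : (t c -> n' < m')%N -> exists k, forall q, M q ->
    ((mode (t c) m' n' \o angles (p c) (e c) (a c) (b c)) \_ (P c)) q = kap^-1 * phi k q.
  move=> /index_surj[k ik]; exists k => q _; rewrite /phi ik/= !patchE; case: ifP => _; last by rewrite mulr0.
  by rewrite /F /sine_mode -/kap mulKf.
have [tc|tc] : ~~ t c \/ t c by case: (t c); [right|left].
  by have [|k hk] := direct m n; [rewrite (negbTE tc)|exists kap^-1, k].
(* Only the modes with n < m are listed on a triangle; by [mode_swap] one with m < n is a multiple
   of a listed mode, and one with m = n is zero. *)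
have [mn|nm|mn] := ltngtP m n.
- have [|k hk] := direct n m; first by [].
  exists (- (-1) ^+ (m + n) * kap^-1), k => q Mq; rewrite -mulrA -hk// !patchE.
  by case: ifP => _; rewrite ?mulr0//= tc; exact: mode_swap.
- by have [|k hk] := direct m n; [|exists kap^-1, k].
exists 0, 0%N => q _; rewrite mul0r patchE; case: ifP => _ //=; rewrite tc -mn.
have := mode_swap m m (angles (p c) (e c) (a c) (b c) q).
rewrite addnn -mul2n exprM sqrrN expr1n expr1n; lra.
Qed.

Let Hone := @one_expansion _ M P (fun c => angles (p c) (e c) (a c) (b c)) t phi mM aM mP MP tP
  (fun c => @measurable_angles _ (p c) (e c) (a c) (b c))
  (fun c q => (in_component (t c) (p c) (e c) (a c) (b c) q).1) Lphi Hon Hmode.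

Lemma union_eigenvalues : dirichlet_eigenvalues M lam.
Proof.
split => //; exists phi; split; last first.
  move=> k; split; first exact: inL2Z.
  by exists (g1 k), (g2 k); split => //; exact: Hweak.
split => // f Lf f0.
by apply: (@modes_complete _ M P (fun c => angles (p c) (e c) (a c) (b c))
  (fun c => of_angles (p c) (e c) (a c) (b c)) t phi mM aM mP MP
  (fun c => @measurable_angles _ (p c) (e c) (a c) (b c))
  (fun c => @measurable_of_angles _ (p c) (e c) (a c) (b c))
  (fun c q => anglesK (p c) (ue c) (a0 c) (b0 c) q)
  (fun c q => (in_component (t c) (p c) (e c) (a c) (b c) q).1) Lphi Hmode f Lf f0).
Qed.

Lemma union_heat_content (mu c s : R) : 0 < s -> (forall k, (0 < k)%N -> mu <= lam k) ->
  L2dot (P (index 0%N).1.1) (cst 1) (F (index 0%N).1.1 (index 0%N).1.2 (index 0%N).2) ^+ 2 = c ->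
  `|heat_content M s - c * expR (- (lam 0%N * s))| <= fine (area R M) * expR (- (mu * s)).
Proof.
move=> s0 hmu hc.
have ac : L2dot M (cst 1) (phi 0%N) ^+ 2 = c.
  rewrite -hc /L2dot; congr (_ ^+ 2); rewrite [LHS]Rintegral_mkcond [RHS]Rintegral_mkcond.
  apply: eq_Rintegral => q _; rewrite !patchE; rewrite /phi patchE; case: (boolP (q \in P (index 0%N).1.1)) => [Pq|_].
    by rewrite (mem_set (PM (set_mem Pq))).
  by rewrite mulr0 if_same.
have C := @heat_content_cvg _ M phi g1 g2 lam A mM aM Hphi Hweak Hon lam0
  (fun k q _ => let: And3 h _ _ := bounds k q in h)
  (fun k q _ => let: And3 _ h _ := bounds k q in h)
  (fun k q _ => let: And3 _ _ h := bounds k q in h) growth Hone s s0.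
have B := @bessel_one _ M phi g1 g2 mM aM Hphi Hon.
have C1 : `|\sum_(k < N) expR (- (lam k * s)) * L2dot M (cst 1) (phi k) ^+ 2
    - c * expR (- (lam 0%N * s))| @[N --> \oo] --> `|heat_content M s - c * expR (- (lam 0%N * s))|.
  by apply: cvg_norm; apply: cvgB; [exact: C|exact: cvg_cst].
apply: (cvgr_to_le C1); near=> N.
have N0 : (0 < N)%N by near: N; exact: nbhs_infty_gt.
have := B N; rewrite -(prednK N0) !big_ord_recl /= ac => BN.
rewrite [expR _ * c]mulrC addrAC subrr add0r.
have e0 : 0 <= expR (- (mu * s)) by exact: expR_ge0.
have c0 : 0 <= c by rewrite -ac sqr_ge0.
set S := \sum_(i < _) _ in BN; set S' := \sum_(i < _) _.
have S0 : 0 <= S' by apply: sumr_ge0 => i _; rewrite mulr_ge0 ?expR_ge0 ?sqr_ge0.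
rewrite (ger0_norm S0); apply: (@le_trans _ _ (S * expR (- (mu * s)))).
  rewrite /S mulr_suml; apply: ler_sum => i _; rewrite mulrC; apply: ler_wpM2l; first exact: sqr_ge0.
  by rewrite ler_expR lerN2 ler_wpM2r ?hmu// ltW.
by apply: ler_wpM2r => //; lra.
Unshelve. all: by end_near. Qed.

End union_of_components.

(** C and D are both instances: the components have areas 2^(1-j) in either case. [en] enumerates
    the common weights in increasing order, and [index] names the mode of the given set that carries
    the k-th weight. *)
Lemma union_spectrum (R : realType) (t : nat -> bool) (p e : nat -> R * R) (a b : nat -> R)
    (M : set (plane R)) (index en : nat -> nat * nat * nat) (c : R) :
  (forall j, unit_vector (e j)) -> (forall j, 0 < a j) -> (forall j, 0 < b j) ->
  (forall j, t j -> a j = b j) ->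
  M = \bigcup_j component (t j) (p j) (e j) (a j) (b j) ->
  trivIset setT (fun j => component (t j) (p j) (e j) (a j) (b j)) ->
  (forall j, area R (component (t j) (p j) (e j) (a j) (b j)) = (4 / (2 ^ j.+1)%:R)%:E) ->
  injective index -> (forall k, t (index k).1.1 -> ((index k).2 < (index k).1.2)%N) ->
  (forall j m n, (t j -> n < m)%N -> exists k, index k = (j, m, n)) ->
  injective en -> (forall i, exists k, en k = i) -> {homo weight \o en : i j / (i <= j)%N} ->
  (forall k, (k < (weight (en k)).+1 ^ 3)%N) ->
  (forall k, frequency (a (index k).1.1) (b (index k).1.1) (index k).1.2 (index k).2 =
    pi ^+ 2 / 4 * (weight (en k))%:R) ->
  (en 0%N = (0, 0, 0)%N -> let i := index 0%N in
    L2dot (component (t i.1.1) (p i.1.1) (e i.1.1) (a i.1.1) (b i.1.1)) (cst 1)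
      (sine_mode (t i.1.1) (p i.1.1) (e i.1.1) (a i.1.1) (b i.1.1) i.1.2 i.2) ^+ 2 = c) ->
  dirichlet_eigenvalues M (fun k => pi ^+ 2 / 4 * (weight (en k))%:R) /\
  exists K : R, forall s : R, 0 < s ->
    `|heat_content M s - c * expR (- (5 * pi ^+ 2 * s / 4))| <= K * expR (- (2 * pi ^+ 2 * s)).
Proof.
move=> ue a0 b0 tab MP tP aP iinj iadm isurj einj esurj emono egrowth freq mean.
have aM : (area R M < +oo)%E.
  rewrite MP; apply: (@le_lt_trans _ _ (\sum_(j <oo) (4 / (2 ^ j.+1)%:R)%:E)%E); last first.
    apply: le_lt_trans (epsilon_trick0 xpredT (ler0n R 4)) _; exact: ltry.
  rewrite (eq_eseriesr (g := fun j => area R (component (t j) (p j) (e j) (a j) (b j)))); last by [].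
  apply: measure_sigma_subadditive => //; first by move=> j; exact: measurable_component.
  by apply: bigcupT_measurable => j; exact: measurable_component.
(* So each eigenvalue is at least its weight, and the cubic count of the weights gives the required
   growth of the eigenvalues. *)
have pi2 : 1 <= pi ^+ 2 / 4 :> R by have := pi_ge2 R; nra.
have e0 : en 0%N = (0, 0, 0)%N.
  apply/eqP/negPn/negP => /weight_min; have [k ek] := esurj (0, 0, 0)%N.
  by have := emono _ _ (leq0n k); rewrite /= ek leqNgt => /negP h /(leq_trans _) h'; apply: h; exact: h'.
have w0 k : (0 < k)%N -> 2 * pi ^+ 2 <= pi ^+ 2 / 4 * (weight (en k))%:R :> R.
  move=> k0; have : (8 <= weight (en k))%N.
    by apply: weight_min; rewrite -e0 (inj_eq einj) -lt0n.
  by rewrite -(ler_nat R); have := sqr_ge0 (pi : R); nra.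
have lamE : (fun k => frequency (a (index k).1.1) (b (index k).1.1) (index k).1.2 (index k).2) =
    fun k => pi ^+ 2 / 4 * (weight (en k))%:R by apply/funext.
have mono : nondecreasing_seq (fun k => frequency (a (index k).1.1) (b (index k).1.1) (index k).1.2 (index k).2).
  by rewrite lamE => i j ij; apply: ler_wpM2l; [lra|rewrite ler_nat; exact: emono].
have growth k : k.+1%:R <= 4 * (1 + frequency (a (index k).1.1) (b (index k).1.1) (index k).1.2 (index k).2) ^+ 3.
  rewrite freq; have : (k.+1%:R : R) <= (1 + (weight (en k))%:R) ^+ 3.
    by rewrite [X in X ^+ 3]addrC natr1 -natrX ler_nat; exact: egrowth.
  have w1 : 0 <= (weight (en k))%:R :> R by [].
  have : (1 + (weight (en k))%:R) ^+ 3 <= (1 + pi ^+ 2 / 4 * (weight (en k))%:R) ^+ 3 :> R.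
    have w2 : (weight (en k))%:R <= pi ^+ 2 / 4 * (weight (en k))%:R :> R by exact: ler_peMl.
    by apply: lerXn2r; rewrite ?nnegrE; lra.
  have : 0 <= (1 + (weight (en k))%:R) ^+ 3 :> R by rewrite exprn_ge0//; lra.
  lra.
split.
  rewrite -lamE; exact: (union_eigenvalues ue a0 b0 tab MP tP aM iinj iadm isurj mono).
exists (fine (area R M)) => s s0.
have lam_ge k : (0 < k)%N -> 2 * pi ^+ 2 <=
    frequency (a (index k).1.1) (b (index k).1.1) (index k).1.2 (index k).2.
  by move=> k0; rewrite freq; exact: w0.
have := union_heat_content ue a0 b0 tab MP tP aM iinj iadm isurj (lexx 4) growth s0 lam_ge (mean e0).
rewrite freq e0.
have -> : 5 * pi ^+ 2 * s / 4 = pi ^+ 2 / 4 * (weight (0, 0, 0)%N)%:R * s.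
  by rewrite /weight/= mul1n; ring.
by [].
Qed.

(** * The spectra of the two sets and the leading coefficients *)

Lemma rectangle_component (R : realType) (p e : R * R) (a b : R) : unit_vector e -> 0 < a -> 0 < b ->
  [set q | exists x y : R, [/\ 0 < x < a, 0 < y < b & q = in_frame p e x y]] =
  component false p e a b.
Proof.
move=> ue a0 b0; apply/seteqP; split => q.
  by move=> [x [y [xa yb ->]]]; apply/component_frame => //; rewrite in_frameK.
have tab : false -> a = b by [].
move=> Pq; have [xa yb _] := (component_frame p e a0 b0 tab q).1 Pq.
by exists (frame_coord p e q).1, (frame_coord p e q).2; rewrite frame_coordK.
Qed.

Lemma triangle_component (R : realType) (p e : R * R) (l : R) : unit_vector e -> 0 < l ->
  [set q | exists x y : R, [/\ 0 < x, 0 < y, x + y < l & q = in_frame p e x y]] =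
  component true p e l l.
Proof.
move=> ue l0; apply/seteqP; split => q.
  move=> [x [y [x0 y0 xy ->]]]; apply/component_frame => //; rewrite in_frameK//=.
  by split; lra.
move=> Pq; have [/andP[x0 _] /andP[y0 _] xy] := (component_frame (t := true) p e l0 l0 (fun=> erefl) q).1 Pq.
by exists (frame_coord p e q).1, (frame_coord p e q).2; rewrite frame_coordK.
Qed.

Lemma powR_half_sqr (R : realType) j : (2 `^ (- (j%:R / 2))) ^+ 2 = 2 ^- j :> R.
Proof.
rewrite -powR_mulrn ?powR_ge0// -powRrM mulNr divfK ?pnatr_eq0//.
by rewrite powRN powR_mulrn.
Qed.

Lemma rectangles_spectrum (R : realType) (Rect : nat -> set (R * R)) (D : set (R * R))
    (en : nat -> nat * nat * nat) :
  (forall j, is_rectangle (2 `^ (- (j%:R / 2))) (2 * 2 `^ (- (j%:R / 2))) (Rect j)) ->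
  trivIset setT Rect -> D = \bigcup_j Rect j ->
  injective en -> (forall i, exists k, en k = i) -> {homo weight \o en : i j / (i <= j)%N} ->
  (forall k, (k < (weight (en k)).+1 ^ 3)%N) ->
  dirichlet_eigenvalues D (fun k => pi ^+ 2 / 4 * (weight (en k))%:R) /\
  exists K : R, forall s : R, 0 < s ->
    `|heat_content D s - 1152 / (9 * pi ^+ 4) * expR (- (5 * pi ^+ 2 * s / 4))| <=
    K * expR (- (2 * pi ^+ 2 * s)).
Proof.
move=> hR hRR -> einj esurj emono egrowth.
pose w j : R := 2 `^ (- (j%:R / 2)).
have w0 j : 0 < w j by rewrite powR_gt0.
have w2 j : w j ^+ 2 = 2 ^- j by exact: powR_half_sqr.
have bw0 j : 0 < 2 * w j by rewrite mulr_gt0.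
have /choice[pe hpe] : forall j, exists pe : (R * R) * (R * R),
    unit_vector pe.2 /\ Rect j = component false pe.1 pe.2 (w j) (2 * w j).
  move=> j; have [p [e [ue ->]]] := hR j; exists (p, e); split => //.
  exact: rectangle_component.
have ue j : unit_vector (pe j).2 := (hpe j).1.
have RE : Rect = fun j => component false (pe j).1 (pe j).2 (w j) (2 * w j).
  by apply/funext => j; exact: (hpe j).2.
rewrite RE in hRR *.
apply: (@union_spectrum _ (fun=> false) (fun j => (pe j).1) (fun j => (pe j).2) w (fun j => 2 * w j) _ en en) => //.
- move=> j; rewrite component_area//= mulrCA -expr2 w2 expnS natrM natrX; congr EFin.
  by field; rewrite expf_neq0.
- move=> k; case: (en k) => [[j m] n]; rewrite /frequency /weight/= natrM natrX.
  have -> : (m.+1%:R / w j) ^+ 2 = m.+1%:R ^+ 2 * 2 ^+ j :> R by rewrite expr_div_n w2 invrK.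
  have -> : (n.+1%:R / (2 * w j)) ^+ 2 = n.+1%:R ^+ 2 * 2 ^+ j / 4 :> R.
    by rewrite expr_div_n exprMn w2 invfM invrK; field.
  by rewrite natrD natrM !natrX; field.
move=> -> /=; rewrite mean_rectangle_mode//.
have -> : w 0%N = 1 by rewrite /w mul0r oppr0 powRr0.
by have := pi_gt0 R; move: pi => r r0; field; rewrite gt_eqF.
Qed.

Lemma squares_triangle_spectrum (R : realType) (Sq : nat -> set (R * R)) (T C : set (R * R))
    (en : nat -> nat * nat * nat) :
  (forall j, is_square (Sq j) /\ area R (Sq j) = (2 ^- j)%:E) ->
  is_right_isosceles_triangle T /\ area R T = 2%:E ->
  trivIset setT Sq -> (forall j, Sq j `&` T = set0) -> C = (\bigcup_j Sq j) `|` T ->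
  injective en -> (forall i, exists k, en k = i) -> {homo weight \o en : i j / (i <= j)%N} ->
  (forall k, (k < (weight (en k)).+1 ^ 3)%N) ->
  dirichlet_eigenvalues C (fun k => pi ^+ 2 / 4 * (weight (en k))%:R) /\
  exists K : R, forall s : R, 0 < s ->
    `|heat_content C s - 1024 / (9 * pi ^+ 4) * expR (- (5 * pi ^+ 2 * s / 4))| <=
    K * expR (- (2 * pi ^+ 2 * s)).
Proof.
move=> hS hT hSS hST hC einj esurj emono egrowth.
(* The triangle comes first, as in the numbering used by [transfer]. The side lengths are known only
   through the areas, hence the recorded squares: area 2 forces legs of square 4. *)
pose Q c := if c is j.+1 then Sq j else T.
pose r2 c : R := if c is j.+1 then 2 ^- j else 4.
have /choice[d hd] : forall c, exists d : (R * R) * (R * R) * R,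
    [/\ unit_vector d.1.2, 0 < d.2, d.2 ^+ 2 = r2 c &
        Q c = component (c == 0%N) d.1.1 d.1.2 d.2 d.2].
  case=> [|j].
    have [[l [p [e [l0 ue TE]]]] aT] := hT; exists ((p, e), l); rewrite /= -triangle_component//; split => //.
    move: aT; rewrite TE triangle_component// component_area//= => -[]; lra.
  have [[s [s0 [p [e [ue SE]]]]] aS] := hS j; exists ((p, e), s); rewrite /= -rectangle_component//; split => //.
  by move: aS; rewrite SE rectangle_component// component_area//= => -[].
have ue c : unit_vector (d c).1.2 by case: (hd c).
have s0 c : 0 < (d c).2 by case: (hd c).
have s2 c : (d c).2 ^+ 2 = r2 c by case: (hd c).
have QE : Q = fun c => component (c == 0%N) (d c).1.1 (d c).1.2 (d c).2 (d c).2.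
  by apply/funext => c; case: (hd c).
have CE : C = \bigcup_c Q c.
  rewrite hC; apply/seteqP; split => q.
    by move=> [[j _ Sjq]|Tq]; [exists j.+1|exists 0%N].
  by move=> [[|j] _ /= Qq]; [right|left; exists j].
have tQ : trivIset setT Q.
  move=> [|i] [|j] _ _ //= [q [q1 q2]].
  - by have : (Sq j `&` T) q by []; rewrite hST.
  - by have : (Sq i `&` T) q by []; rewrite hST.
  - by congr _.+1; apply: hSS => //; exists q.
rewrite CE; rewrite QE in tQ *.
(* The modes of C are listed by [transfer] in the order in which [en] lists those of D, so that both
   sets receive the same eigenvalue sequence. *)
apply: (@union_spectrum _ (fun c => c == 0%N) (fun c => (d c).1.1) (fun c => (d c).1.2)
  (fun c => (d c).2) (fun c => (d c).2) _ (transfer \o en) en) => //.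
- move=> c; rewrite component_area// -expr2 s2 /r2; case: c => [|j] /=.
    by rewrite expn1; congr EFin; field.
  by congr EFin; rewrite !expnS !natrM natrX; field; rewrite expf_neq0.
- by apply: inj_comp => //; exact: transfer_inj.
- by move=> k /eqP; exact: transfer_admissible.
- move=> c m n h; have [i Ei] := transfer_surjective (c := c) (m := m) (n := n) (fun h0 => h (introT eqP h0)).
  by have [k ek] := esurj i; exists k; rewrite /= ek.
- move=> k; rewrite -transfer_weight /=; case: (transfer (en k)) => [[c m] n].
  rewrite /frequency /weight_squares/= !expr_div_n s2 /r2; case: c => [|j].
    by rewrite natrD !natrX; field.
  by rewrite invrK natrM natrX natrM natrD !natrX; field.
move=> e0; rewrite /= e0 /=.
have hm := @mean_triangle_mode R true (d 0%N).1.1 (d 0%N).1.2 (d 0%N).2 (d 0%N).2 (ue _) (s0 _) (s0 _) (fun=> erefl) isT.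
by rewrite hm s2 /r2; have := pi_gt0 R; move: pi => r r0; field; rewrite gt_eqF.
Qed.

Lemma bound_bigO (R : realType) (f : R -> R) (K : R) :
  (forall s : R, 0 < s -> `|f s| <= K * expR (- (2 * pi ^+ 2 * s))) ->
  bigO_at_infinity f (fun s => expR (- (2 * pi ^+ 2 * s))).
Proof.
move=> fK; exists K; near=> s; rewrite [X in _ * X]ger0_norm ?expR_ge0//.
by apply: fK; near: s; exact: nbhs_pinfty_gt.
Unshelve. all: by end_near. Qed.

(** The difference of the exponents is 3 pi^2 / 4 >= 1, so the ratio of the leading exponential to
    the error is at least exp s >= 1 + s; a nonzero difference of coefficients would be unbounded
    against the error. *)
Lemma leading_coefficient_unique (R : realType) (f : R -> R) (c1 c2 K1 K2 : R) :
  (forall s : R, 0 < s -> `|f s - c1 * expR (- (5 * pi ^+ 2 * s / 4))| <= K1 * expR (- (2 * pi ^+ 2 * s))) ->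
  (forall s : R, 0 < s -> `|f s - c2 * expR (- (5 * pi ^+ 2 * s / 4))| <= K2 * expR (- (2 * pi ^+ 2 * s))) ->
  c1 = c2.
Proof.
move=> h1 h2; apply/eqP; rewrite -subr_eq0 -normr_eq0; apply/eqP.
set d := `|c1 - c2|; apply/eqP; rewrite eq_le normr_ge0 andbT leNgt; apply/negP => d0.
have pi2 : 4 <= pi ^+ 2 :> R by have := pi_ge2 R; nra.
have main (s : R) : 0 < s -> d * (1 + s) <= K1 + K2.
  move=> s0; have e2 := expR_gt0 (- (2 * pi ^+ 2 * s)).
  rewrite -(ler_pM2r e2); apply: (@le_trans _ _ (d * expR (- (5 * pi ^+ 2 * s / 4)))).
    rewrite -(mulrA d); apply: ler_wpM2l; first exact: ltW.
    apply: (@le_trans _ _ (expR s * expR (- (2 * pi ^+ 2 * s)))).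
      by apply: ler_wpM2r; [exact: ltW|exact: expR_ge1Dx].
    by rewrite -expRD ler_expR; nra.
  have := h1 s s0; have := h2 s s0; move: (expR _) (expR_gt0 (- (5 * pi ^+ 2 * s / 4))) (expR _) e2 => x x0 y y0 e2 e1.
  have -> : d * x = `|(f s - c2 * x) - (f s - c1 * x)|.
    by rewrite /d -{1}(gtr0_norm x0) -normrM; congr `|_|; ring.
  by rewrite mulrDl; apply: le_trans (ler_normB _ _) _; lra.
have K0 : 0 < K1 + K2 by apply: lt_le_trans (main 1 ltr01); rewrite mulr_gt0//; lra.
(* At this s the left-hand side is d + (K1 + K2), which is too large. *)
have := main ((K1 + K2) / d) (divr_gt0 K0 d0).
by rewrite mulrDr mulr1 mulrCA divff ?gt_eqF// mulr1; lra.
Qed.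

Theorem corollary8 (R : realType) (Sq : nat -> set (R * R)) (T : set (R * R))
    (Rect : nat -> set (R * R)) (C D : set (R * R))
    (hS : forall j, is_square (Sq j) /\ area R (Sq j) = (2 ^- j)%:E)
    (hT : is_right_isosceles_triangle T /\ area R T = 2%:E)
    (hSS : trivIset setT Sq)
    (hST : forall j, Sq j `&` T = set0)
    (hC : C = (\bigcup_j Sq j) `|` T)
    (hR : forall j, is_rectangle (2 `^ (- (j%:R / 2)))
                                 (2 * 2 `^ (- (j%:R / 2))) (Rect j))
    (hRR : trivIset setT Rect)
    (hD : D = \bigcup_j Rect j) :
  [/\ isospectral C D,
      ~ isoheat C D,
      bigO_at_infinity
        (fun t => heat_content C t
                  - 1024 / (9 * pi ^+ 4) * expR (- (5 * pi ^+ 2 * t / 4)))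
        (fun t => expR (- (2 * pi ^+ 2 * t)))
    & bigO_at_infinity
        (fun t => heat_content D t
                  - 1152 / (9 * pi ^+ 4) * expR (- (5 * pi ^+ 2 * t / 4)))
        (fun t => expR (- (2 * pi ^+ 2 * t)))].
Proof.
have [en [e1 e2 e3 e4]] := sorted_weights.
have [specC [KC hKC]] := squares_triangle_spectrum hS hT hSS hST hC e1 e2 e3 e4.
have [specD [KD hKD]] := rectangles_spectrum hR hRR hD e1 e2 e3 e4.
split; [|move=> CD|exact: bound_bigO hKC|exact: bound_bigO hKD].
  by exists (fun k => pi ^+ 2 / 4 * (weight (en k))%:R), (fun k => pi ^+ 2 / 4 * (weight (en k))%:R).
have hKD' (s : R) : 0 < s ->
    `|heat_content C s - 1152 / (9 * pi ^+ 4) * expR (- (5 * pi ^+ 2 * s / 4))| <= KD * expR (- (2 * pi ^+ 2 * s)).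
  by move=> s0; rewrite CD//; exact: hKD.
have /eqP := leading_coefficient_unique hKC hKD'.
rewrite (inj_eq (mulIf _)) ?eqr_nat// invr_eq0 mulf_neq0// expf_neq0// gt_eqF// pi_gt0//.
Qed.
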